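(* Let $p$ be a prime, $n$ a positive integer, $u\in\mathbb{Z}_p^\times$, and let $F_0$ be an abelian finite subgroup of $\mathbb{S}_n$. If $r_1$ is maximal such that $\widetilde{\mathcal{F}}_u(\mathbb{Q}_p(F_0),\widetilde{F_0},r_1)\neq\emptyset$ and if $\widetilde{F_1}$ belongs to this set, then, for an integer $r_2\geq 1$, $\widetilde{\mathcal{F}}_u(C_{\mathbb{D}_n^\times}(F_0),\widetilde{F_1},r_2)$ is non-empty if and only if $r_2$ divides $\dfrac{n}{[\mathbb{Q}_p(F_0):\mathbb{Q}_p]}$.
   Context: $\mathbb{D}_n$ is the central division algebra over $\mathbb{Q}_p$ of Hasse invariant $1/n$, $\mathcal{O}_n$ its maximal order, $\mathbb{S}_n=\mathcal{O}_n^\times$. $v$ is the unique valuation on $\mathbb{D}_n$ extending the $p$-adic valuation with $v(p)=1$, so $v(\mathbb{D}_n^\times)=\frac1n\mathbb{Z}$. $\mathbb{Q}_p(F_0)$ is the subfield of $\mathbb{D}_n$ generated by $F_0$ over $\mathbb{Q}_p$, $C_{\mathbb{D}_n^\times}(F_0)$ is the centralizer of $F_0$ in $\mathbb{D}_n^\times$, and $\widetilde{F_0}=F_0\times\langle pu\rangle\subset\mathbb{D}_n^\times$. $\widetilde{\mathcal{F}}_u(\mathbb{Q}_p(F_0),\widetilde{F_0},r_1)$ is the set of all subgroups $\widetilde{F_1}$ of $\mathbb{Q}_p(F_0)^\times$ which contain $\widetilde{F_0}$ as a subgroup of finite index, such that $v$ induces an injection $\widetilde{F_1}/\widetilde{F_0}\hookrightarrow\frac1n\mathbb{Z}/\mathbb{Z}$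 and $|\widetilde{F_1}/\widetilde{F_0}|=r_1$. ''$r_1$ maximal'' means that this set is non-empty for $r_1$ and empty for every $r>r_1$. $\widetilde{\mathcal{F}}_u(C_{\mathbb{D}_n^\times}(F_0),\widetilde{F_1},r_2)$ is the set of all subgroups $\widetilde{F_2}$ of $C_{\mathbb{D}_n^\times}(F_0)$ containing $\langle pu\rangle$ as a subgroup of finite index, such that $\widetilde{F_2}\cap\mathbb{Q}_p(F_0)^\times=\widetilde{F_1}$, $v$ induces an injection $\widetilde{F_2}/\widetilde{F_1}\hookrightarrow\frac1n\mathbb{Z}/v(\widetilde{F_1})$, and $|\widetilde{F_2}/\widetilde{F_1}|=r_2$. *)

(* Defs.v *)
From mathcomp Require Import all_boot all_order all_algebra all_field.
From mathcomp Require Import boolp classical_sets functions cardinality.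

Set Implicit Arguments.
Unset Strict Implicit.
Unset Printing Implicit Defensive.

Import Order.TTheory GRing.Theory Num.Theory.
Local Open Scope classical_set_scope.
Local Open Scope ring_scope.

(* Additive valuations take values in rat and are only meaningful on nonzero
   elements; v 0 stands for +oo, which [vge] and [vgt] take into account. *)
Section Valuations.
Variables (A : unitRingType) (v : A -> rat).

Definition vge (r : rat) (x : A) : Prop := x = 0 \/ r <= v x.
Definition vgt (r : rat) (x : A) : Prop := x = 0 \/ r < v x.

Record is_valuation : Prop := {
  valuationM : forall x y, x != 0 -> y != 0 -> v (x * y) = v x + v y;
  valuationD : forall x y, x != 0 -> y != 0 -> x + y != 0 ->
    Num.min (v x) (v y) <= v (x + y) }.

Definition val_ring : set A := [set x | vge 0 x].

End Valuations.

Definition ring_units (A : unitRingType) (O : set A) : set A :=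
  [set x | [/\ x \is a GRing.unit, O x & O x^-1]].

Definition rat_integers : set rat := range (fun z : int => z%:~R).

Definition rat_fracs (n : nat) : set rat :=
  range (fun z : int => z%:~R / n%:R).

Definition padic_val (p : nat) (q : rat) : rat :=
  (logn p `|numq q|%N)%:R - (logn p `|denq q|%N)%:R.

(* (K, vp) is the field of p-adic numbers with its p-adic valuation: the
   completion of the rationals for the p-adic valuation.  It is unique up to
   a unique isomorphism of valued fields. *)
Record is_padic_field (p : nat) (K : fieldType) (vp : K -> rat) : Prop := {
  padic_char0 : [pchar K] =i pred0;
  padic_valuation : is_valuation vp;
  padic_extends : forall q : rat, q != 0 -> vp (ratr q) = padic_val p q;
  padic_dense : forall (x : K) (N : rat), exists q : rat, vge vp N (x - ratr q);
  padic_complete : forall s : nat -> K,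
    (forall N : rat, exists m0 : nat, forall i j : nat,
        (m0 <= i)%N -> (m0 <= j)%N -> vge vp N (s i - s j)) ->
    exists l : K, forall N : rat, exists m0 : nat, forall i : nat,
        (m0 <= i)%N -> vge vp N (s i - l) }.

Section DivisionAlgebra.
Variables (p : nat) (K : fieldType) (vp : K -> rat).
Variables (D : falgType K) (v : D -> rat).

Definition extends_valuation : Prop :=
  is_valuation v /\ forall x : K, x != 0 -> v x%:A = vp x.

Definition is_division : Prop := forall x : D, x != 0 -> x \is a GRing.unit.

Definition is_central : Prop := ('Z({:D}) = 1)%VS.

(* L is a commutative subfield with ramification index 1 over K; as the residue
   field of K is finite, this says that L is unramified. *)
Definition unramified_subfield (L : {aspace D}) : Prop :=
  [/\ 1 \in L, {in L &, forall x y, x * y = y * x} &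
      {in L, forall x, x != 0 -> rat_integers (v x)}].

(* Conjugation by g is the Frobenius automorphism of L over K, that is, the
   one that induces x |-> x ^ p on the residue field of L. *)
Definition conj_Frobenius (L : {aspace D}) (g : D) : Prop :=
  {in L, forall x, g * x * g^-1 \in L /\
                   (vge v 0 x -> vgt v 0 (g * x * g^-1 - x ^+ p))}.

(* The Hasse invariant is the class in Q/Z of v(g), where conjugation by g is
   the Frobenius automorphism of a maximal subfield that is unramified. *)
Definition has_Hasse_invariant (r : rat) : Prop :=
  exists (L : {aspace D}) (g : D),
    [/\ unramified_subfield L, (\dim L ^ 2 = \dim {:D})%N,
        g \is a GRing.unit, conj_Frobenius L g & rat_integers (v g - r)].

(* The dimension is determined by the invariant 1/n. *)
Record is_Dn (n : nat) : Prop := {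
  Dn_division : is_division;
  Dn_central : is_central;
  Dn_dim : \dim {:D} = (n ^ 2)%N;
  Dn_invariant : has_Hasse_invariant n%:R^-1 }.

(* Orders over the valuation ring of K: subrings that are finitely generated
   submodules spanning D. *)
Record is_order (O : set D) : Prop := {
  order1 : O 1;
  orderB : forall x y, O x -> O y -> O (x - y);
  orderM : forall x y, O x -> O y -> O (x * y);
  order_lattice : exists (m : nat) (b : m.-tuple D), <<b>>%VS = fullv /\
    O = [set x | exists2 a : 'I_m -> K, (forall i, val_ring vp (a i)) &
                   x = \sum_(i < m) a i *: tnth b i] }.

Definition is_maximal_order (O : set D) : Prop :=
  is_order O /\ forall O' : set D, is_order O' -> O `<=` O' -> O' = O.

Record is_subgroup (H : set D) : Prop := {
  subgroup_unit : forall x, H x -> x \is a GRing.unit;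
  subgroup1 : H 1;
  subgroupM : forall x y, H x -> H y -> H (x * y);
  subgroupV : forall x, H x -> H x^-1 }.

Definition cyclic_subgroup (x : D) : set D := range (fun k : int => x ^ k).

Definition prod_set (G H : set D) : set D := [set x * y | x in G & y in H].

Definition lcosets (G H : set D) : set (set D) :=
  [set [set x * h | h in H] | x in G].

Definition finite_index_subgroup (H G : set D) : Prop :=
  [/\ is_subgroup H, H `<=` G & finite_set (lcosets G H)].

Definition index_is (G H : set D) (r : nat) : Prop :=
  (lcosets G H #= `I_r)%card.

(* v induces a well-defined injective map G / H -> A / B. *)
Definition v_injects (G H : set D) (A B : set rat) : Prop :=
  (forall x, G x -> A (v x)) /\
  (forall x y, G x -> G y -> (B (v x - v y) <-> H (y^-1 * x))).

(* The subalgebra generated by F; it is a subfield when D is a division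
   algebra and the elements of F commute. *)
Definition adjoin (F : seq D) : {aspace D} := <<1 & F>>%AS.

Definition adjoin_units (F : seq D) : set D :=
  [set x | x \in adjoin F /\ x \is a GRing.unit].

Definition centralizer_units (F : seq D) : set D :=
  [set x | x \is a GRing.unit /\ {in F, forall f, x * f = f * x}].

Definition pu_elt (u : K) : D := (p%:R * u)%:A.

Definition tilde (u : K) (F : seq D) : set D :=
  prod_set [set` F] (cyclic_subgroup (pu_elt u)).

(* The set ~F_u(Q_p(F0), ~F0, r). *)
Definition Ftilde_field (n : nat) (u : K) (F0 : seq D) (r : nat) :
    set (set D) :=
  [set F1 | [/\ is_subgroup F1,
                F1 `<=` adjoin_units F0,
                finite_index_subgroup (tilde u F0) F1,
                v_injects F1 (tilde u F0) (rat_fracs n) rat_integers &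
                index_is F1 (tilde u F0) r]].

(* The set ~F_u(C(F0), ~F1, r). *)
Definition Ftilde_centralizer (n : nat) (u : K) (F0 : seq D) (F1 : set D)
    (r : nat) : set (set D) :=
  [set F2 | [/\ is_subgroup F2 /\ F2 `<=` centralizer_units F0,
                finite_index_subgroup (cyclic_subgroup (pu_elt u)) F2,
                F2 `&` adjoin_units F0 = F1,
                v_injects F2 F1 (rat_fracs n) (v @` F1) &
                index_is F2 F1 r]].

End DivisionAlgebra.

(* Main.v *)
(** Write [L = Qp(F0)], [d = dim L], and let [x1] be an element of [F1] of valuation [1/r1].

    If [F2] belongs to the second family, an element [x] of [F2] of minimal positive valuation
    commutes with [L] and [a = x ^ r2] lies in [F1], with [v a = 1/r1].  By maximality of [r1],
    [a] is not a [j]-th power in [L] for any [j > 1].  By Capelli's criterion, [x ^ (r2 / q ^ c)]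
    then generates an extension of [L] of degree [q ^ c] for each prime power [q ^ c] dividing
    [r2] exactly, and the dimension of a subfield divides [n].  The exceptional case
    [a = - 4 b ^ 4] is absorbed by maximality when [-1] is in [F0]; otherwise [F0] is cyclic of
    odd order, a power of [b] has its fourth power in [Qp] but not its square, and since [L] is
    normal over [Qp] it contains a square root of [-1], so that [a] is a square.

    Conversely, if [r2 * d] divides [n], adjoining prime roots one at a time gives [x] in the
    centraliser of [L] with [x ^ r2 = x1], and [F2 = F0 <x>].  The point is that for a prime [q]
    dividing [n / d] each nonzero [a] in [L] has a [q]-th root in the centraliser of [L].  Instead
    of appealing to Brauer groups, this is proved by successive approximation: [D] is described
    modulo larger valuations by a root of unity [om] and a uniformiser [g] with
    [g om g^-1 = om ^ p], an approximate root is found in the centraliser, and a noncommutative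
    form of Hensel's lemma refines it.  For [q = p] the approximation uses traces of
    conjugations below the critical level [p / (p - 1)] and an Artin-Schreier equation at it. *)

From HB Require Import structures.
Require Import Defs.
From mathcomp Require Import all_boot all_order all_algebra all_field cyclic.
From mathcomp Require Import boolp classical_sets functions cardinality.
From mathcomp Require Import ring lra zify.

Set Implicit Arguments.
Unset Strict Implicit.
Unset Printing Implicit Defensive.

Import Order.TTheory GRing.Theory Num.Theory.
Local Open Scope ring_scope.

(** * Valued division rings *)

(** Values lie in [(1/n) Z] and elements of [F1] of valuation 0 lie in [F0]; hence [F1] is [F0 <x1>]
    with [x1 ^ r1 = f1 * pu], [f1] in [F0]. Maximality of [r1] then says that no element of [F1] of
    valuation [1/r1] is a proper power in [L]. The double centraliser theorem is replaced by a
    count: residues and values bound [dim L] and [dim C(L)] by numbers with product [n ^ 2], and an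
    elementary [dim D <= dim L * dim C(L)] forces equality. So [dim L] divides [n], and [C(L)]
    realises every residue and value that the bounds allow. Extraction of roots has to accept an [a]
    that is already a power in [L]: then the degree drops and [L] stays; otherwise [L] grows by
    exactly the factor by which the degree drops. The differential of [y ^ q] at [y] is the sum of
    the [y ^ i * h * y ^ (q - 1 - i)]. It is [q h y ^ (q - 1)] only if [h] commutes with [y]; for
    [q = p] that would be too small, but for suitable [h] in [C(L)] the sum is a trace, which does
    not degenerate. This noncommutativity is what produces p-th roots. At [v y = 1/(p - 1)] the
    terms [p * y] and [y ^ p] have the same valuation [p/(p - 1)], whence the critical level. *)

Definition valued_division (A : unitRingType) (v : A -> rat) : Prop :=
  is_valuation v /\ forall x : A, x != 0 -> x \is a GRing.unit.

Section ValuationTheory.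
Variables (A : unitRingType) (v : A -> rat).
Hypothesis hvd : valued_division v.
Let hv := hvd.1.
Let hdiv := hvd.2.
Implicit Types (x y : A) (r s : rat).

Lemma mul_neq0 x y : x != 0 -> y != 0 -> x * y != 0.
Proof. by move=> hx hy; rewrite (mulrI_eq0 _ (mulrI (hdiv hx))). Qed.

Lemma inv_neq0 x : x != 0 -> x^-1 != 0.
Proof. by move=> hx; rewrite invr_eq0. Qed.

Lemma exp_neq0 x k : x != 0 -> x ^+ k != 0.
Proof. by move=> hx; elim: k => [|k IH]; rewrite ?expr0 ?oner_neq0 // exprS mul_neq0. Qed.

Lemma v1 : v 1 = 0.
Proof.
have := valuationM hv (oner_neq0 A) (oner_neq0 A); rewrite mulr1 => h.
by apply: (addrI (v 1)); rewrite addr0 -h.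
Qed.

Lemma vV x : x != 0 -> v x^-1 = - v x.
Proof.
move=> hx; apply: (addrI (v x)); rewrite subrr -valuationM // ?inv_neq0 //.
by rewrite mulrV ?v1 // hdiv.
Qed.

Lemma vX x k : x != 0 -> v (x ^+ k) = v x *+ k.
Proof.
move=> hx; elim: k => [|k IH]; first by rewrite expr0 v1.
by rewrite exprS valuationM ?exp_neq0 // IH mulrS.
Qed.

Lemma vN1 : v (-1) = 0.
Proof.
have h1 : (-1 : A) != 0 by rewrite oppr_eq0 oner_neq0.
have := vX 2 h1; rewrite sqrrN expr1n v1 => /esym/eqP.
by rewrite mulrn_eq0 /= => /eqP.
Qed.

Lemma vN x : v (- x) = v x.
Proof.
have [->|hx] := eqVneq x 0; first by rewrite oppr0.
by rewrite -mulN1r valuationM ?oppr_eq0 ?oner_neq0 // vN1 add0r.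
Qed.

Lemma vge_le r s x : s <= r -> vge v r x -> vge v s x.
Proof. by move=> h [->|hx]; [left|right; apply: le_trans h hx]. Qed.

Lemma vgt_le r s x : s <= r -> vgt v r x -> vgt v s x.
Proof. by move=> h [->|hx]; [left|right; apply: le_lt_trans h hx]. Qed.

Lemma vgtW r x : vgt v r x -> vge v r x.
Proof. by move=> [->|hx]; [left|right; apply: ltW]. Qed.

Lemma vge_gt r s x : s < r -> vge v r x -> vgt v s x.
Proof. by move=> h [->|hx]; [left|right; apply: lt_le_trans h hx]. Qed.

Lemma vge0 r : vge v r 0. Proof. by left. Qed.
Lemma vge_refl x : vge v (v x) x. Proof. by right. Qed.
Lemma vge1 : vge v 0 1. Proof. by right; rewrite v1. Qed.

Lemma vgeN r x : vge v r x -> vge v r (- x).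
Proof. by move=> [->|hx]; [rewrite oppr0; left|right; rewrite vN]. Qed.

Lemma vgtN r x : vgt v r x -> vgt v r (- x).
Proof. by move=> [->|hx]; [rewrite oppr0; left|right; rewrite vN]. Qed.

Lemma vgeD r x y : vge v r x -> vge v r y -> vge v r (x + y).
Proof.
have [->|x0] := eqVneq x 0; first by rewrite add0r.
have [->|y0] := eqVneq y 0; first by rewrite addr0.
have [->|xy0] := eqVneq (x + y) 0; first by left.
move=> [/eqP|hx]; first by rewrite (negPf x0).
move=> [/eqP|hy]; first by rewrite (negPf y0).
right; apply: le_trans (valuationD hv x0 y0 xy0).
by rewrite le_min hx hy.
Qed.

Lemma vgtD r x y : vgt v r x -> vgt v r y -> vgt v r (x + y).
Proof.
have [->|x0] := eqVneq x 0; first by rewrite add0r.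
have [->|y0] := eqVneq y 0; first by rewrite addr0.
have [->|xy0] := eqVneq (x + y) 0; first by left.
move=> [/eqP|hx]; first by rewrite (negPf x0).
move=> [/eqP|hy]; first by rewrite (negPf y0).
right; apply: lt_le_trans (valuationD hv x0 y0 xy0).
by rewrite lt_min hx hy.
Qed.

Lemma vgeB r x y : vge v r x -> vge v r y -> vge v r (x - y).
Proof. by move=> hx hy; apply: vgeD => //; apply: vgeN. Qed.

Lemma vgtB r x y : vgt v r x -> vgt v r y -> vgt v r (x - y).
Proof. by move=> hx hy; apply: vgtD => //; apply: vgtN. Qed.

Lemma vgtC r x y : vgt v r (x - y) -> vgt v r (y - x).
Proof. by move/vgtN; rewrite opprB. Qed.

Lemma vgt_trans r y x z : vgt v r (x - y) -> vgt v r (y - z) -> vgt v r (x - z).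
Proof. by move=> h1 h2; have := vgtD h1 h2; rewrite addrA subrK. Qed.

Lemma vgeM r s x y : vge v r x -> vge v s y -> vge v (r + s) (x * y).
Proof.
have [->|x0] := eqVneq x 0; first by rewrite mul0r; left.
have [->|y0] := eqVneq y 0; first by rewrite mulr0; left.
move=> [/eqP|hx]; first by rewrite (negPf x0).
move=> [/eqP|hy]; first by rewrite (negPf y0).
by right; rewrite valuationM // lerD.
Qed.

Lemma vgtM r s x y : vge v r x -> vgt v s y -> vgt v (r + s) (x * y).
Proof.
have [->|x0] := eqVneq x 0; first by rewrite mul0r; left.
have [->|y0] := eqVneq y 0; first by rewrite mulr0; left.
move=> [/eqP|hx]; first by rewrite (negPf x0).
move=> [/eqP|hy]; first by rewrite (negPf y0).
by right; rewrite valuationM // ler_ltD.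
Qed.

Lemma vgtMr r s x y : vgt v r x -> vge v s y -> vgt v (r + s) (x * y).
Proof.
have [->|x0] := eqVneq x 0; first by rewrite mul0r; left.
have [->|y0] := eqVneq y 0; first by rewrite mulr0; left.
move=> [/eqP|hx]; first by rewrite (negPf x0).
move=> [/eqP|hy]; first by rewrite (negPf y0).
by right; rewrite valuationM // ltr_leD.
Qed.

Lemma vgeX r x k : vge v r x -> vge v (r *+ k) (x ^+ k).
Proof.
by move=> hx; elim: k => [|k IH]; [exact: vge1|rewrite exprS mulrS; apply: vgeM].
Qed.

Lemma vge_sum (I : Type) (s : seq I) (P : pred I) r (F : I -> A) :
  (forall i, P i -> vge v r (F i)) -> vge v r (\sum_(i <- s | P i) F i).
Proof. by move=> h; apply: (big_ind (fun x => vge v r x)) => //; [left|exact: vgeD]. Qed.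

Lemma vgt_sum (I : Type) (s : seq I) (P : pred I) r (F : I -> A) :
  (forall i, P i -> vgt v r (F i)) -> vgt v r (\sum_(i <- s | P i) F i).
Proof. by move=> h; apply: (big_ind (fun x => vgt v r x)) => //; [left|exact: vgtD]. Qed.

Lemma vge_nat k : vge v 0 k%:R.
Proof.
elim: k => [|k IH]; first by left.
by rewrite mulrS; apply: vgeD => //; exact: vge1.
Qed.

Lemma vgt_irrefl x : x != 0 -> ~ vgt v (v x) x.
Proof. by move=> x0 [/eqP|]; [rewrite (negPf x0)|rewrite ltxx]. Qed.

(** The isosceles property of a non-archimedean valuation; leading terms determine valuations
    through it. *)
Lemma vgt_close x y : x != 0 -> vgt v (v x) (y - x) -> y != 0 /\ v y = v x.
Proof.
move=> x0 h.
have y0 : y != 0.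
  by apply/eqP => y0; move: h; rewrite y0 sub0r => /vgtN; rewrite opprK; apply: vgt_irrefl.
split => //; apply: le_anti; apply/andP; split.
  rewrite leNgt; apply/negP => hlt.
  apply: (vgt_irrefl x0); rewrite -{2}(subKr y x); apply: vgtB => //; by right.
have : vge v (v x) y by rewrite -(subrK x y); apply: vgeD; [apply: vgtW|right].
by case=> // /eqP; rewrite (negPf y0).
Qed.

Lemma vge_val r x : x != 0 -> vge v r x -> r <= v x.
Proof. by move=> x0 [/eqP|//]; rewrite (negPf x0). Qed.

Lemma vgt_val r x : x != 0 -> vgt v r x -> r < v x.
Proof. by move=> x0 [/eqP|//]; rewrite (negPf x0). Qed.

Lemma not_vge r x : ~ vge v r x -> x != 0 /\ v x < r.
Proof.
move=> h; split; first by apply/eqP => x0; apply: h; left.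
by rewrite ltNge; apply/negP => h'; apply: h; right.
Qed.

Lemma not_vgt r x : ~ vgt v r x -> x != 0 /\ v x <= r.
Proof.
move=> h; split; first by apply/eqP => x0; apply: h; left.
by rewrite leNgt; apply/negP => h'; apply: h; right.
Qed.

Lemma vge_mull x y r : x != 0 -> vge v (v x + r) (x * y) -> vge v r y.
Proof.
move=> x0 h; have := vgeM (vge_refl x^-1) h.
by rewrite vV // addrA addNr add0r mulKr // hdiv.
Qed.

Lemma vgt_mulr x y r : x != 0 -> vgt v (r + v x) (y * x) -> vgt v r y.
Proof.
move=> x0 h; have := vgtMr h (vge_refl x^-1).
by rewrite vV // addrK mulrK // hdiv.
Qed.

Lemma vge_all x : (forall k : nat, vge v k%:R x) -> x = 0.
Proof.
move=> h; apply/eqP/negP => /negP x0.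
have := vge_val x0 (h (Num.bound `|v x|)).
rewrite leNgt => /negP; apply.
by apply: le_lt_trans (ler_norm _) _; rewrite archi_boundP ?normr_ge0.
Qed.

Lemma vgt_exp x y k : vge v 0 x -> vgt v 0 (y - x) -> vgt v 0 (y ^+ k - x ^+ k).
Proof.
move=> hx hy.
have hy0 : vge v 0 y by rewrite -(subrK x y); apply: vgeD => //; apply: vgtW.
elim: k => [|k IH]; first by rewrite subrr; left.
rewrite !exprS -(subrK (y * x ^+ k) (y * y ^+ k)) -mulrBr -addrA -mulrBl -[0]addr0.
apply: vgtD; first exact: vgtM.
by apply: vgtMr => //; have := vgeX k hx; rewrite mul0rn.
Qed.

Lemma vgt_mul2 x x' y y' : vge v 0 x -> vge v 0 y' -> vgt v 0 (x - x') -> vgt v 0 (y - y') ->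
  vgt v 0 (x * y - x' * y').
Proof.
move=> hx hy' h1 h2.
rewrite -(subrK (x * y') (x * y)) -mulrBr -addrA -mulrBl -[0]addr0.
by apply: vgtD; [apply: vgtM|apply: vgtMr].
Qed.

Lemma vgt_vge x y : vge v 0 x -> vgt v 0 (y - x) -> vge v 0 y.
Proof. by move=> hx hy; rewrite -(subrK x y); apply: vgeD => //; apply: vgtW. Qed.

Lemma v_conj x y : x != 0 -> y != 0 -> v (x * y * x^-1) = v y.
Proof. by move=> x0 y0; rewrite !valuationM ?vV ?mul_neq0 ?inv_neq0 // addrAC subrr add0r. Qed.

End ValuationTheory.

(** * The p-adic field: integral values and digits *)

Section PadicField.
Variables (p : nat) (K : fieldType) (vp : K -> rat).
Hypotheses (hp : prime p) (hK : is_padic_field p vp).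

Lemma padic_valued : valued_division vp.
Proof. by split; [exact: padic_valuation hK|move=> x; rewrite unitfE]. Qed.

Let hv := padic_valued.

Lemma natK_neq0 k : (0 < k)%N -> (k%:R : K) != 0.
Proof. by move=> hk; rewrite ((pcharf0P K).1 (padic_char0 hK)) -lt0n. Qed.

Lemma vp_nat k : (0 < k)%N -> vp k%:R = (logn p k)%:R.
Proof.
move=> hk; have := padic_extends hK (q := k%:R); rewrite ratr_nat => -> //.
  rewrite /padic_val; have -> : (k%:R : rat) = (k%:Z)%:~R by [].
  by rewrite numq_int denq_int /= logn1 subr0.
by rewrite pnatr_eq0 -lt0n.
Qed.

Lemma vp_p : vp p%:R = 1.
Proof. by rewrite vp_nat ?prime_gt0 // lognE hp prime_gt0 //= dvdnn divnn prime_gt0 //= logn1. Qed.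

Lemma vp_coprime k : ~~ (p %| k)%N -> vp k%:R = 0.
Proof.
case: k => [|k] h; first by rewrite dvdn0 in h.
by rewrite vp_nat // lognE hp /= (negPf h).
Qed.

Lemma vge1_nat k : vge vp 1 (k%:R : K) -> (p %| k)%N.
Proof.
case: k => [|k]; first by rewrite dvdn0.
move=> /(vge_val (natK_neq0 (ltn0Sn k))); rewrite vp_nat // ler1n.
by rewrite logn_gt0 mem_primes => /and3P[].
Qed.

Lemma dvd_vge1 (A : unitRingType) (v : A -> rat) k : valued_division v ->
  vge v 1 p%:R ->
  (p %| k)%N -> vge v 1 (k%:R : A).
Proof.
move=> hv' h /dvdnP[c ->]; rewrite natrM -[1%R : rat]add0r.
by apply: (vgeM hv') => //; apply: (vge_nat hv').
Qed.

(** A rational approximation with error of valuation above [vp x] has the valuation of [x], and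
    rationals have integral valuation. *)
Lemma vp_int x : x != 0 -> exists z : int, vp x = z%:~R.
Proof.
move=> x0; have [q hq] := padic_dense hK x (vp x + 1).
have [||y0 hy] := vgt_close hv (x := x) (y := ratr q) => //.
  by apply: (vgtC hv); apply: vge_gt hq; rewrite ltrDl.
have q0 : q != 0 by apply: contraNneq y0 => ->; rewrite /ratr /= mul0r.
rewrite -hy (padic_extends hK q0) /padic_val.
exists ((logn p `|numq q|)%:Z - (logn p `|denq q|)%:Z); by rewrite intrB.
Qed.

Lemma vge0_int (z : int) : vge vp 0 (z%:~R : K).
Proof.
case: z => k; first exact: (vge_nat hv).
by rewrite NegzE mulrNz; apply: (vgeN hv); exact: (vge_nat hv).
Qed.

Lemma vge1_int (z : int) : (p %| z)%Z -> vge vp 1 (z%:~R : K).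
Proof.
move=> /dvdzP[c ->]; rewrite intrM -[1%R : rat]add0r.
by apply: (vgeM hv) => //; [exact: vge0_int|right; rewrite vp_p].
Qed.

Lemma intK_abs (z : int) : (z%:~R : K) = `|z|%N%:R \/ (z%:~R : K) = - `|z|%N%:R.
Proof.
case: z => k; [by left|right].
by rewrite NegzE mulrNz abszN.
Qed.

Lemma intK_neq0 (z : int) : z != 0 -> (z%:~R : K) != 0.
Proof.
rewrite -absz_gt0 => /natK_neq0 h.
by case: (intK_abs z) => ->; rewrite ?oppr_eq0.
Qed.

Lemma vp_absz (z : int) : vp (z%:~R) = vp (`|z|%N%:R).
Proof. by case: (intK_abs z) => ->; rewrite ?(vN hv). Qed.

(** The residue field of [K] is the prime field: by density the claim concerns a rational number,
    whose denominator is prime to [p] because it is integral. *)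
Lemma padic_digit x : vge vp 0 x -> exists2 c : nat, (c < p)%N & vge vp 1 (x - c%:R).
Proof.
move=> hx; have [q hq] := padic_dense hK x 1.
suff [c hc h] : exists2 c : nat, (c < p)%N & vge vp 1 (ratr q - c%:R : K).
  by exists c => //; have := vgeD hv hq h; rewrite addrA subrK.
have hq0 : vge vp 0 (ratr q : K).
  rewrite -(subKr x (ratr q)); apply: (vgeB hv) => //.
  by apply: vge_le hq.
have [q0|q0] := eqVneq q 0.
  exists 0%N; first exact: prime_gt0.
  by left; rewrite q0 /ratr /= mul0r subr0.
have den0 : (denq q)%:~R != 0 :> K by rewrite intK_neq0 ?denq_neq0.
have npd : ~~ (p %| `|denq q|)%N.
  apply/negP => pd.
  have pn : ~~ (p %| `|numq q|)%N.
    apply/negP => pn; have := coprime_num_den q.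
    rewrite /coprime => /eqP h; have : (p %| 1)%N by rewrite -h dvdn_gcd pn pd.
    by rewrite dvdn1 => /eqP p1; move: hp; rewrite p1.
  have r0 : (ratr q : K) != 0.
    by rewrite /ratr mulf_neq0 ?invr_neq0 // intK_neq0 // numq_eq0.
  have := vge_val r0 hq0; rewrite (padic_extends hK q0) /padic_val subr_ge0 ler_nat.
  rewrite [X in (_ <= X)%N]lognE (negPf pn) !andbF leqn0 => /eqP h0.
  have : (0 < logn p `|denq q|)%N by rewrite logn_gt0 mem_primes hp pd absz_gt0 denq_neq0.
  by rewrite h0.
have cop : coprimez (denq q) p%:Z.
  by rewrite /coprimez /gcdz /= eqz_nat -/(coprime _ _) coprime_sym prime_coprime.
have [[a b] /= hab] := coprimezP _ _ cop.
(* By Bezout [a] inverts the denominator modulo [p], so [z] is the residue of [q]. *)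
pose z := ((a * numq q) %% p%:Z)%Z.
have p0 : (p%:Z != 0) by rewrite -lt0n prime_gt0.
have z0 : (0 <= z)%R by apply: modz_ge0.
have zp : (z < p%:Z)%R by rewrite ltz_mod.
exists `|z|%N; first by rewrite -ltz_nat gez0_abs.
have -> : (`|z|%N%:R : K) = z%:~R by rewrite -{2}(gez0_abs z0).
have -> : ratr q - z%:~R = (denq q)%:~R^-1 * (numq q - z * denq q)%:~R :> K.
  by rewrite /ratr intrB intrM mulrBr mulrC [_ * (z%:~R * _)]mulrCA mulVf // mulr1.
rewrite -[1%R : rat]add0r; apply: (vgeM hv).
  by right; rewrite (vV hv) // vp_absz vp_coprime ?oppr0.
apply: vge1_int.
have -> : numq q - z * denq q = (b * numq q + (a * numq q %/ p%:Z)%Z * denq q) * p%:Z.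
  rewrite /z /modz; move: (_ %/ _)%Z => w.
  have -> : numq q = numq q * 1 by rewrite mulr1.
  rewrite -{1}hab; ring.
exact: dvdz_mull.
Qed.

End PadicField.

(** * Unit balls of subspaces: bases and completeness *)

Section Lattices.
Variables (p : nat) (K : fieldType) (vp : K -> rat) (D : falgType K) (v : D -> rat).
Hypotheses (hp : prime p) (hK : is_padic_field p vp).
Hypotheses (hv : extends_valuation vp v) (hdiv : is_division D).

Lemma division_valued : valued_division v.
Proof. by split; [exact: hv.1|exact: hdiv]. Qed.

Let hvK := padic_valued hK.
Let hvD := division_valued.

Lemma scalar_neq0 (c : K) : c != 0 -> c%:A != 0 :> D.
Proof. by move=> c0; rewrite scaler_eq0 negb_or c0 oner_neq0. Qed.

Lemma vZ (c : K) x : c != 0 -> x != 0 -> v (c *: x) = vp c + v x.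
Proof.
move=> c0 x0; rewrite -[x in LHS]mul1r scalerAl (valuationM hv.1) ?scalar_neq0 //.
by rewrite hv.2.
Qed.

Lemma vgeZ r s (c : K) x : vge vp r c -> vge v s x -> vge v (r + s) (c *: x).
Proof.
have [->|c0] := eqVneq c 0; first by rewrite scale0r; left.
have [->|x0] := eqVneq x 0; first by rewrite scaler0; left.
move=> /(vge_val c0) h1 /(vge_val x0) h2.
by right; rewrite vZ // lerD.
Qed.

Lemma natD_alg k : (k%:R : D) = (k%:R : K)%:A.
Proof. by rewrite scaler_nat. Qed.

Lemma natD_neq0 k : (0 < k)%N -> (k%:R : D) != 0.
Proof. by move=> hk; rewrite natD_alg scalar_neq0 // (natK_neq0 hK). Qed.

Lemma v_nat k : (0 < k)%N -> v k%:R = vp k%:R.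
Proof. by move=> hk; rewrite natD_alg hv.2 // (natK_neq0 hK). Qed.

Lemma v_p : v p%:R = 1.
Proof. by rewrite v_nat ?prime_gt0 // (vp_p hp hK). Qed.

Lemma natK_p_neq0 : (p%:R : K) != 0.
Proof. by apply: (natK_neq0 hK); apply: prime_gt0. Qed.

Lemma vp_pz (z : int) : vp (p%:R ^ z) = z%:~R.
Proof.
case: z => k; first by rewrite -exprnP (vX hvK) ?natK_p_neq0 // (vp_p hp hK).
rewrite NegzE -exprnN (vV hvK) ?expf_neq0 ?natK_p_neq0 //.
by rewrite (vX hvK) ?natK_p_neq0 // (vp_p hp hK) mulrNz.
Qed.

Lemma pz_neq0 (z : int) : (p%:R : K) ^ z != 0.
Proof. by rewrite expfz_neq0 // natK_p_neq0. Qed.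

(** Linear independence, over the residue field, of the classes of the [b i] modulo [p]. Unlike
    independence over [K], it controls the size of coefficients. *)
Definition pfree k (b : 'I_k -> D) := forall c : 'I_k -> K,
  (forall i, vge vp 0 (c i)) -> vge v 1 (\sum_i c i *: b i) -> forall i, vge vp 1 (c i).

Lemma vge_bound (A : unitRingType) (w : A -> rat) (x : A) :
  exists N : nat, vge w (- N%:R) x.
Proof.
exists (Num.bound `|w x|); right; rewrite lerNl.
apply: ltW; apply: le_lt_trans (archi_boundP (normr_ge0 (w x))).
by rewrite -normrN ler_norm.
Qed.

Lemma vge_bound_ord k (c : 'I_k -> K) : exists N : nat, forall i, vge vp (- N%:R) (c i).
Proof.
have [f hf] := choice (fun i => vge_bound vp (c i)).
exists (\sum_i f i)%N => i; apply: vge_le (hf i).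
by rewrite lerN2 ler_nat (bigD1 i) //= leq_addr.
Qed.

(** Descent on a common lower bound [- N] for the valuations of the coefficients divided by [p ^ r]:
    multiplied by [p ^ N] they are integral with a combination divisible by [p], so [pfree] raises
    the bound by one. *)
Lemma pfree_scale k (b : 'I_k -> D) : pfree b -> forall (r : int) c,
  vge v r%:~R (\sum_i c i *: b i) -> forall i, vge vp r%:~R (c i).
Proof.
move=> hb r c hs.
have [N0 hN0] := vge_bound_ord (fun i => p%:R ^ (- r) * c i).
suff H : forall N : nat, (forall i, vge vp (- N%:R) (p%:R ^ (- r) * c i)) ->
    forall i, vge vp 0 (p%:R ^ (- r) * c i).
  move=> i; apply: (vge_mull hvK (pz_neq0 (- r))).
  by rewrite vp_pz mulrNz addNr; apply: H hN0 i.
move=> {hN0}; elim=> [|N IH] h; first by move: h; rewrite oppr0.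
apply: IH => i.
have h1 : forall i, vge vp 0 (p%:R ^ (N.+1%:Z) * (p%:R ^ (- r) * c i)).
  move=> j; have := vgeM hvK (vge_refl vp (p%:R ^ (N.+1%:Z))) (h j).
  by rewrite vp_pz subrr.
have h2 : vge v 1 (\sum_i (p%:R ^ (N.+1%:Z) * (p%:R ^ (- r) * c i)) *: b i).
  under eq_bigr => j _ do rewrite mulrA -scalerA.
  rewrite -scaler_sumr.
  have := vgeZ (vge_refl vp (p%:R ^ (N.+1%:Z) * p%:R ^ (- r))) hs.
  apply: vge_le; rewrite (valuationM (padic_valuation hK)) ?pz_neq0 //.
  by rewrite !vp_pz mulrNz subrK -[_%:~R]/(N.+1%:R : rat) ler1n.
have h3 := hb _ h1 h2 i.
apply: (vge_mull hvK (pz_neq0 N.+1%:Z)); rewrite vp_pz.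
apply: vge_le h3; have -> : (N.+1%:Z)%:~R = N%:R + 1 :> rat by rewrite [RHS]natr1.
by rewrite addrAC subrr add0r.
Qed.

Lemma pfree0 k (b : 'I_k -> D) : pfree b -> forall c,
  \sum_i c i *: b i = 0 -> forall i, c i = 0.
Proof.
move=> hb c h i; apply: vge_all => m.
by apply: (pfree_scale hb (r := m)); rewrite h; left.
Qed.

Lemma pfree_dim (S : {vspace D}) k (b : 'I_k -> D) :
  pfree b -> (forall i, b i \in S) -> (k <= \dim S)%N.
Proof.
move=> hb hS; pose t := [tuple b i | i < k].
have ft : free t.
  apply/freeP => c hc; apply: (pfree0 hb); rewrite -[RHS]hc.
  by apply: eq_bigr => i _; rewrite -tnth_nth tnth_mktuple.
have := dimvS (U := <<t>>%VS) (V := S).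
rewrite -[\dim <<t>>]/(\dim <<t>>) (eqnP ft) size_tuple; apply.
by apply/span_subvP => x /mapP[i _ ->].
Qed.

Lemma vge_lim k (c : nat -> 'I_k -> K) :
  (forall N : nat, exists m, forall i j, (m <= i)%N -> (m <= j)%N ->
     forall l, vge vp N%:R (c i l - c j l)) ->
  exists L : 'I_k -> K, forall N : nat, exists m, forall i, (m <= i)%N ->
     forall l, vge vp N%:R (c i l - L l).
Proof.
move=> hc.
have hL (l : 'I_k) : exists x : K, forall N : nat, exists m, forall i, (m <= i)%N ->
    vge vp N%:R (c i l - x).
  have [N|x hx] := padic_complete hK (s := fun i => c i l).
    have [m hm] := hc (Num.bound `|N|); exists m => i j hi hj.
    apply: vge_le (hm i j hi hj l); apply: le_trans (ler_norm _) _.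
    by apply: ltW; rewrite archi_boundP ?normr_ge0.
  by exists x => N; have [m hm] := hx N%:R; exists m.
have [L hL'] := choice hL; exists L => N.
have [f hf] := choice (fun l => hL' l N).
exists (\max_l f l) => i hi l; apply: hf; apply: leq_trans hi.
exact: leq_bigmax.
Qed.

Lemma vge_near r (x y : D) : vge v r x -> vge v r (y - x) -> vge v r y.
Proof. by move=> h1 h2; rewrite -(subrK x y); apply: (vgeD hvD). Qed.

(** A [pfree] family of integral elements of maximal size represents the unit ball modulo [p];
    iterating and passing to the limit in the complete field [K] makes the representation exact. *)
Lemma subspace_basis (S : {vspace D}) : exists b : 'I_(\dim S) -> D,
  [/\ forall i, b i \in S, forall i, vge v 0 (b i), pfree b &
      forall x, x \in S -> vge v 0 x -> exists2 c : 'I_(\dim S) -> K,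
        forall i, vge vp 0 (c i) & x = \sum_i c i *: b i].
Proof.
pose good k := exists b : 'I_k -> D,
  [/\ forall i, b i \in S, forall i, vge v 0 (b i) & pfree b].
have good0 : exists k, `[< good k >].
  exists 0%N; apply/asboolP; exists (fun i : 'I_0 => 0).
  by split=> [[]|[]|c _ _ []].
have bnd k : `[< good k >] -> (k <= \dim S)%N.
  by move/asboolP => [b [h1 _ h3]]; apply: pfree_dim h3 h1.
case: (ex_maxnP good0 bnd) => k /asboolP[b [hS hb fb]] maxk.
have step x : x \in S -> vge v 0 x -> exists2 c : 'I_k -> K,
    forall i, vge vp 0 (c i) & vge v 1 (x - \sum_i c i *: b i).
  move=> xS hx.
  pose b' (i : 'I_k.+1) := if unlift ord0 i is Some j then b j else x.
  have : ~ pfree b'.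
    move=> fb'; have : (k.+1 <= k)%N; last by rewrite ltnn.
    apply: maxk; apply/asboolP; exists b'; split => // i; rewrite /b'; by case: unliftP.
  move/existsNP => [c] /not_implyP[hc] /not_implyP[hs] /existsNP[i0 hi0].
  move: hs; rewrite big_ord_recl /b' unlift_none.
  under eq_bigr => i _ do rewrite liftK.
  move=> hs.
  (* Were the coefficient of [x] divisible by [p], the relation would restrict to [b], and all
     coefficients would be. Values being integral, it is a unit and [x] can be solved for modulo
     [p]. *)
  have hc0 : ~ vge vp 1 (c ord0).
    move=> h0; apply: hi0.
    have h1 : vge v 1 (\sum_(i < k) c (lift ord0 i) *: b i).
      rewrite -(addKr (c ord0 *: x) (\sum_(i < k) _)); apply: (vgeD hvD) => //.
      by apply: (vgeN hvD); rewrite -[1%R : rat]addr0; apply: vgeZ.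
    have h2 := fb _ (fun i => hc (lift ord0 i)) h1.
    by case: (unliftP ord0 i0) => [j ->|->].
  have [c00 vc0] := not_vge hc0.
  have vc0' : vp (c ord0) = 0.
    have := vge_val c00 (hc ord0); have [z hz] := vp_int hK c00; move: vc0.
    rewrite hz -[1%R : rat]/(1%:~R) ltr_int ler0z => h1 h2.
    have -> : z = 0 by lia.
    by [].
  have vc0i : vge vp 0 (c ord0)^-1 by right; rewrite (vV hvK) // vc0' oppr0.
  exists (fun i => - ((c ord0)^-1 * c (lift ord0 i))).
    by move=> i; apply: (vgeN hvK); rewrite -[0%R : rat]addr0; apply: (vgeM hvK).
  have := vgeZ vc0i hs; rewrite add0r scalerDr scalerA mulVf // scale1r.
  rewrite scaler_sumr; congr (vge v 1 (_ + _)).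
  by rewrite -sumrN; apply: eq_bigr => i _; rewrite scalerA scaleNr opprK.
have approx x N : x \in S -> vge v 0 x -> exists c : 'I_k -> K,
    (forall i, vge vp 0 (c i)) /\ vge v N%:R (x - \sum_i c i *: b i).
  move=> xS hx; elim: N => [|N [c [hc hN]]].
    exists (fun => 0); split; first by move=> i; left.
    by rewrite big1 ?subr0 // => i _; rewrite scale0r.
  pose y := x - \sum_i c i *: b i.
  have yS : y \in S by rewrite rpredB // rpred_sum // => i _; rewrite rpredZ.
  have pz0 := pz_neq0 N.
  have [||c' hc' hy'] := step ((p%:R ^ N%:Z)^-1 *: y).
  - by rewrite rpredZ.
  - have hi : vge vp (- N%:R) ((p%:R ^ N%:Z)^-1 : K).
      by right; rewrite (vV hvK) // vp_pz.
    by have := vgeZ hi hN; rewrite addNr.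
  exists (fun i => c i + p%:R ^ N%:Z * c' i); split.
    move=> i; apply: (vgeD hvK) => //.
    apply: vge_le (vgeM hvK (vge_refl vp (p%:R ^ N%:Z)) (hc' i)).
    by rewrite vp_pz addr0 ler0n.
  have := vgeZ (vge_refl vp (p%:R ^ N%:Z)) hy'.
  rewrite vp_pz scalerBr scalerA mulfV // scale1r scaler_sumr.
  have -> : (N%:~R + 1 : rat) = N.+1%:R by rewrite -[N%:~R]/(N%:R : rat) natr1.
  congr (vge v _ _); rewrite /y -addrA -opprD -big_split /=.
  by congr (_ - _); apply: eq_bigr => i _; rewrite scalerDl scalerA.
have span x : x \in S -> vge v 0 x -> exists2 c : 'I_k -> K,
    forall i, vge vp 0 (c i) & x = \sum_i c i *: b i.
  move=> xS hx; have [c hc] := choice (fun N => approx x N xS hx).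
  have [N|L hL] := vge_lim (c := c).
    exists N => i j hi hj l.
    apply: (pfree_scale fb (r := N) (c := fun l => c i l - c j l)).
    under eq_bigr => t _ do rewrite scalerBl.
    rewrite sumrB.
    have -> : \sum_t c i t *: b t - \sum_t c j t *: b t =
      (x - \sum_t c j t *: b t) - (x - \sum_t c i t *: b t).
      by rewrite opprB [RHS]addrC addrA subrK.
    apply: (vgeB hvD); [apply: vge_le (hc j).2|apply: vge_le (hc i).2]; by rewrite ler_nat.
  exists L.
    move=> l; have [m hm] := hL 0%N.
    by rewrite -(subKr (c m l) (L l)); apply: (vgeB hvK); [apply: (hc m).1|apply: hm].
  apply/eqP; rewrite -subr_eq0; apply/eqP; apply: (vge_all (v := v)) => N.
  have [m hm] := hL N.
  pose M := maxn m N.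
  have h1 : vge v N%:R (x - \sum_t c M t *: b t).
    by apply: vge_le (hc M).2; rewrite ler_nat leq_maxr.
  have h2 : vge v N%:R (\sum_t (c M t - L t) *: b t).
    apply: (vge_sum hvD) => t _; rewrite -[N%:R : rat]addr0; apply: vgeZ => //.
    by apply: hm; rewrite leq_maxl.
  have := vgeD hvD h1 h2.
  have -> : \sum_t (c M t - L t) *: b t = \sum_t c M t *: b t - \sum_t L t *: b t.
    by rewrite -sumrB; apply: eq_bigr => t _; rewrite scalerBl.
  by rewrite addrA subrK.
(* Every element of [S] becomes integral after multiplication by a power of [p], so the family spans
   [S]. *)
have kd : k = \dim S.
  apply/eqP; rewrite eqn_leq (pfree_dim fb hS) /=.
  pose t := [tuple b i | i < k].
  have sub : (S <= <<t>>)%VS.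
    apply/subvP => x xS; have [N hN] := vge_bound v x.
    have [||c hc hx] := span (p%:R ^ N%:Z *: x).
    - by rewrite rpredZ.
    - by have := vgeZ (vge_refl vp (p%:R ^ N%:Z)) hN; rewrite vp_pz subrr.
    rewrite -[x]scale1r -(mulVf (pz_neq0 N)) -scalerA hx rpredZ //.
    apply: rpred_sum => i _; rewrite rpredZ // memv_span //.
    by apply/mapP; exists i => //; rewrite mem_enum.
  by apply: leq_trans (dimvS sub) _; apply: leq_trans (dim_span _) _; rewrite size_tuple.
by rewrite -kd; exists b; split.
Qed.

(** By [pfree_scale], the coordinates of a Cauchy sequence in such a basis are Cauchy in [K]. *)
Lemma subspace_complete (S : {vspace D}) (s : nat -> D) :
  (forall i, s i \in S) ->
  (forall N : nat, exists m, forall i j, (m <= i)%N -> (m <= j)%N -> vge v N%:R (s i - s j)) ->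
  exists2 l, l \in S & forall N : nat, exists m, forall i, (m <= i)%N -> vge v N%:R (s i - l).
Proof.
move=> sS hs; have [b [hS hb fb span]] := subspace_basis S.
have hc i : exists c : 'I_(\dim S) -> K, s i = \sum_t c t *: b t.
  have [N hN] := vge_bound v (s i).
  have [||c _ hx] := span (p%:R ^ N%:Z *: s i).
  - by rewrite rpredZ.
  - by have := vgeZ (vge_refl vp (p%:R ^ N%:Z)) hN; rewrite vp_pz subrr.
  exists (fun t => (p%:R ^ N%:Z)^-1 * c t).
  under eq_bigr => t _ do rewrite -scalerA.
  by rewrite -scaler_sumr -hx scalerA mulVf ?scale1r // pz_neq0.
have [c hc'] := choice hc.
have [N|L hL] := vge_lim (c := c).
  have [m hm] := hs N; exists m => i j hi hj l.
  apply: (pfree_scale fb (r := N) (c := fun l => c i l - c j l)).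
  under eq_bigr => t _ do rewrite scalerBl.
  by rewrite sumrB -!hc'; apply: hm.
exists (\sum_t L t *: b t); first by rewrite rpred_sum // => t _; rewrite rpredZ.
move=> N; have [m hm] := hL N; exists m => i hi.
rewrite hc' -sumrB; apply: (vge_sum hvD) => t _.
by rewrite -scalerBl -[N%:R : rat]addr0; apply: vgeZ => //; apply: hm.
Qed.

End Lattices.

Lemma subr_telescope (V : zmodType) (d x y a : V) : y - a = d + (x - a) + (y - x - d).
Proof. by rewrite [d + _]addrC -addrA [d + _]addrC subrK [RHS]addrC addrA subrK. Qed.

(** * Newton iteration in a division algebra *)

Section Hensel.
Variables (p : nat) (K : fieldType) (vp : K -> rat) (D : falgType K) (v : D -> rat).
Hypotheses (hp : prime p) (hK : is_padic_field p vp).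
Hypotheses (hv : extends_valuation vp v) (hdiv : is_division D).

Let hvK := padic_valued hK.
Let hvD := division_valued hv hdiv.

(* The differential at y, in the direction h, of the j-th power map. *)
Definition dpow (j : nat) (y h : D) : D := \sum_(i < j) y ^+ i * h * y ^+ (j - i.+1).

Lemma dpowS j y h : dpow j.+1 y h = dpow j y h * y + y ^+ j * h.
Proof.
rewrite /dpow big_ord_recr /= subnn expr0 mulr1; congr (_ + _).
rewrite mulr_suml; apply: eq_bigr => i _.
by rewrite subSS -[in RHS]mulrA -exprSr subnSK.
Qed.

Lemma vge_dpow j y h s t : vge v s y -> vge v t h -> vge v ((j%:R - 1) * s + t) (dpow j y h).
Proof.
move=> hy hh; elim: j => [|j IH]; first by rewrite /dpow big_ord0; left.
rewrite dpowS; apply: (vgeD hvD).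
  by apply: vge_le (vgeM hvD IH hy); rewrite -natr1; lra.
apply: vge_le (vgeM hvD (vgeX hvD j hy) hh).
by rewrite -natr1 -mulr_natl; lra.
Qed.

(** Each term of the remainder contains [h] at least twice; [s <= t] allows any further factor to be
    counted with weight [s]. *)
Lemma vge_taylor j y h s t : s <= t -> vge v s y -> vge v t h ->
  vge v ((j%:R - 2) * s + 2 * t) ((y + h) ^+ j - y ^+ j - dpow j y h).
Proof.
move=> st hy hh; elim: j => [|j IH].
  by rewrite /dpow big_ord0 !expr0 subr0 subrr; left.
have -> : (y + h) ^+ j.+1 - y ^+ j.+1 - dpow j.+1 y h =
    ((y + h) ^+ j - y ^+ j - dpow j y h) * (y + h) + dpow j y h * h.
  rewrite dpowS !exprSr !mulrBl [y ^+ j * (y + h)]mulrDr [dpow j y h * (y + h)]mulrDr.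
  by rewrite !opprD !addrA subrK; rewrite addrAC.
apply: (vgeD hvD).
  have hyh : vge v s (y + h) by apply: (vgeD hvD) => //; apply: vge_le hh.
  by apply: vge_le (vgeM hvD IH hyh); rewrite -natr1; lra.
by apply: vge_le (vgeM hvD (vge_dpow j hy hh) hh); rewrite -natr1; lra.
Qed.

Definition scalar_poly (q : nat) (B : nat -> K) (y : D) : D := \sum_(j < q.+1) B j *: y ^+ j.

Definition dscalar_poly (q : nat) (B : nat -> K) (y h : D) : D :=
  \sum_(j < q.+1) B j *: dpow j y h.

Section Weights.
Variables (q : nat) (B : nat -> K) (s : rat).
Hypothesis hB : forall j, (j <= q)%N -> vge vp ((q%:R - j%:R) * s) (B j).

(** Under [hB] the Newton polygon lies above the line of slope [- s] ending at degree [q], so at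
    points of valuation at least [s] each monomial obeys the estimates for [y ^ q]. *)
Lemma vge_scalar_poly_taylor y h t : s <= t -> vge v s y -> vge v t h ->
  vge v ((q%:R - 2) * s + 2 * t)
    (scalar_poly q B (y + h) - scalar_poly q B y - dscalar_poly q B y h).
Proof.
move=> st hy hh; rewrite /scalar_poly /dscalar_poly -!sumrB.
apply: (vge_sum hvD) => j _; rewrite -!scalerBr.
apply: vge_le (vgeZ hv (hB (ltn_ord j)) (vge_taylor j st hy hh)).
lra.
Qed.

Lemma vge_dscalar_poly y h t : vge v s y -> vge v t h ->
  vge v ((q%:R - 1) * s + t) (dscalar_poly q B y h).
Proof.
move=> hy hh; rewrite /dscalar_poly; apply: (vge_sum hvD) => j _.
apply: vge_le (vgeZ hv (hB (ltn_ord j)) (vge_dpow j hy hh)).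
lra.
Qed.

(* A noncommutative Hensel lemma: it suffices that the differential of the polynomial at
   points near [y0] hits, up to higher order, every target commuting with that point. *)
Lemma hensel (S : {aspace D}) (M : nat) (a y0 : D) :
  (0 < M)%N -> (forall x, x \in S -> x != 0 -> exists z : int, v x = z%:~R / M%:R) ->
  1 \in S -> a \in S -> {in S, forall y, a * y = y * a} -> y0 \in S -> vge v s y0 ->
  vgt v (q%:R * s) (scalar_poly q B y0 - a) ->
  (forall y d, y \in S -> vgt v s (y - y0) -> d \in S -> d != 0 -> y * d = d * y ->
     exists h, [/\ h \in S, vge v (v d - (q%:R - 1) * s) h &
                   vgt v (v d) (dscalar_poly q B y h - d)]) ->
  exists y, [/\ y \in S, vgt v s (y - y0) & scalar_poly q B y = a].
Proof.
move=> M0 hM S1 Sa ca Sy0 hy0 hF0 lin.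
pose F y := scalar_poly q B y - a.
have M0' : 0 < M%:R :> rat by rewrite ltr0n.
have FS y : y \in S -> F y \in S.
  move=> yS; rewrite rpredB // rpred_sum // => j _; rewrite rpredZ //.
  by elim: (nat_of_ord j) => [|i IH]; rewrite ?expr0 // exprS memvM.
(* The coefficients are central and [a] commutes with [S]: the defect commutes with [y], and [lin]
   is needed only for such targets. *)
have Fc y : y \in S -> y * F y = F y * y.
  move=> yS; rewrite /F mulrBr mulrBl ca //; congr (_ - _).
  rewrite /scalar_poly mulr_sumr mulr_suml; apply: eq_bigr => j _.
  by rewrite -scalerAl -scalerAr -exprS -exprSr.
pose good y := [/\ y \in S, vgt v s (y - y0) & vgt v (q%:R * s) (F y)].
(* The condition [good y] sits inside the existential so that [choice] gives a total iteration
   map. *)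
have step y : exists y', good y -> [/\ good y', (F y = 0 -> F y' = 0),
    (F y != 0 -> vgt v (v (F y)) (F y')) &
    forall r, vge v r (F y) -> vge v (r - (q%:R - 1) * s) (y' - y)].
  have [gy|ngy] := EM (good y); last by exists y.
  have [Fy0|Fy0] := eqVneq (F y) 0.
    by exists y => _; split => // r _; rewrite subrr; left.
  have [yS hy hFy] := gy.
  have nFy0 : - F y != 0 by rewrite oppr_eq0.
  have [||h [hS hh hl]] := lin y (- F y) yS hy _ nFy0.
  - by rewrite rpredN FS.
  - by rewrite mulrN mulNr Fc.
  rewrite (vN hvD) in hh hl.
  have vF := vgt_val Fy0 hFy.
  have st : s < v (F y) - (q%:R - 1) * s by move: vF; lra.
  have ygs : vge v s y by apply: (vge_near hv hdiv hy0); apply: vgtW.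
  have hFF : vgt v (v (F y)) (F (y + h)).
    have -> : F (y + h) = (dscalar_poly q B y h - - F y) +
       (scalar_poly q B (y + h) - scalar_poly q B y - dscalar_poly q B y h).
      by rewrite /F opprK; apply: subr_telescope.
    apply: (vgtD hvD) => //.
    apply: vge_gt (vge_scalar_poly_taylor (ltW st) ygs hh).
    move: vF; lra.
  exists (y + h) => _; split => //.
  - split; first by rewrite rpredD.
      rewrite addrAC; apply: (vgtD hvD) => //; exact: vge_gt hh.
    by apply: vgt_le hFF; apply: ltW.
  - by move=> e; rewrite e eqxx in Fy0.
  - by move=> r hr; rewrite addrAC subrr add0r; apply: vge_le hh; rewrite lerB ?(vge_val Fy0).
have [f hf] := choice step.
pose u k := iter k f y0.
have gu k : good (u k).
  by elim: k => [|k IH]; [split => //; rewrite subrr; left|case: (hf (u k) IH)].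
(* Values on [S] lie in [(1/M) Z] and each Newton step strictly raises [v (F y)], hence gains at
   least [1/M]. *)
have hFu k : vge v (q%:R * s + k%:R / M%:R) (F (u k)).
  elim: k => [|k IH]; first by rewrite mul0r addr0; apply: vgtW.
  have [gk h0 h1 _] := hf (u k) (gu k); rewrite -/(u k.+1) in h0 h1 gk.
  have [F0|F0] := eqVneq (F (u k)) 0; first by rewrite (h0 F0); left.
  have [->|F1] := eqVneq (F (u k.+1)) 0; first by left.
  have := vgt_val F1 (h1 F0); have := vge_val F0 IH.
  have [[_ _ _] [S0 _ _]] := (gu k, gu k).
  have [S1' _ _] := gk.
  have [z0 ->] := hM _ (FS _ S0) F0; have [z1 hz1] := hM _ (FS _ S1') F1.
  rewrite hz1 => ha hb; right; rewrite hz1.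
  have hz : (z0 + 1 <= z1)%R.
    by rewrite lezD1 -(ltr_int rat) -(ltr_pM2r (x := M%:R^-1)) // invr_gt0.
  have : ((z0 + 1)%:~R <= z1%:~R :> rat) by rewrite ler_int.
  rewrite intrD => hz'.
  have : (z0%:~R + 1) / M%:R <= z1%:~R / M%:R :> rat by rewrite ler_pM2r ?invr_gt0.
  move: ha; rewrite -natr1 !mulrDl; lra.
have du k : vge v (s + k%:R / M%:R) (u k.+1 - u k).
  have [_ _ _ h] := hf (u k) (gu k).
  by apply: vge_le (h _ (hFu k)); lra.
have du' k d : vge v (s + k%:R / M%:R) (u (k + d)%N - u k).
  elim: d => [|d IH]; first by rewrite addn0 subrr; left.
  rewrite addnS -(subrK (u (k + d)%N) (u _.+1)) -addrA; apply: (vgeD hvD) => //.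
  apply: vge_le (du _); rewrite lerD2l ler_pM2r ?invr_gt0 // ler_nat leq_addr.
exact: isT.
have far (r : rat) : exists m : nat, forall i, (m <= i)%N -> r <= s + i%:R / M%:R.
  exists (Num.bound `|(r - s) * M%:R|) => i hi.
  rewrite -lerBlDl ler_pdivlMr //; apply: le_trans (ler_norm _) _.
  by apply: ltW; apply: lt_le_trans (archi_boundP (normr_ge0 _)) _; rewrite ler_nat.
have [||l lS hl] := subspace_complete hp hK hv hdiv (S := S) (s := u).
- by move=> i; case: (gu i).
- move=> N; have [m hm] := far N%:R; exists m => i j hi hj.
  have hi' := du' m (i - m)%N; have hj' := du' m (j - m)%N.
  rewrite !subnKC // in hi' hj'.
  have -> : u i - u j = (u i - u m) - (u j - u m) by rewrite opprB addrA subrK.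
  by apply: vge_le (vgeB hvD hi' hj'); apply: hm.
have near r : exists k : nat, vge v r (u k - l).
  have [m hm] := hl (Num.bound `|r|); exists m; apply: vge_le (hm m (leqnn m)).
  by apply: le_trans (ler_norm _) _; apply: ltW; rewrite archi_boundP ?normr_ge0.
exists l; split=> //.
  have [k hk] := near (s + 1); have [_ hk' _] := gu k.
  rewrite -(subrK (u k) l) -addrA; apply: (vgtD hvD) => //.
  by apply: (vgtC hvD); apply: vge_gt hk; rewrite ltrDl.
apply/eqP; rewrite -subr_eq0; apply/eqP; apply: (vge_all (v := v)) => N.
have [m hm] := far ((N%:R : rat) + s - q%:R * s).
have [k0 hk0] := hl (Num.bound (`|s| + `|N%:R - (q%:R - 1) * s|)).
(* [t] must reach [s] for the Taylor estimate, and [N - (q - 1) s] for the linear term to have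
   valuation at least [N]. *)
pose k := maxn m k0; pose t := Num.max s (N%:R - (q%:R - 1) * s).
have hlk : vge v t (l - u k).
  rewrite -opprB; apply: (vgeN hvD); apply: vge_le (hk0 k (leq_maxr _ _)).
  have ht : t <= `|s| + `|N%:R - (q%:R - 1) * s|.
    by rewrite ge_max ler_wpDr ?ler_norm // ler_wpDl ?ler_norm.
  by apply: le_trans ht _; apply: ltW; rewrite archi_boundP ?addr_ge0.
have st : s <= t by rewrite le_max lexx.
have Nt : N%:R - (q%:R - 1) * s <= t by rewrite le_max lexx orbT.
have [ukS hk _] := gu k.
have ygs : vge v s (u k) by apply: (vge_near hv hdiv hy0); apply: vgtW.
have := vge_scalar_poly_taylor st ygs hlk; have := vge_dscalar_poly ygs hlk.
rewrite [u k + _]addrC subrK => h1 h2.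
have h3 : vge v N%:R (F (u k)).
  apply: vge_le (hFu k); have := hm k (leq_maxl _ _); lra.
have -> : scalar_poly q B l - a = F (u k) + dscalar_poly q B (u k) (l - u k) +
   (scalar_poly q B l - scalar_poly q B (u k) - dscalar_poly q B (u k) (l - u k)).
  by rewrite [F _ + _]addrC; apply: subr_telescope.
apply: (vgeD hvD); first apply: (vgeD hvD) => //.
  by apply: vge_le h1; lra.
by apply: vge_le h2; move: st Nt; lra.
Qed.

End Weights.
End Hensel.

(** * Commutative subalgebras as fields *)

Record is_subfield (K : fieldType) (D : falgType K) (L : {aspace D}) : Prop := {
  subfield_division : is_division D;
  subfield1 : 1 \in L;
  subfieldC : {in L &, forall x y, x * y = y * x} }.

(** A copy of [subvs_of L] indexed by the proof [hL], on which a field structure can be declared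
    canonically; this gives access in [L] to polynomials and primitive roots. *)
Definition subfield_type (K : fieldType) (D : falgType K) (L : {aspace D})
  (hL : is_subfield L) : Type := subvs_of L.

Section SubfieldType.
Variables (K : fieldType) (D : falgType K) (L : {aspace D}) (hL : is_subfield L).

HB.instance Definition _ := GRing.NzRing.copy (subfield_type hL) (subvs_of L).

Fact subfield_mulC : commutative (@GRing.mul (subfield_type hL)).
Proof.
by move=> x y; apply: val_inj; exact: (subfieldC hL (valP x) (valP y)).
Qed.

HB.instance Definition _ :=
  GRing.PzRing_hasCommutativeMul.Build (subfield_type hL) subfield_mulC.

Definition subfield_inv (x : subfield_type hL) : subfield_type hL :=
  (x : subvs_of L)^-1.

Lemma subfield_unit (x : subfield_type hL) : x != 0 -> val x \is a GRing.unit.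
Proof. by move=> x0; apply: (subfield_division hL); apply: contra x0 => /eqP h; apply/eqP/val_inj. Qed.

Fact subfield_mulV (x : subfield_type hL) : x != 0 -> subfield_inv x * x = 1.
Proof.
move=> x0; have u := subfield_unit x0.
exact: (mulVr (vsval_unitr u)).
Qed.

Fact subfield_inv0 : subfield_inv 0 = 0.
Proof. exact: invr0. Qed.

HB.instance Definition _ :=
  GRing.ComNzRing_isField.Build (subfield_type hL) subfield_mulV subfield_inv0.

Definition subfield_val (x : subfield_type hL) : D := vsval x.

Fact subfield_val_additive : zmod_morphism subfield_val.
Proof. by []. Qed.

Fact subfield_val_multiplicative : monoid_morphism subfield_val.
Proof.
split=> //; rewrite /subfield_val /=.
by apply/eqP; rewrite algid_eq1 (subfield1 hL).
Qed.

HB.instance Definition _ := GRing.isZmodMorphism.Build (subfield_type hL) D subfield_val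
  subfield_val_additive.
HB.instance Definition _ := GRing.isMonoidMorphism.Build (subfield_type hL) D subfield_val
  subfield_val_multiplicative.

Lemma subfield_val_inj : injective subfield_val.
Proof. exact: val_inj. Qed.

Lemma subfield_valP x : subfield_val x \in L.
Proof. exact: (valP x). Qed.

Definition subfield_sub (x : D) (hx : x \in L) : subfield_type hL := Subvs hx.

Lemma subfield_subK x (hx : x \in L) : subfield_val (subfield_sub hx) = x.
Proof. by []. Qed.

Lemma subfield_valV x : x != 0 -> subfield_val x^-1 = (subfield_val x)^-1.
Proof. by move=> /subfield_unit; exact: vsval_invr. Qed.

Lemma subfield_val0 : subfield_val 0 = 0. Proof. exact: rmorph0. Qed.

Lemma subfield_val_1 : subfield_val 1 = 1. Proof. exact: subfield_val_multiplicative.1. Qed.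

Lemma subfield_valM x y : subfield_val (x * y) = subfield_val x * subfield_val y.
Proof. by []. Qed.

Lemma subfield_valD x y : subfield_val (x + y) = subfield_val x + subfield_val y.
Proof. by []. Qed.

Lemma subfield_valB x y : subfield_val (x - y) = subfield_val x - subfield_val y.
Proof. by []. Qed.

Lemma subfield_valX x i : subfield_val (x ^+ i) = subfield_val x ^+ i.
Proof.
elim: i => [|i IH]; first by rewrite !expr0 subfield_val_1.
by rewrite !exprS subfield_valM IH.
Qed.

Lemma subfield_val_eq0 x : (subfield_val x == 0) = (x == 0).
Proof. by rewrite -subfield_val0 (inj_eq subfield_val_inj). Qed.

End SubfieldType.

(** Pigeonhole: sending [t] to a representative near it is injective by separation, hence onto when
    the cardinals agree. *)
Lemma leq_card_sep_cover (A : unitRingType) (v : A -> rat) (hv : valued_division v) r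
    (T1 T2 : finType) (r1 : T1 -> A) (r2 : T2 -> A) :
  (forall t t', vge v r (r1 t - r1 t') -> t = t') ->
  (forall t, exists t2, vge v r (r1 t - r2 t2)) ->
  (#|T1| <= #|T2|)%N /\
  ((#|T2| <= #|T1|)%N -> forall t2, exists t1, vge v r (r1 t1 - r2 t2)).
Proof.
move=> sep /choice[f hf].
have finj : injective f.
  move=> t t' e; apply: sep.
  have := vgeB hv (hf t) (hf t'); rewrite e.
  by rewrite opprB addrA subrK.
split; first exact: leq_card finj.
move=> h t2; have /codomP[t1 ->] : t2 \in codom f by rewrite inj_card_onto.
by exists t1.
Qed.

Lemma vgt_prod (A : fieldType) (v : A -> rat) (hv : valued_division v)
    (I : finType) (P : pred I) (F G : I -> A) :
  (forall i, P i -> vge v 0 (F i)) -> (forall i, P i -> vgt v 0 (F i - G i)) ->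
  vge v 0 (\prod_(i | P i) F i) /\ vgt v 0 (\prod_(i | P i) F i - \prod_(i | P i) G i).
Proof.
move=> hF hG.
have hG' i : P i -> vge v 0 (G i).
  by move=> Pi; apply: (vgt_vge hv) (hF i Pi) _; apply: (vgtC hv); apply: hG.
apply: (big_ind2 (fun x y => vge v 0 x /\ vgt v 0 (x - y))).
- by rewrite subrr; split; [apply: vge1|left].
- move=> x1 x2 y1 y2 [h1 h2] [h3 h4]; split.
    by rewrite -[0%R : rat]addr0; apply: vgeM.
  apply: vgt_mul2 => //; apply: (vgt_vge hv) h3 _; exact: (vgtC hv).
- by move=> i Pi; split; [apply: hF|apply: hG].
Qed.

(** * Classes modulo p, and roots of degree prime to p *)

Section Structure.
Variables (p : nat) (K : fieldType) (vp : K -> rat) (D : falgType K) (v : D -> rat).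
Hypotheses (hp : prime p) (hK : is_padic_field p vp).
Hypotheses (hv : extends_valuation vp v) (hdiv : is_division D).

Let hvK := padic_valued hK.
Let hvD := division_valued hv hdiv.

Lemma eq_digit (a b : nat) : (a < p)%N -> (b < p)%N -> vge vp 1 (a%:R - b%:R : K) -> a = b.
Proof.
wlog ab : a b / (a <= b)%N.
  move=> H ha hb h; case/orP: (leq_total a b) => ab; first exact: H.
  by apply/esym; apply: H => //; rewrite -opprB; apply: (vgeN hvK).
move=> ha hb /(vgeN hvK); rewrite opprB -natrB // => /(vge1_nat hK).
move=> /dvdnP[[|k]]; first by lia.
by nia.
Qed.

(** Digit combinations of a lattice basis: the unit ball of [S] has exactly [p ^ dim S] classes
    modulo [p], which turns comparisons of dimensions into counting. *)
Lemma subspace_reps (S : {vspace D}) : exists rho : {ffun 'I_(\dim S) -> 'I_p} -> D,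
  [/\ forall t, rho t \in S, forall t, vge v 0 (rho t),
      forall t t', vge v 1 (rho t - rho t') -> t = t' &
      forall x, x \in S -> vge v 0 x -> exists t, vge v 1 (x - rho t)].
Proof.
have [b [bS hb fb span]] := subspace_basis hp hK hv hdiv S.
exists (fun t : {ffun 'I_(\dim S) -> 'I_p} => \sum_i (t i : nat)%:R *: b i); split.
- by move=> t; rewrite rpred_sum // => i _; rewrite rpredZ.
- move=> t; apply: (vge_sum hvD) => i _; rewrite -[0%R : rat]addr0.
  by apply: (vgeZ hv) => //; apply: (vge_nat hvK).
- move=> t t' h; apply/ffunP => i; apply/val_inj; apply: eq_digit; try exact: ltn_ord.
  refine (fb (fun i => (t i : nat)%:R - (t' i : nat)%:R) _ _ i).
    by move=> j; apply: (vgeB hvK); apply: (vge_nat hvK).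
  move: h; rewrite -sumrB; congr (vge v 1 _); apply: eq_bigr => j _.
  by rewrite scalerBl.
- move=> x xS hx; have [c hc ->] := span x xS hx.
  have hd i : exists d : 'I_p, vge vp 1 (c i - (d : nat)%:R).
    by have [d dp h] := padic_digit hp hK (hc i); exists (Ordinal dp).
  have [d hd'] := choice hd; exists [ffun i => d i].
  rewrite -sumrB; apply: (vge_sum hvD) => i _; rewrite ffunE -scalerBl.
  by rewrite -[1%R : rat]addr0; apply: (vgeZ hv).
Qed.

Lemma dpow_comm j (y h : D) : y * h = h * y -> dpow j y h = (h * y ^+ j.-1) *+ j.
Proof.
move=> c; rewrite /dpow -[in RHS](card_ord j) -sumr_const; apply: eq_bigr => i _.
have cX : y ^+ i * h = h * y ^+ i by apply/esym/commrX.
rewrite cX -mulrA -exprD; congr (_ * _ ^+ _).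
by rewrite card_ord -[in RHS](subnKC (ltn_ord i)) addSn.
Qed.

Definition pure_power (q : nat) : nat -> K := fun j => (j == q)%:R.

Lemma scalar_poly_pure q (y : D) : scalar_poly q (pure_power q) y = y ^+ q.
Proof.
rewrite /scalar_poly big_ord_recr /= /pure_power eqxx scale1r big1 ?add0r // => i _.
by rewrite ltn_eqF // scale0r.
Qed.

Lemma dscalar_poly_pure q (y h : D) : dscalar_poly q (pure_power q) y h = dpow q y h.
Proof.
rewrite /dscalar_poly big_ord_recr /= /pure_power eqxx scale1r big1 ?add0r // => i _.
by rewrite ltn_eqF // scale0r.
Qed.

Lemma vge_pure_power q s j : (j <= q)%N -> vge vp ((q%:R - j%:R) * s) (pure_power q j).
Proof.
move=> _; rewrite /pure_power; case: eqP => [->|_]; last by left.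
by rewrite subrr mul0r; apply: vge1.
Qed.

(** Since [d] commutes with [y] and [q] is a unit, [h = q^-1 d y ^- (q - 1)] solves the linearised
    equation exactly. *)
Lemma root_tame (S : {aspace D}) (M q : nat) (a y0 : D) :
  (0 < M)%N -> (forall x, x \in S -> x != 0 -> exists z : int, v x = z%:~R / M%:R) ->
  1 \in S -> a \in S -> {in S, forall y, a * y = y * a} -> y0 \in S -> y0 != 0 ->
  ~~ (p %| q)%N -> vgt v (q%:R * v y0) (y0 ^+ q - a) ->
  exists y, [/\ y \in S, vgt v (v y0) (y - y0) & y ^+ q = a].
Proof.
move=> M0 hM S1 Sa ca Sy0 y00 pq hy.
have q0 : (0 < q)%N by case: q pq {hy}; rewrite // dvdn0.
have lin y d : y \in S -> vgt v (v y0) (y - y0) -> d \in S -> d != 0 -> y * d = d * y ->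
    exists h, [/\ h \in S, vge v (v d - (q%:R - 1) * v y0) h &
      vgt v (v d) (dscalar_poly q (pure_power q) y h - d)].
  move=> yS hyy dS d0 yd.
  have [y1 vy] := vgt_close hvD y00 hyy.
  have cd : y * (d * y ^- q.-1) = (d * y ^- q.-1) * y.
    rewrite mulrA yd -!mulrA; congr (_ * _).
    by apply: commrV; apply: commrX.
  have qn0 : (q%:R : K) != 0 by apply: (natK_neq0 hK).
  exists ((q%:R)^-1 *: (d * y ^- q.-1)); split.
  + by rewrite rpredZ // memvM // memvV; elim: q.-1 => [|i IH]; rewrite ?expr0 // exprS memvM.
  + right; rewrite (vZ hv) ?invr_neq0 ?(mul_neq0 hvD) ?invr_eq0 ?(exp_neq0 hvD) //.
    rewrite (vV hvK) // (vp_coprime hp hK) // oppr0 add0r (valuationM hv.1) ?invr_eq0 ?(exp_neq0 hvD) //.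
    rewrite (vV hvD) ?(exp_neq0 hvD) // (vX hvD) //.
    have -> : (q%:R : rat) - 1 = q.-1%:R by rewrite -subn1 natrB.
    by rewrite vy mulr_natl lexx.
  + rewrite dscalar_poly_pure dpow_comm -?scalerAr -?scalerAl ?cd // -scaler_nat scalerA mulfV //.
    rewrite scale1r -mulrA mulVr ?mulr1 ?subrr ?unitrX ?hdiv //; by left.
have hy' : vgt v (q%:R * v y0) (scalar_poly q (pure_power q) y0 - a) by rewrite scalar_poly_pure.
have [y [h1 h2]] := hensel hp hK hv hdiv (@vge_pure_power q (v y0)) M0 hM S1 Sa ca
  Sy0 (vge_refl v y0) hy' lin.
by rewrite scalar_poly_pure; exists y.
Qed.

End Structure.

Lemma subfield_valued (K : fieldType) (D : falgType K) (v : D -> rat) (L : {aspace D})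
    (hL : is_subfield L) : is_valuation v ->
  valued_division (fun x : subfield_type hL => v (subfield_val x)).
Proof.
move=> hv; split; last by move=> x; rewrite unitfE.
split=> x y; rewrite -!(subfield_val_eq0 (hL := hL)) ?subfield_valM ?subfield_valD => x0 y0.
  exact: valuationM.
exact: valuationD.
Qed.

(** * Residues and roots of unity of the unramified maximal subfield *)

Section UnramifiedResidue.
Variables (p : nat) (K : fieldType) (vp : K -> rat) (D : falgType K) (v : D -> rat).
Hypotheses (hp : prime p) (hK : is_padic_field p vp).
Hypotheses (hv : extends_valuation vp v) (hdiv : is_division D).
Variables (n : nat) (W : {aspace D}).
Hypotheses (hn : (0 < n)%N) (hW : unramified_subfield v W) (dimW : \dim W = n).

Let hvK := padic_valued hK.
Let hvD := division_valued hv hdiv.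

Lemma unramified_is_subfield : is_subfield W.
Proof. by case: hW => h1 h2 _; split. Qed.

Let hWF := unramified_is_subfield.
Let N := (p ^ n).-1.

Lemma pn_gt1 : (1 < p ^ n)%N.
Proof. by rewrite -{1}(expn0 p) ltn_exp2l // prime_gt1. Qed.

Lemma N_gt0 : (0 < N)%N.
Proof. by rewrite /N -subn1 subn_gt0 pn_gt1. Qed.

Lemma p_ndvd_N : ~~ (p %| N)%N.
Proof.
have h : (p %| p ^ n)%N by rewrite dvdn_exp.
apply/negP => h'; have := dvdn_sub h h'.
have -> : (p ^ n - N = 1)%N by rewrite /N -subn1 subKn // ltnW // pn_gt1.
by rewrite dvdn1 => /eqP p1; move: hp; rewrite p1.
Qed.

Lemma unramified_int x : x \in W -> x != 0 -> exists z : int, v x = z%:~R / 1%N%:R.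
Proof. by case: hW => _ _ h /h{}h /h[z _ <-]; exists z; rewrite divr1. Qed.

Lemma unramified_vgt x : x \in W -> vgt v 0 x -> vge v 1 x.
Proof.
move=> xW; have [->|x0] := eqVneq x 0; first by left.
have [z hz] := unramified_int xW x0; move=> /(vgt_val x0).
rewrite hz divr1 ltr0z => h; right; rewrite hz divr1 -[1%R : rat]/(1%:~R) ler_int; lia.
Qed.

(** Fermat's argument in the residue field: multiplication by [x] permutes the [N] nonzero classes
    modulo [p], so it multiplies the product of their representatives by [x ^ N] without changing
    its residue. *)
Lemma unramified_unit_pow x : x \in W -> x != 0 -> v x = 0 -> vgt v 0 (x ^+ N - 1).
Proof.
move=> xW x0 vx.
have [rho [rW rO rsep rcov]] := subspace_reps hp hK hv hdiv W.
have [t0 ht0] := rcov 0 (mem0v _) (vge0 v 0).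
have ht0' t : vge v 1 (rho t) -> t = t0.
  by move=> ht; apply: rsep; apply: (vgeB hvD) => //; move: ht0; rewrite sub0r => /(vgeN hvD); rewrite opprK.
have xcov t : exists t', vge v 1 (x * rho t - rho t').
  apply: rcov; rewrite ?memvM // -[0%R : rat]add0r.
  by apply: (vgeM hvD) => //; right; rewrite vx.
have [pi hpi] := choice xcov.
have piinj : injective pi.
  move=> t t' e; apply: rsep; apply: (vge_mull hvD x0); rewrite vx add0r mulrBr.
  by have := vgeB hvD (hpi t) (hpi t'); rewrite e opprB addrA subrK.
have pit0 t : (pi t == t0) = (t == t0).
  have h : pi t0 = t0.
    apply: ht0'; rewrite -(subKr (x * rho t0) (rho _)); apply: (vgeB hvD) => //.
    have h0 : vge v 1 (rho t0) by move: ht0; rewrite sub0r => /(vgeN hvD); rewrite opprK.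
    by rewrite -[1%R : rat]add0r; apply: (vgeM hvD) => //; right; rewrite vx.
  by rewrite -{1}h (inj_eq piinj).
pose F := subfield_type hWF.
have hvF := subfield_valued hWF hv.1; set w := (fun _ => _) in hvF.
pose x' : F := subfield_sub hWF xW; pose r t : F := subfield_sub hWF (rW t).
have xr t : vge w 0 (r t) by case: (rO t) => h; [left; apply/subfield_val_inj; rewrite subfield_subK h subfield_val0|right].
have vgtF (z : F) (c : rat) : vgt v c (subfield_val z) -> vgt w c z.
  by case=> h; [left; apply/eqP; rewrite -subfield_val_eq0; apply/eqP|right].
have x'0 : x' != 0.
  by apply: contraNneq x0 => h; rewrite -(subfield_subK hWF xW) -/x' h subfield_val0.
have vx' : vge w 0 x' by right; rewrite /w subfield_subK vx.
have [] := vgt_prod hvF (P := fun t => t != t0) (F := fun t => x' * r t) (G := fun t => r (pi t)).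
- by move=> t _; rewrite -[0%R : rat]add0r; apply: (vgeM hvF).
- move=> t _; apply: vgtF; rewrite subfield_valB subfield_valM.
  exact: vge_gt (hpi t).
move=> _; have -> : \prod_(t | t != t0) r (pi t) = \prod_(t | t != t0) r t.
  rewrite [RHS](reindex_inj piinj); apply: eq_bigl => t; by rewrite pit0.
rewrite big_split /= prodr_const.
have -> : #|(fun t => t != t0)| = N.
  have cT : #|{ffun 'I_(\dim W) -> 'I_p}| = (p ^ n)%N by rewrite card_ffun !card_ord dimW.
  rewrite /N -cT -(cardC1 t0).
  by apply: eq_card => t; rewrite !inE.
have [P0 vP] : \prod_(t | t != t0) r t != 0 /\ w (\prod_(t | t != t0) r t) = 0.
  apply: (big_ind (fun z => z != 0 /\ w z = 0)).
  - by rewrite oner_neq0 (v1 hvF).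
  - by move=> a b [a0 wa] [b0 wb]; rewrite mulf_neq0 // (valuationM hvF.1) // wa wb addr0.
  - move=> t ht; have [h1 h2] : rho t != 0 /\ v (rho t) < 1.
      by apply: not_vge => h; move: ht; rewrite (ht0' t h) eqxx.
    split.
      by apply: contraNneq h1 => h; rewrite -(subfield_subK hWF (rW t)) -/(r t) h subfield_val0.
    rewrite /w subfield_subK; have := vge_val h1 (rO t); move: h2.
    have [z ->] := unramified_int (rW t) h1; rewrite divr1 -[1%R : rat]/(1%:~R) ltr_int ler0z => h2 h3.
    by have -> : z = 0 by lia.
rewrite -[X in _ - X]mul1r -mulrBl => h.
have := vgt_mulr hvF P0 (r := 0) (y := x' ^+ N - 1); rewrite vP addr0 => /(_ h).
have e : subfield_val (x' ^+ N - 1) = x ^+ N - 1 by rewrite subfield_valB subfield_valX subfield_val_1 subfield_subK.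
by case=> [h'|h']; [left; rewrite -e h' subfield_val0|right; rewrite -e].
Qed.

(** In [x ^ q - y ^ q = (x - y) * S] the factor [S] is congruent to [q x ^ (q - 1)], a unit, hence
    is nonzero. *)
Lemma unity_root_close (x y : D) (q : nat) : x * y = y * x -> ~~ (p %| q)%N ->
  x ^+ q = 1 -> y ^+ q = 1 -> vgt v 0 (x - y) -> x = y.
Proof.
move=> xy pq xq yq h.
have q0 : (0 < q)%N by case: q pq {xq yq}; rewrite // dvdn0.
have n0 (z : D) : z ^+ q = 1 -> z != 0.
  by move=> hz; apply: contraNneq (oner_neq0 D) => z0; rewrite -hz z0 expr0n gtn_eqF.
have v0 (z : D) : z ^+ q = 1 -> v z = 0.
  move=> hz; have := vX hvD q (n0 z hz); rewrite hz (v1 hvD) => /esym/eqP.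
  by rewrite mulrn_eq0 gtn_eqF //= => /eqP.
have := subrXX_comm q xy; rewrite xq yq subrr => /esym/eqP.
apply: contraTeq; rewrite -subr_eq0 => d0.
apply: (mul_neq0 hvD) => //.
have vx i : vge v 0 (x ^+ i) by rewrite -[0%R : rat](mul0rn _ i); apply: (vgeX hvD); right; rewrite v0.
have vy i : vge v 0 (y ^+ i) by rewrite -[0%R : rat](mul0rn _ i); apply: (vgeX hvD); right; rewrite v0.
have hs : vgt v 0 (\sum_(i < q) x ^+ (q.-1 - i) * y ^+ i - (x ^+ q.-1) *+ q).
  have -> : (x ^+ q.-1) *+ q = \sum_(i < q) x ^+ q.-1 by rewrite sumr_const card_ord.
  rewrite -sumrB; apply: (vgt_sum hvD) => i _.
  have -> : x ^+ q.-1 = x ^+ (q.-1 - i) * x ^+ i.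
    by rewrite -exprD subnK // -ltnS prednK.
  rewrite -mulrBr -[0%R : rat]add0r; apply: (vgtM hvD) => //.
  by apply: (vgt_exp hvD); [have := vx 1%N; rewrite expr1|apply: (vgtC hvD)].
have e0 : (x ^+ q.-1) *+ q != 0.
  by rewrite -mulr_natl (mul_neq0 hvD) ?(natD_neq0 _ hK) // (exp_neq0 hvD) // n0.
have ve : v (x ^+ q.-1 *+ q) = 0.
  rewrite -mulr_natl (valuationM hv.1) ?(natD_neq0 _ hK) ?(exp_neq0 hvD) ?n0 //.
  rewrite (v_nat hK hv) // (vp_coprime hp hK) // add0r.
  by rewrite (vX hvD) ?n0 // v0 // mul0rn.
by case: (vgt_close hvD e0 (y := \sum_(i < q) x ^+ (q.-1 - i) * y ^+ i)); rewrite ?ve.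
Qed.

(** Each of the [N] nonzero classes lifts to an [N]-th root of unity (its Teichmueller
    representative). These are [N] distinct ones in a field, so one of them is primitive. *)
Lemma unramified_omega : exists om, [/\ om \in W, om ^+ N = 1,
  (forall i j, vgt v 0 (om ^+ i - om ^+ j) -> i = j %[mod N]) &
  (forall x, x \in W -> x != 0 -> v x = 0 -> exists2 i, (i < N)%N & vgt v 0 (x - om ^+ i))].
Proof.
have W1 := subfield1 hWF; have WC := subfieldC hWF.
have WX x i : x \in W -> x ^+ i \in W.
  by move=> xW; elim: i => [|i IH]; rewrite ?expr0 // exprS memvM.
have root x : x \in W -> x != 0 -> v x = 0 -> exists y, [/\ y \in W, vgt v 0 (y - x) & y ^+ N = 1].
  move=> xW x0 vx; have := unramified_unit_pow xW x0 vx.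
  have := root_tame hp hK hv hdiv (S := W) (M := 1) (q := N) (a := 1) (y0 := x) isT unramified_int.
  rewrite vx mulr0; apply => //; last exact: p_ndvd_N.
  by move=> y _; rewrite mul1r mulr1.
have [rho [rW rO rsep rcov]] := subspace_reps hp hK hv hdiv W.
have [t0 ht0] := rcov 0 (mem0v _) (vge0 v 0).
have ht0' t : vge v 1 (rho t) -> t = t0.
  by move=> ht; apply: rsep; apply: (vgeB hvD) => //; move: ht0; rewrite sub0r => /(vgeN hvD); rewrite opprK.
have ru t : t != t0 -> rho t != 0 /\ v (rho t) = 0.
  move=> ht; have [h1 h2] : rho t != 0 /\ v (rho t) < 1.
    by apply: not_vge => h; move: ht; rewrite (ht0' t h) eqxx.
  split => //; have := vge_val h1 (rO t); move: h2.
  have [z ->] := unramified_int (rW t) h1; rewrite divr1 -[1%R : rat]/(1%:~R) ltr_int ler0z => h2 h3.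
  by have -> : z = 0 by lia.
have zex t : exists z : subfield_type hWF, t != t0 ->
    vgt v 0 (subfield_val z - rho t) /\ z ^+ N = 1.
  have [->|ht] := eqVneq t t0; first by exists 0.
  have [r0 vr] := ru t ht; have [y [yW h1 h2]] := root _ (rW t) r0 vr.
  exists (subfield_sub hWF yW) => _; split=> //.
  by apply: subfield_val_inj; rewrite subfield_valX subfield_val_1.
have [z hz] := choice zex.
pose rs := [seq z t | t <- enum (predC1 t0)].
have /hasP[om _ hom] : has N.-primitive_root rs.
  apply: has_prim_root; first exact: N_gt0.
  - by apply/allP => y /mapP[t]; rewrite mem_enum /= => ht ->; apply/unity_rootP; case: (hz t ht).
  - rewrite map_inj_in_uniq ?enum_uniq // => t t'; rewrite !mem_enum /= => ht ht' e.
    have [h1 _] := hz t ht; have [h2 _] := hz t' ht'; apply: rsep.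
    apply: unramified_vgt; first by rewrite rpredB.
    by apply: (vgt_trans hvD) h2; rewrite -e; apply: (vgtC hvD).
  - have cT : #|{ffun 'I_(\dim W) -> 'I_p}| = (p ^ n)%N by rewrite card_ffun !card_ord dimW.
    by rewrite size_map -cardE cardC1 cT.
exists (subfield_val om); split.
- exact: subfield_valP.
- by rewrite -subfield_valX (prim_expr_order hom) subfield_val_1.
- move=> i j; rewrite -!subfield_valX => h.
  have e : subfield_val (om ^+ i) = subfield_val (om ^+ j).
    apply: (unity_root_close _ p_ndvd_N) h.
    + by apply: WC; apply: subfield_valP.
    + by rewrite -subfield_valX -exprM mulnC exprM (prim_expr_order hom) expr1n subfield_val_1.
    + by rewrite -subfield_valX -exprM mulnC exprM (prim_expr_order hom) expr1n subfield_val_1.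
  by apply/eqP; rewrite -(eq_prim_root_expr hom); apply/eqP/(subfield_val_inj e).
- move=> x xW x0 vx; have [y [yW h1 h2]] := root x xW x0 vx.
  have /(prim_rootP hom)[i hi] : subfield_sub hWF yW ^+ N = 1.
    by apply: subfield_val_inj; rewrite subfield_valX subfield_val_1.
  exists i; first exact: ltn_ord.
  by apply: (vgtC hvD); rewrite -subfield_valX -hi subfield_subK.
Qed.

End UnramifiedResidue.

(* An explicit presentation of the graded ring of a division algebra of degree [n]: modulo
   elements of larger valuation, every nonzero element is a product of powers of [om] and [g]. *)
Record Dn_coordinates (p n : nat) (K : fieldType) (D : falgType K) (v : D -> rat)
    (W : {aspace D}) (om g : D) : Prop := {
  coord_W : unramified_subfield v W;
  coord_omW : om \in W;
  coord_om1 : om ^+ (p ^ n).-1 = 1;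
  coord_om_inj : forall i j, vgt v 0 (om ^+ i - om ^+ j) -> i = j %[mod (p ^ n).-1];
  coord_g0 : g != 0;
  coord_vg : v g = n%:R^-1;
  coord_frob : conj_Frobenius p v W g;
  coord_conj : g * om * g^-1 = om ^+ p;
  coord_val : forall x, x != 0 -> exists z : int, v x = z%:~R / n%:R;
  coord_res : forall x, x != 0 -> v x = 0 ->
    exists2 i, (i < (p ^ n).-1)%N & vgt v 0 (x - om ^+ i) }.

(** * Leading terms in the division algebra *)

Section Coordinates.
Variables (p : nat) (K : fieldType) (vp : K -> rat) (D : falgType K) (v : D -> rat).
Hypotheses (hp : prime p) (hK : is_padic_field p vp).
Hypotheses (hv : extends_valuation vp v) (hdiv : is_division D).
Variables (n : nat) (W : {aspace D}) (g : D).
Hypotheses (hn : (0 < n)%N) (hW : unramified_subfield v W) (dimW : \dim W = n).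
Hypotheses (g0 : g != 0) (vg : v g = n%:R^-1) (hg : conj_Frobenius p v W g).
Hypothesis dimD : \dim {:D} = (n ^ 2)%N.

Let hvK := padic_valued hK.
Let hvD := division_valued hv hdiv.
Let N := (p ^ n).-1.

Lemma v_gX i : v (g ^+ i) = i%:R / n%:R.
Proof. by rewrite (vX hvD) // vg [RHS]mulr_natl. Qed.

Lemma n_gt0Q : 0 < n%:R :> rat. Proof. by rewrite ltr0n. Qed.

Lemma ltn_frac i j : (i%:R / n%:R < j%:R / n%:R :> rat) = (i < j)%N.
Proof. by rewrite ltr_pM2r ?invr_gt0 ?n_gt0Q // ltr_nat. Qed.

Lemma frac1 : n%:R / n%:R = 1 :> rat.
Proof. by rewrite mulfV // gt_eqF // n_gt0Q. Qed.

Lemma frac_lt1 i : (i < n)%N -> i%:R / n%:R < 1 :> rat.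
Proof. by move=> h; rewrite -[X in _ < X]frac1 ltn_frac. Qed.

(** Values on [W] are integers while [g ^ i] has value [i/n] with [i < n]: no two terms can cancel,
    and the first term with unit coefficient leads. *)
Lemma unramified_expansion (w : 'I_n -> D) :
  (forall i, w i \in W) -> (forall i, vge v 0 (w i)) ->
  (forall i, vge v 1 (w i)) \/
  exists i0 : 'I_n, [/\ w i0 != 0, v (w i0) = 0 &
    vgt v (i0%:R / n%:R) (\sum_(i < n) w i * g ^+ i - w i0 * g ^+ i0)].
Proof.
move=> wW wO; have [h|/existsNP[j hj]] := EM (forall i, vge v 1 (w i)); [by left|right].
have ex : exists i : nat, `[< exists2 j : 'I_n, j = i :> nat & ~ vge v 1 (w j) >].
  by exists j; apply/asboolP; exists j.
case: (ex_minnP ex) => m /asboolP[i0 i0m hi0] hmin.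
have [w0 w1] := not_vge hi0.
exists i0; split=> //.
  have := vge_val w0 (wO i0); have [z hz] := unramified_int hW (wW i0) w0.
  move: w1; rewrite hz divr1 -[1%R : rat]/(1%:~R) ltr_int ler0z => h1 h2.
  by have -> : z = 0 by lia.
rewrite (bigD1 i0) //= addrAC subrr add0r; apply: (vgt_sum hvD) => i ii0.
have [lt|ge] := ltnP i i0.
  have hi : vge v 1 (w i).
    apply: contrapT => h; have : (m <= i)%N by apply: hmin; apply/asboolP; exists i.
    by rewrite -i0m leqNgt lt.
  apply: (vge_gt _ (vgeM hvD hi (vge_refl v _))).
  rewrite v_gX -{3}frac1 -mulrDl -natrD ltn_frac; have := ltn_ord i0; lia.
apply: (vge_gt _ (vgeM hvD (wO i) (vge_refl v _))).
rewrite v_gX add0r ltn_frac ltn_neqAle ge andbT.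
by apply: contra ii0 => /eqP e; apply/eqP/val_inj.
Qed.

(** There are [p ^ (n * n)] expansions with digits in [W], pairwise distinct modulo [p] by
    [unramified_expansion]. As [dim D = n ^ 2] they exhaust the classes of integral elements. *)
Lemma expansion_mod_p x : vge v 0 x -> exists w : 'I_n -> D,
  [/\ forall i, w i \in W, forall i, vge v 0 (w i) & vge v 1 (x - \sum_(i < n) w i * g ^+ i)].
Proof.
move=> hx.
have [rho [rW rO rsep rcov]] := subspace_reps hp hK hv hdiv W.
have [rho2 [rW2 rO2 rsep2 rcov2]] := subspace_reps hp hK hv hdiv {:D}%VS.
pose r1 (c : {ffun 'I_n -> {ffun 'I_(\dim W) -> 'I_p}}) := \sum_(i < n) rho (c i) * g ^+ i.
have r1O c : vge v 0 (r1 c).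
  apply: (vge_sum hvD) => i _; apply: vge_le (vgeM hvD (rO _) (vge_refl v _)).
  by rewrite v_gX add0r divr_ge0.
have sep c c' : vge v 1 (r1 c - r1 c') -> c = c'.
  move=> h; apply/ffunP => i; apply: rsep.
  have [||h'|[i0 [w0 vw hs]]] := @unramified_expansion (fun i => rho (c i) - rho (c' i)).
  - by move=> j; rewrite rpredB.
  - by move=> j; apply: (vgeB hvD).
  - exact: h'.
  exfalso.
  have e : \sum_(i < n) (rho (c i) - rho (c' i)) * g ^+ i = r1 c - r1 c'.
    by rewrite /r1 -sumrB; apply: eq_bigr => j _; rewrite mulrBl.
  rewrite e in hs.
  have ne : (rho (c i0) - rho (c' i0)) * g ^+ i0 != 0 by rewrite (mul_neq0 hvD) // (exp_neq0 hvD).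
  apply: (vgt_irrefl (v := v) ne).
  rewrite (valuationM hv.1) ?(exp_neq0 hvD) // vw add0r v_gX.
  rewrite -(subKr (r1 c - r1 c') (_ * _)); apply: (vgtB hvD) => //.
  by apply: vge_gt h; rewrite frac_lt1.
have cov c : exists t, vge v 1 (r1 c - rho2 t) by apply: rcov2; rewrite ?memvf.
have [_ H] := leq_card_sep_cover hvD sep cov.
have card : (#|{ffun 'I_(\dim {:D}) -> 'I_p}| <= #|{ffun 'I_n -> {ffun 'I_(\dim W) -> 'I_p}}|)%N.
  by rewrite !card_ffun !card_ord dimW dimD -expnM mulnn.
have [t ht] := rcov2 x (memvf x) hx; have [c hc] := H card t.
exists (fun i => rho (c i)); split=> //.
rewrite -(subrK (rho2 t) x) -addrA; apply: (vgeD hvD) => //.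
by rewrite -opprB; apply: (vgeN hvD).
Qed.

Lemma leading_term x : vge v 0 x -> ~ vge v 1 x -> exists w i0,
  [/\ w \in W, w != 0, v w = 0, (i0 < n)%N & vgt v (i0%:R / n%:R) (x - w * g ^+ i0)].
Proof.
move=> hx hx1; have [w [wW wO hw]] := expansion_mod_p hx.
have [h|[i0 [w0 vw hs]]] := unramified_expansion wW wO.
  case: hx1; rewrite -(subrK (\sum_(i < n) w i * g ^+ i) x); apply: (vgeD hvD) => //.
  apply: (vge_sum hvD) => i _; apply: vge_le (vgeM hvD (h i) (vge_refl v _)).
  by rewrite v_gX lerDl divr_ge0.
exists (w i0), i0; split; [exact: wW|exact: w0|exact: vw|exact: ltn_ord|].
rewrite -(subrK (\sum_(i < n) w i * g ^+ i) x) -addrA; apply: (vgtD hvD) => //.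
by apply: vge_gt hw; rewrite frac_lt1.
Qed.

Lemma leading_val x w i : w != 0 -> v w = 0 -> vgt v (i%:R / n%:R) (x - w * g ^+ i) ->
  x != 0 /\ v x = i%:R / n%:R.
Proof.
move=> w0 vw h; have ne : w * g ^+ i != 0 by rewrite (mul_neq0 hvD) // (exp_neq0 hvD).
have vv : v (w * g ^+ i) = i%:R / n%:R by rewrite (valuationM hv.1) ?(exp_neq0 hvD) // vw add0r v_gX.
by rewrite -vv; apply: (vgt_close hvD) => //; rewrite vv.
Qed.

Lemma Dn_val x : x != 0 -> exists z : int, v x = z%:~R / n%:R.
Proof.
move=> x0; pose m := Num.floor (v x).
pose y := p%:R ^ (- m) *: x.
have pz0 := pz_neq0 hp hK (- m).
have y0 : y != 0 by rewrite scaler_eq0 negb_or pz0.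
have vy : v y = v x - m%:~R by rewrite (vZ hv) // (vp_pz hp hK) mulrNz addrC.
have /andP[f1 f2] := floor_itv (v x).
have [||w [i0 [wW w0 vw i0n hw]]] := @leading_term y.
- by right; rewrite vy subr_ge0.
- by move=> /(vge_val y0); rewrite vy lerBrDl leNgt => /negP; apply; move: f2; rewrite intrD.
have [_ vy'] := leading_val w0 vw hw.
exists (i0%:Z + m * n%:Z); rewrite intrD intrM mulrDl mulfK ?gt_eqF ?n_gt0Q //.
by rewrite -vy' vy subrK.
Qed.

Lemma Dn_res x : x != 0 -> v x = 0 -> exists w, [/\ w \in W, w != 0, v w = 0 & vgt v 0 (x - w)].
Proof.
move=> x0 vx; have [||w [i0 [wW w0 vw i0n hw]]] := @leading_term x.
- by right; rewrite vx.
- by move=> /(vge_val x0); rewrite vx.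
have [_ vx'] := leading_val w0 vw hw.
have i00 : i0 = 0%N.
  move: vx'; rewrite vx => /esym/eqP; rewrite mulf_eq0 invr_eq0 !pnatr_eq0.
  by rewrite (gtn_eqF hn) orbF => /eqP.
by exists w; split=> //; move: hw; rewrite i00 expr0 mulr1 mul0r.
Qed.

(** [g om g^-1] and [om ^ p] are both [N]-th roots of unity, congruent by the Frobenius property and
    commuting inside [W], so they are equal and not merely congruent. *)
Lemma exists_coordinates : exists om, Dn_coordinates p n v W om g.
Proof.
have [om [omW om1 omi omr]] := unramified_omega hp hK hv hdiv hn hW dimW.
exists om; split=> //.
- have pN := p_ndvd_N hp hn.
  have hWF := unramified_is_subfield hdiv hW.
  have [/= cW hc] := hg omW.
  have N0 : (0 < (p ^ n).-1)%N := N_gt0 hp hn.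
  have om0 : om != 0.
    by apply: contraNneq (oner_neq0 D) => o0; rewrite -om1 o0 expr0n gtn_eqF.
  have vom : v om = 0.
    have := vX hvD (p ^ n).-1 om0; rewrite om1 (v1 hvD) => /esym/eqP.
    by rewrite mulrn_eq0 gtn_eqF //= => /eqP.
  have vom' : vge v 0 om by right; rewrite vom.
  apply: (unity_root_close hp hK hv hdiv _ pN _ _ (hc vom')).
  + apply: (subfieldC hWF) => //.
    by elim: p => [|i IH]; rewrite ?expr0 ?(subfield1 hWF) // exprS memvM.
  + have conjX i : (g * om * g^-1) ^+ i = g * om ^+ i * g^-1.
      elim: i => [|i IH]; first by rewrite !expr0 mulr1 mulrV // hdiv.
      by rewrite !exprS IH !mulrA mulrVK ?hdiv.
    by rewrite conjX om1 mulr1 mulrV // hdiv.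
  + by rewrite -exprM mulnC exprM om1 expr1n.
- exact: Dn_val.
- move=> x x0 vx; have [w [wW w0 vw hw]] := Dn_res x0 vx.
  have [i iN hi] := omr w wW w0 vw; exists i => //.
  exact: vgt_trans hw hi.
Qed.

End Coordinates.

(** * Centralisers of subfields *)

Section CentraliserDimension.
Variables (K : fieldType) (D : falgType K) (hdiv : is_division D).
Variables (L : {aspace D}) (L1 : 1 \in L).

Let d := \dim L.
Let l (j : 'I_d) : D := tnth (vbasis L) j.

(** The action on [D] of the sum of the [e j ⊗ l j], a general element of [D ⊗ L], by left and right
    multiplication. *)
Definition bimodule_op (e : 'I_d -> D) (u : D) : D := \sum_j e j * u * l j.

Lemma bimodule_opD e1 e2 u :
  bimodule_op (fun j => e1 j + e2 j) u = bimodule_op e1 u + bimodule_op e2 u.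
Proof. by rewrite /bimodule_op -big_split; apply: eq_bigr => j _; rewrite !mulrDl. Qed.

Lemma bimodule_opM c e u : bimodule_op (fun j => c * e j) u = c * bimodule_op e u.
Proof. by rewrite /bimodule_op mulr_sumr; apply: eq_bigr => j _; rewrite !mulrA. Qed.

Lemma bimodule_opN e u : bimodule_op (fun j => - e j) u = - bimodule_op e u.
Proof. by rewrite /bimodule_op -sumrN; apply: eq_bigr => j _; rewrite !mulNr. Qed.

Lemma bimodule_op_sum (I : finType) (e : I -> 'I_d -> D) u :
  bimodule_op (fun j => \sum_i e i j) u = \sum_i bimodule_op (e i) u.
Proof.
rewrite /bimodule_op exchange_big /=; apply: eq_bigr => j _.
by rewrite !mulr_suml.
Qed.

Lemma bimodule_op_right e x : x \in L ->
  exists e', forall u, bimodule_op e' u = bimodule_op e u * x.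
Proof.
move=> xL; have lL j : l j * x \in L by rewrite memvM // vbasis_mem // mem_tnth.
exists (fun i => \sum_j coord (vbasis L) i (l j * x) *: e j) => u.
rewrite /bimodule_op mulr_suml.
under eq_bigr => i _ do rewrite !mulr_suml.
rewrite exchange_big /=; apply: eq_bigr => j _.
rewrite -mulrA {2}(coord_vbasis (lL j)) mulr_sumr; apply: eq_bigr => i _.
by rewrite -!scalerAl -scalerAr /l !(tnth_nth 0).
Qed.

Lemma bimodule_op_id : exists e, forall u, bimodule_op e u = u.
Proof.
exists (fun i => (coord (vbasis L) i 1)%:A) => u.
rewrite /bimodule_op -[RHS]mulr1 [in RHS](coord_vbasis L1) mulr_sumr.
by apply: eq_bigr => i _; rewrite -!scalerAl mul1r -scalerAr /l (tnth_nth 0).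
Qed.

Definition dual_family k (x : 'I_k -> D) (e : 'I_k -> 'I_d -> D) :=
  forall i j, bimodule_op (e j) (x i) = (i == j)%:R.

(** Duality makes the map [c |-> sum c i * e i] from [D ^ k] to [D ^ d] injective. *)
Lemma dual_family_size k x e : @dual_family k x e -> (k <= d)%N.
Proof.
move=> h.
pose f (c : {ffun 'I_k -> D}) : {ffun 'I_d -> D} := [ffun j => \sum_i c i * e i j].
have flin : linear f.
  move=> a c1 c2; apply/ffunP => j; rewrite !ffunE scaler_sumr -big_split /=.
  by apply: eq_bigr => i _; rewrite !ffunE mulrDl scalerAl.
pose fL := GRing.isLinear.Build _ _ _ _ f flin.
pose F : {linear {ffun 'I_k -> D} -> {ffun 'I_d -> D}} := HB.pack f fL.
have inj : lker (linfun F) == 0%VS.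
  apply/lker0P => c1 c2; rewrite !lfunE /= => /ffunP e12.
  have ev (c : {ffun 'I_k -> D}) i : bimodule_op (f c) (x i) = c i.
    have -> : bimodule_op (f c) (x i) = bimodule_op (fun j => \sum_t c t * e t j) (x i).
      by apply: eq_bigr => j _; rewrite ffunE.
    rewrite bimodule_op_sum (bigD1 i) //= bimodule_opM h eqxx mulr1 big1 ?addr0 // => t ti.
    by rewrite bimodule_opM h eq_sym (negPf ti) mulr0.
  apply/ffunP => i; rewrite -!ev; apply: eq_bigr => j _; by rewrite e12.
have := dimvS (subvf (limg (linfun F))); rewrite limg_dim_eq ?(eqP inj) ?capv0 //.
rewrite !dimvf /dim /= !card_ord leq_pmul2r //.
by have := adim_gt0 (aspacef D); rewrite /= dimvf.
Qed.

(** A density argument. For a dual family of maximal size every operator satisfies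
    [e' y = sum e' (x j) * e j y]: otherwise the difference kills all [x j] but not [y], and
    normalised at [y] it enlarges the family. So [D] is the sum of the [x j * C(L)], with at most
    [dim L] terms. *)
Lemma dim_centraliser : (\dim {:D} <= \dim L * \dim 'C(L))%N.
Proof.
pose good k := exists x e, @dual_family k x e.
have good0 : exists k, `[< good k >].
  by exists 0%N; apply/asboolP; exists (fun => 0), (fun _ _ => 0); case.
have bnd k : `[< good k >] -> (k <= d)%N by move/asboolP => [x [e]]; apply: dual_family_size.
case: (ex_maxnP good0 bnd) => k /asboolP[x [e h]] kmax.
have key e' y : bimodule_op e' y = \sum_j bimodule_op e' (x j) * bimodule_op (e j) y.
  apply/eqP; rewrite -subr_eq0; apply/negP => /negP ne.
  set t := _ - _ in ne.
  pose e1 i := e' i - \sum_j bimodule_op e' (x j) * e j i.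
  have e1E u : bimodule_op e1 u = bimodule_op e' u - \sum_j bimodule_op e' (x j) * bimodule_op (e j) u.
    rewrite bimodule_opD bimodule_opN bimodule_op_sum; congr (_ - _).
    by apply: eq_bigr => j _; rewrite bimodule_opM.
  have e1x i : bimodule_op e1 (x i) = 0.
    rewrite e1E (bigD1 i) //= h eqxx mulr1 big1 ?addr0 ?subrr // => j ji.
    by rewrite h eq_sym (negPf ji) mulr0.
  pose e2 i := t^-1 * e1 i.
  have e2x i : bimodule_op e2 (x i) = 0 by rewrite bimodule_opM e1x mulr0.
  have e2y : bimodule_op e2 y = 1 by rewrite bimodule_opM e1E mulVr // hdiv.
  have : (k.+1 <= k)%N; last by rewrite ltnn.
  apply: kmax; apply/asboolP.
  exists (fun i => if unlift ord0 i is Some i' then x i' else y).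
  exists (fun j => if unlift ord0 j is Some j' then
    (fun i => e j' i + - (bimodule_op (e j') y * e2 i)) else e2).
  move=> i j; case: (unliftP ord0 i) => [i' ->|->]; case: (unliftP ord0 j) => [j' ->|->] /=.
  - by rewrite bimodule_opD bimodule_opN bimodule_opM e2x mulr0 subr0 h (inj_eq lift_inj).
  - by rewrite e2x.
  - by rewrite bimodule_opD bimodule_opN bimodule_opM e2y mulr1 subrr.
  - by rewrite e2y ?eqxx.
(* [key] for [e j] followed by right multiplication by [z] reads [e j y * z = z * e j y]. *)
have cC j y : bimodule_op (e j) y \in 'C(L)%VS.
  apply/centvP => z zL; have [e' he'] := bimodule_op_right (e j) zL.
  have := key e' y; rewrite he' => ->.
  rewrite (bigD1 j) //= he' h eqxx mul1r big1 ?addr0 // => i ij.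
  by rewrite he' h (negPf ij) !mul0r.
have sub : ({:D} <= \sum_(j < k) (<[x j]> * 'C(L)))%VS.
  apply/subvP => y _; have [e0 he0] := bimodule_op_id.
  have := key e0 y; rewrite he0 => ->.
  by apply: memv_sumr => j _; rewrite he0; apply: memv_mul; rewrite ?memv_line ?cC.
apply: leq_trans (dimvS sub) _; apply: (leq_trans (dimv_leq_sum _ _ _)).
apply: (@leq_trans (\sum_(j < k) \dim 'C(L))).
  apply: leq_sum => j _; apply: leq_trans (dim_prodv _ _) _.
  by rewrite dim_vline; case: eqP; rewrite ?mul1n.
by rewrite sum_nat_const card_ord leq_mul2r bnd ?orbT //; apply/asboolP; exists x, e.
Qed.

End CentraliserDimension.

(** * Counting residues and values of a subalgebra *)

Lemma count_dvdn_iota f k : (0 < f)%N -> count (fun j => f %| j)%N (iota 0 (f * k)) = k.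
Proof.
move=> f0; elim: k => [|k IH]; first by rewrite muln0.
rewrite mulnS addnC iotaD count_cat IH add0n.
case: f f0 {IH} => // f _; rewrite /= dvdn_mulr // -[RHS]addn1; congr (_ + _)%N.
rewrite (eq_in_count (a2 := pred0)) ?count_pred0 ?addn0 // => j; rewrite mem_iota => /andP[h1 h2].
apply/negbTE; have -> : j = (f.+1 * k + (j - f.+1 * k))%N by lia.
by rewrite dvdn_addr ?dvdn_mulr // gtnNdvd //; lia.
Qed.

Lemma count_le (T : eqType) (P Q : pred T) (s : seq T) :
  {in s, forall x, P x -> Q x} -> (count P s <= count Q s)%N.
Proof.
elim: s => //= x s IH h; apply: leq_add.
  by have := h x (mem_head _ _); case: (P x); case: (Q x) => // /(_ isT).
by apply: IH => y ys; apply: h; rewrite inE ys orbT.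
Qed.

Lemma count_eq (T : eqType) (P Q : pred T) (s : seq T) :
  {in s, forall x, P x -> Q x} -> (count Q s <= count P s)%N -> {in s, forall x, Q x -> P x}.
Proof.
move=> h le x xs Qx; apply: contraLR le => nPx; rewrite -ltnNge.
have [s1 [s2 es]] : exists s1 s2, s = s1 ++ x :: s2 by case/splitPr: xs => s1 s2; exists s1, s2.
have c1 : (count P s1 <= count Q s1)%N.
  by apply: count_le => y ys; apply: h; rewrite es mem_cat ys.
have c2 : (count P s2 <= count Q s2)%N.
  by apply: count_le => y ys; apply: h; rewrite es mem_cat inE ys !orbT.
by rewrite es !count_cat /= Qx (negPf nPx) add0n; lia.
Qed.

Lemma min_dvdn (P : nat -> Prop) f : (forall a b, (b <= a)%N -> P a -> P b -> P (a - b)%N) ->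
  (0 < f)%N -> P f -> (forall j, (0 < j)%N -> P j -> (f <= j)%N) -> forall j, P j -> (f %| j)%N.
Proof.
move=> hB f0 Pf fmin j; elim/ltn_ind: j => j IH Pj.
have [jf|fj] := ltnP j f.
  by case: j jf {IH} Pj => // j jf /(fmin j.+1 isT); rewrite leqNgt jf.
rewrite -(subnK fj) dvdn_add //; apply: IH; [by lia|exact: hB].
Qed.

Lemma exists_min (P : nat -> Prop) a : P a -> exists2 m, P m & forall j, P j -> (m <= j)%N.
Proof.
move=> Pa; have ex : exists i, `[< P i >] by exists a; apply/asboolP.
case: (ex_minnP ex) => m /asboolP Pm hm; exists m => // j Pj; by apply: hm; apply/asboolP.
Qed.

Lemma dvdn_pred_exp p a b : (a %| b)%N -> ((p ^ a).-1 %| (p ^ b).-1)%N.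
Proof.
move=> /dvdnP[k ->]; rewrite mulnC expnM.
elim: k => [|k IH]; first by rewrite expn0 dvdn0.
case: (p ^ a)%N IH => [|q] IH; first by rewrite exp0n.
have -> : (q.+1 ^ k.+1).-1 = (q * q.+1 ^ k + (q.+1 ^ k).-1)%N.
  rewrite expnS mulSn; have := expn_gt0 q.+1 k; case: (q.+1 ^ k)%N => // a' _; lia.
by rewrite dvdn_add // dvdn_mulr.
Qed.

Section Counting.
Variables (p n : nat) (K : fieldType) (vp : K -> rat) (D : falgType K) (v : D -> rat).
Hypotheses (hp : prime p) (hn : (0 < n)%N) (hK : is_padic_field p vp).
Hypotheses (hv : extends_valuation vp v) (hdiv : is_division D).
Variables (W : {aspace D}) (om g : D).
Hypothesis hc : Dn_coordinates p n v W om g.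

Let hvD := division_valued hv hdiv.
Let N := (p ^ n).-1.

Definition has_residue (S : {aspace D}) (i : nat) := exists2 x, x \in S & vgt v 0 (x - om ^+ i).
Definition has_val (S : {aspace D}) (j : nat) := exists x, [/\ x \in S, x != 0 & v x = j%:R / n%:R].

Lemma om_neq0 : om != 0.
Proof.
apply: contraNneq (oner_neq0 D) => o0; rewrite -(coord_om1 hc) o0 expr0n gtn_eqF //.
exact: (N_gt0 hp hn).
Qed.

Lemma v_om : v om = 0.
Proof.
have := vX hvD (p ^ n).-1 om_neq0; rewrite (coord_om1 hc) (v1 hvD) => /esym/eqP.
by rewrite mulrn_eq0 gtn_eqF ?(N_gt0 hp hn) //= => /eqP.
Qed.

Lemma v_omX i : v (om ^+ i) = 0.
Proof. by rewrite (vX hvD) ?om_neq0 // v_om mul0rn. Qed.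

Lemma omX_neq0 i : om ^+ i != 0.
Proof. by rewrite (exp_neq0 hvD) // om_neq0. Qed.

Lemma om_mod i j : i = j %[mod N] -> om ^+ i = om ^+ j.
Proof.
move=> h; rewrite (divn_eq i N) (divn_eq j N) h !exprD.
by rewrite -/N ![(_ * N)%N]mulnC !exprM (coord_om1 hc) !expr1n.
Qed.

Lemma res_unit x i : vgt v 0 (x - om ^+ i) -> x != 0 /\ v x = 0.
Proof.
by move=> h; case: (vgt_close hvD (omX_neq0 i) (y := x)); rewrite ?v_omX.
Qed.

Lemma vgt_frac x (k : nat) : vgt v (k%:R / n%:R) x -> vge v (k.+1%:R / n%:R) x.
Proof.
have [->|x0] := eqVneq x 0; first by left.
move=> /(vgt_val x0) h; right; have [z hz] := coord_val hc x0; move: h; rewrite hz.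
have n0 : 0 < n%:R^-1 :> rat by rewrite invr_gt0 ltr0n.
rewrite ltr_pM2r // ler_pM2r //.
have -> : (k%:R : rat) = (k%:Z)%:~R by [].
have -> : (k.+1%:R : rat) = (k.+1%:Z)%:~R by [].
by rewrite ltr_int ler_int; lia.
Qed.

(** Integral elements of [S] are approximated level by level up to [p]. At a level [j/n] that is a
    value of [S] the correction is 0 or one of at most [cI] residues times a fixed element of that
    value; other levels need no correction. *)
Lemma count_classes (S : {aspace D}) : 1 \in S ->
  (p ^ \dim S <= (1 + count (fun i => `[< has_residue S i >]) (iota 0 N)) ^
                 count (fun j => `[< has_val S j >]) (iota 0 n))%N.
Proof.
move=> S1.
set cI := count _ (iota 0 N).
have [r hr] : exists r : nat -> D, forall i, (has_residue S i -> vgt v 0 (r i - om ^+ i)) /\ r i \in S.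
  have ex i : exists x, (has_residue S i -> vgt v 0 (x - om ^+ i)) /\ x \in S.
    have [[x xS hx]|no] := EM (has_residue S i); first by exists x.
    by exists 0; rewrite mem0v.
  by have [f hf] := choice ex; exists f.
have cover m : (m <= n)%N -> exists s : seq D, [/\ {subset s <= S},
    size s = ((1 + cI) ^ count (fun j => `[< has_val S j >]) (iota 0 m))%N &
    forall x, x \in S -> vge v 0 x -> exists2 y, y \in s & vge v (m%:R / n%:R) (x - y)].
  elim: m => [|m IH] mn.
    exists [:: 0]; split=> //; first by move=> x; rewrite inE => /eqP ->; rewrite mem0v.
    by move=> x xS hx; exists 0; rewrite ?inE // subr0 mul0r.
  have [s [sS ssz scov]] := IH (ltnW mn).
  have rest x y : x \in S -> vge v 0 x -> y \in s -> vge v (m%:R / n%:R) (x - y) ->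
      vge v (m.+1%:R / n%:R) (x - y) \/ (x - y != 0 /\ v (x - y) = m%:R / n%:R).
    move=> xS hx ys h; have [h1|h1] := EM (vge v (m.+1%:R / n%:R) (x - y)); [by left|right].
    have [d0 dv] := not_vge h1; split=> //.
    apply/eqP; rewrite eq_le (vge_val d0 h) andbT leNgt; apply/negP => lt.
    by apply: h1; apply: vgt_frac; right.
  have -> : iota 0 m.+1 = iota 0 m ++ [:: m] by rewrite -addn1 iotaD.
  rewrite count_cat /= addn0.
  have [hm|hm] := EM (has_val S m); last first.
    exists s; split=> //; first by rewrite asboolF // addn0.
    move=> x xS hx; have [y ys hy] := scov x xS hx; exists y => //.
    case: (rest x y xS hx ys hy) => // -[d0 dv].
    case: hm; exists (x - y); split=> //. by rewrite rpredB ?(sS _ ys).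
  have [y0 [y0S y00 vy0]] := hm.
  pose t := 0 :: [seq r i * y0 | i <- iota 0 N & `[< has_residue S i >]].
  exists [seq y + z | y <- s, z <- t]; split.
  - move=> _ /allpairsP[[y z] /= [ys zt ->]]; rewrite rpredD ?(sS _ ys) //.
    move: zt; rewrite inE => /orP[/eqP ->|/mapP[i _ ->]]; first exact: mem0v.
    by rewrite memvM //; case: (hr i).
  - by rewrite size_allpairs ssz /= size_map size_filter asboolT // expnD expn1 add1n.
  - move=> x xS hx; have [y ys hy] := scov x xS hx.
    case: (rest x y xS hx ys hy) => [h|[d0 dv]].
      by exists (y + 0); rewrite ?addr0 //; apply/allpairsP; exists (y, 0); rewrite addr0 mem_head.
    have u0 : (x - y) * y0^-1 != 0 by rewrite (mul_neq0 hvD) ?invr_eq0.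
    have vu : v ((x - y) * y0^-1) = 0.
      by rewrite (valuationM hv.1) ?invr_eq0 // (vV hvD) // dv vy0 subrr.
    have [i iN hi] := coord_res hc u0 vu.
    have hresi : has_residue S i.
      by exists ((x - y) * y0^-1) => //; rewrite memvM ?memvV ?rpredB ?(sS _ ys).
    have [hri riS] := hr i.
    exists (y + r i * y0).
      apply/allpairsP; exists (y, r i * y0); split=> //=; rewrite inE; apply/orP; right.
      by apply/mapP; exists i; rewrite // mem_filter asboolT //= mem_iota.
    apply: vgt_frac; rewrite opprD addrA -vy0 -[v y0]add0r.
    have -> : x - y - r i * y0 = ((x - y) * y0^-1 - r i) * y0.
      by rewrite mulrBl mulrVK // hdiv.
    apply: (vgtMr hvD); last exact: vge_refl.
    by apply: (vgt_trans hvD) hi _; apply: (vgtC hvD); apply: hri.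
have [s [sS ssz scov]] := cover n (leqnn n); rewrite -ssz.
have [rho [rW rO rsep rcov]] := subspace_reps hp hK hv hdiv S.
have cov t : exists i : 'I_(size s), vge v 1 (rho t - s`_i).
  have [y ys hy] := scov _ (rW t) (rO t); move: ys => /(nthP 0)[i ilt e].
  by exists (Ordinal ilt); rewrite /= e; move: hy; rewrite mulfV // pnatr_eq0 -lt0n.
have [h _] := leq_card_sep_cover hvD rsep cov.
by move: h; rewrite card_ffun !card_ord.
Qed.

End Counting.

(* Ramification index [e] and residue degree [f] of [L] over the base field, and the shape of the
   centraliser of [L], which has degree [m] over [L]. *)
Record subfield_structure (p n : nat) (K : fieldType) (D : falgType K) (v : D -> rat)
    (om : D) (L : {aspace D}) (e f m : nat) : Prop := {
  struct_n : n = (e * f * m)%N;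
  struct_dim : \dim L = (e * f)%N;
  struct_val : forall x, x \in L -> x != 0 -> exists z : int, v x = z%:~R / e%:R;
  struct_unif : exists x, [/\ x \in L, x != 0 & v x = e%:R^-1];
  struct_res : forall x, x \in L -> x != 0 -> v x = 0 -> exists2 i,
    ((p ^ n).-1 %| i * (p ^ f).-1)%N & vgt v 0 (x - om ^+ i);
  struct_res_lift : forall i, ((p ^ n).-1 %| i * (p ^ f).-1)%N -> exists2 x, x \in L & vgt v 0 (x - om ^+ i);
  struct_cval : forall x, x \in 'C(L)%VS -> x != 0 -> exists z : int, v x = z%:~R / (e * m)%:R;
  struct_cunif : exists x, [/\ x \in 'C(L)%VS, x != 0 & v x = (e * m)%:R^-1];
  struct_cres : forall x, x \in 'C(L)%VS -> x != 0 -> v x = 0 -> exists2 i,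
    ((p ^ n).-1 %| i * (p ^ (m * f)).-1)%N & vgt v 0 (x - om ^+ i);
  struct_cres_lift : forall i, ((p ^ n).-1 %| i * (p ^ (m * f)).-1)%N ->
    exists2 x, x \in 'C(L)%VS & vgt v 0 (x - om ^+ i) }.

Lemma leq_exp_eq a b A B : (a <= A)%N -> (b <= B)%N -> (1 < A)%N -> (0 < B)%N ->
  (A ^ B <= a ^ b)%N -> (A <= a)%N /\ (B <= b)%N.
Proof.
move=> aA bB A1 B0 h.
have hb : (B <= b)%N.
  rewrite -(leq_exp2l _ _ A1); apply: leq_trans h _.
  by case: b {bB} => // b; rewrite leq_exp2r.
have eb : b = B by apply/eqP; rewrite eqn_leq bB hb.
by split=> //; move: h; rewrite eb leq_exp2r.
Qed.

Lemma pred_mul_exp p a b : (0 < p)%N -> (b <= a)%N ->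
  (p ^ a).-1 = (p ^ (a - b) * (p ^ b).-1 + (p ^ (a - b)).-1)%N.
Proof.
move=> p0 ba; rewrite -{1}(subnK ba) expnD.
have := expn_gt0 p (a - b); have := expn_gt0 p b; rewrite p0 /=.
case: (p ^ b)%N => // Y _; case: (p ^ (a - b))%N => // X _; rewrite mulnS; lia.
Qed.

(** The divisibility says that [om ^ i] is fixed by the [p ^ k] power map, that is, has its residue
    in the field with [p ^ k] elements; the count is the order of the multiplicative group of that
    field. *)
Lemma count_dvdn_pred p n k : (1 < p)%N -> (0 < k)%N -> (k %| n)%N -> (0 < n)%N ->
  count (fun i => (p ^ n).-1 %| i * (p ^ k).-1)%N (iota 0 (p ^ n).-1) = (p ^ k).-1.
Proof.
move=> p1 k0 kn n0; have /dvdnP[M' eM] := dvdn_pred_exp p kn.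
have M0 : (0 < (p ^ k).-1)%N.
  by rewrite -subn1 subn_gt0 -{1}(expn0 p) ltn_exp2l.
have M'0 : (0 < M')%N.
  have : (0 < (p ^ n).-1)%N by rewrite -subn1 subn_gt0 -{1}(expn0 p) ltn_exp2l.
  by rewrite eM muln_gt0 => /andP[].
rewrite eM -[RHS](count_dvdn_iota _ M'0); apply: eq_count => i.
by rewrite dvdn_pmul2r.
Qed.

(** * Ramification and residues of a subfield and of its centraliser *)

Section SubfieldStructure.
Variables (p n : nat) (K : fieldType) (vp : K -> rat) (D : falgType K) (v : D -> rat).
Hypotheses (hp : prime p) (hn : (0 < n)%N) (hK : is_padic_field p vp).
Hypotheses (hv : extends_valuation vp v) (hdiv : is_division D).
Variables (W : {aspace D}) (om g : D).
Hypothesis hc : Dn_coordinates p n v W om g.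

Let hvD := division_valued hv hdiv.
Let N := (p ^ n).-1.

Lemma vgt_conj x y r : x != 0 -> vgt v r y -> vgt v r (x * y * x^-1).
Proof.
move=> x0; have [->|y0] := eqVneq y 0; first by rewrite mulr0 mul0r; left.
by move=> /(vgt_val y0) h; right; rewrite (v_conj hvD).
Qed.

Lemma conj_gX j i : g ^+ j * om ^+ i * g ^- j = om ^+ (i * p ^ j).
Proof.
have gu : g \is a GRing.unit by apply/hdiv/(coord_g0 hc).
elim: j i => [|j IH] i; first by rewrite expr0 invr1 mul1r mulr1 muln1.
have conj1 k : g * om ^+ k * g^-1 = om ^+ (k * p).
  elim: k => [|k IHk]; first by rewrite expr0 mulr1 mulrV.
  rewrite mulSn exprD -IHk -(coord_conj hc) exprS !mulrA; congr (_ * _ * _).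
  by rewrite mulrVK.
rewrite exprSr invrM ?unitrX // !mulrA -[g ^+ j * g * _]mulrA.
by rewrite -[g ^+ j * _ * _]mulrA conj1 IH -mulnA -expnS.
Qed.

(** Write [x = t * g ^ j] with [v t = 0]. Conjugation by [t] is trivial on residues, which are 0 or
    powers of [om] and so commute; conjugation by [g ^ j] raises them to the power [p ^ j]. *)
Lemma conj_residue x u i j : x != 0 -> v x = j%:R / n%:R -> vgt v 0 (u - om ^+ i) ->
  vgt v 0 (x * u * x^-1 - om ^+ (i * p ^ j)).
Proof.
move=> x0 vx hu; have g0 := coord_g0 hc.
have gj0 : g ^+ j != 0 by rewrite (exp_neq0 hvD).
have gju := hdiv gj0.
pose t := x * g ^- j; have t0 : t != 0 by rewrite (mul_neq0 hvD) ?invr_eq0.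
have xe : x = t * g ^+ j by rewrite mulrVK.
have vt : v t = 0.
  by rewrite (valuationM hv.1) ?invr_eq0 // (vV hvD) // (v_gX hv hdiv g0 (coord_vg hc)) vx subrr.
have [k _ hk] := coord_res hc t0 vt.
pose w := om ^+ (i * p ^ j).
have e1 : x * u * x^-1 - w = t * (g ^+ j * (u - om ^+ i) * g ^- j) * t^-1 + (t * w - w * t) * t^-1.
  have -> : x * u * x^-1 = t * (g ^+ j * u * g ^- j) * t^-1 by rewrite xe invrM ?hdiv // !mulrA.
  rewrite [g ^+ j * (u - _)]mulrBr [(_ - _) * g ^- j]mulrBl conj_gX -/w.
  by rewrite mulrBr !mulrBl mulrK ?hdiv // addrA subrK.
rewrite e1; apply: (vgtD hvD); first by do 2!apply: vgt_conj => //.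
rewrite -[0%R : rat]addr0; apply: (vgtMr hvD); last by right; rewrite (vV hvD) // vt oppr0.
have -> : t * w - w * t = (t - om ^+ k) * w - w * (t - om ^+ k).
  have cw : w * om ^+ k = om ^+ k * w by rewrite /w -!exprD addnC.
  by rewrite mulrBl mulrBr cw opprB addrA subrK.
have vw : vge v 0 w by right; rewrite (v_omX hp hn hv hdiv hc).
rewrite -[0%R : rat]addr0; apply: (vgtB hvD); first by apply: (vgtMr hvD).
by apply: (vgtM hvD).
Qed.

(** [has_val] only sees nonnegative values; multiplication by a power of [p] makes any value
    nonnegative. *)
Lemma has_val_int (S : {aspace D}) j0 x :
  (forall j, has_val n v S j -> (j0 %| j)%N) -> (j0 %| n)%N -> x \in S -> x != 0 ->
  exists z : int, v x = (z * j0%:Z)%:~R / n%:R.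
Proof.
move=> hS /dvdnP[a ea] xS x0; have [z hz] := coord_val hc x0.
have n0 : n%:R != 0 :> rat by rewrite pnatr_eq0 -lt0n.
pose k := `|z|%N; pose w : int := k%:Z * n%:Z + z; pose y := p%:R ^+ k *: x.
have pk0 : (p%:R : K) ^+ k != 0 by rewrite expf_neq0 // (natK_p_neq0 hp hK).
have y0 : y != 0 by rewrite scaler_eq0 negb_or pk0.
have jE : `|w|%N%:Z = w by rewrite gez0_abs // /w /k; nia.
have vy : v y = `|w|%N%:R / n%:R.
  rewrite (vZ hv) // (vX (padic_valued hK)) ?(natK_p_neq0 hp hK) // (vp_p hp hK) hz.
  have -> : (`|w|%N%:R : rat) = w%:~R by rewrite -{2}jE.
  by rewrite /w intrD intrM mulrDl mulfK.
have /dvdnP[b eb] : (j0 %| `|w|)%N by apply: hS; exists y; rewrite rpredZ.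
exists (b%:Z - k%:Z * a%:Z); rewrite hz; congr (_%:~R / _).
have : k%:Z * n%:Z + z = b%:Z * j0%:Z by rewrite -/w -jE eb PoszM.
by rewrite ea PoszM; nia.
Qed.

(** With [j0/n] the least positive value of [L] (so [e = n/j0]) and [f] its residue degree, counting
    gives [dim L <= f * e] and [dim C(L) <= j0 * (n/f)]. The product of the bounds is [n ^ 2], so
    [dim_centraliser] makes both equalities, and equality in the counts means that all allowed
    residues and values occur. *)
Lemma exists_subfield_structure (L : {aspace D}) : is_subfield L -> \dim {:D} = (n ^ 2)%N ->
  exists e f m, subfield_structure p n v om L e f m.
Proof.
move=> hL dimD; have L1 := subfield1 hL; have LC := subfieldC hL.
have p1 := prime_gt1 hp; have p0 := prime_gt0 hp.
have n0Q : n%:R != 0 :> rat by rewrite pnatr_eq0 -lt0n.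
have N0 : (0 < N)%N := N_gt0 hp hn.
have subLC x : x \in L -> x \in 'C(L)%VS by move=> xL; apply/centvP => y yL; apply: LC.
have C1 : 1 \in 'C(L)%VS := subLC 1 L1.
have valn (S : {aspace D}) : 1 \in S -> has_val n v S n.
  move=> S1; exists (p%:R); rewrite natD_alg rpredZ // scalar_neq0 ?(natK_p_neq0 hp hK) //.
  by rewrite hv.2 ?(natK_p_neq0 hp hK) // (vp_p hp hK) mulfV.
have [j0 [j00 hj0] j0min] := exists_min (P := fun j => (0 < j)%N /\ has_val n v L j) (conj hn (valn L L1)).
have j0dvd j : has_val n v L j -> (j0 %| j)%N.
  apply: min_dvdn => //; last by move=> i i0 hi; apply: j0min.
  move=> a b ba [x [xL x0 vx]] [y [yL y0 vy]]; exists (x * y^-1); split.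
  - by rewrite memvM ?memvV.
  - by rewrite (mul_neq0 hvD) ?invr_eq0.
  - by rewrite (valuationM hv.1) ?invr_eq0 // (vV hvD) // vx vy natrB // mulrBl.
pose P j := forall i, has_residue v om L i -> (N %| i * (p ^ j).-1)%N.
have Pn : P n by move=> i _; rewrite dvdn_mull.
have [f [f0 Pf] fmin] := exists_min (P := fun j => (0 < j)%N /\ P j) (conj hn Pn).
have fdvd j : P j -> (f %| j)%N.
  apply: min_dvdn => //; last by move=> i i0 hi; apply: fmin.
  move=> a b ba Pa Pb i hi; have := Pa i hi; rewrite (pred_mul_exp p0 ba) mulnDr.
  by rewrite dvdn_addr // mulnCA dvdn_mull // Pb.
have j0n : (j0 %| n)%N := j0dvd n (valn L L1).
have fn : (f %| n)%N := fdvd n Pn.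
have [e en] := dvdnP j0n; have [nf nfn] := dvdnP fn.
have e0 : (0 < e)%N by move: hn; rewrite en muln_gt0 => /andP[].
have nf0 : (0 < nf)%N by move: hn; rewrite nfn muln_gt0 => /andP[].
have resmod i k : vgt v 0 (om ^+ i - om ^+ (i * p ^ k)) -> (N %| i * (p ^ k).-1)%N.
  move=> /(coord_om_inj hc)/eqP; rewrite eq_sym eqn_mod_dvd; last first.
    by rewrite leq_pmulr // expn_gt0 p0.
  by rewrite -[(p ^ k).-1]subn1 mulnBr muln1.
(* An element of [C(L)] of value [j/n] acts on the residues of [L] trivially and as the [p ^ j]
   power. In [Cres] an element of [L] of value [j0/n] bounds the residues of [C(L)] likewise. *)
have CP j : has_val n v 'C(L)%AS j -> P j.
  move=> [x [xC x0 vx]] i [u uL hu]; apply: resmod.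
  have /centvP/(_ u uL) cxu := xC.
  have := conj_residue x0 vx hu; rewrite cxu mulrK ?hdiv // => h.
  by apply: (vgt_trans hvD) h; apply: (vgtC hvD).
have Cres i : has_residue v om 'C(L)%AS i -> (N %| i * (p ^ j0).-1)%N.
  move=> [x xC hx]; apply: resmod; have [y [yL y0 vy]] := hj0.
  have /centvP/(_ y yL) cxy := xC.
  have := conj_residue y0 vy hx; rewrite -cxy mulrK ?hdiv // => h.
  by apply: (vgt_trans hvD) h; apply: (vgtC hvD).
pose cI (S : {aspace D}) := count (fun i => `[< has_residue v om S i >]) (iota 0 N).
pose cJ (S : {aspace D}) := count (fun j => `[< has_val n v S j >]) (iota 0 n).
have bnd (S : {aspace D}) k j : 1 \in S -> (0 < k)%N -> (k %| n)%N -> (0 < j)%N -> (j %| n)%N ->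
    (forall i, has_residue v om S i -> (N %| i * (p ^ k).-1)%N) ->
    (forall i, has_val n v S i -> (j %| i)%N) ->
    (\dim S <= k * (n %/ j))%N /\ ((k * (n %/ j) <= \dim S)%N ->
      (forall i, (i < N)%N -> (N %| i * (p ^ k).-1)%N -> has_residue v om S i) /\
      (forall i, (i < n)%N -> (j %| i)%N -> has_val n v S i)).
  move=> S1 k0 kn jj0 jn hI hJ.
  have hI' : {in iota 0 N, forall i, `[< has_residue v om S i >] -> (N %| i * (p ^ k).-1)%N}.
    by move=> i _ /asboolP; apply: hI.
  have hJ' : {in iota 0 n, forall i, `[< has_val n v S i >] -> (j %| i)%N}.
    by move=> i _ /asboolP; apply: hJ.
  have cIle : (1 + cI S <= p ^ k)%N.
    have := count_le hI'; rewrite count_dvdn_pred // => h.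
    by rewrite add1n -[(p ^ k)%N]prednK ?ltnS // expn_gt0 p0.
  have nj : n = (j * (n %/ j))%N by rewrite mulnC divnK.
  have cntj : count (fun i => j %| i)%N (iota 0 n) = (n %/ j)%N.
    by rewrite {1}nj count_dvdn_iota.
  have cJle : (cJ S <= n %/ j)%N.
    by rewrite -cntj; exact: count_le hJ'.
  have pk1 : (1 < p ^ k)%N by rewrite -{1}(expn0 p) ltn_exp2l.
  have main := count_classes hp hn hK hv hdiv hc S1; rewrite -/(cI S) -/(cJ S) in main.
  have nj0 : (0 < n %/ j)%N by rewrite divn_gt0 // dvdn_leq.
  split.
    rewrite -(leq_exp2l _ _ p1) expnM; apply: leq_trans main _.
    apply: (@leq_trans ((p ^ k) ^ cJ S)); last by rewrite leq_exp2l.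
    by case: (cJ S) => // c; rewrite leq_exp2r.
  move=> ge; have hh : ((p ^ k) ^ (n %/ j) <= (1 + cI S) ^ cJ S)%N.
    by apply: leq_trans main; rewrite -expnM leq_exp2l.
  have [h1 h2] := leq_exp_eq cIle cJle pk1 nj0 hh.
  split=> i ilt hi; apply/asboolP.
    apply: (count_eq hI') => //; last by rewrite mem_iota.
    rewrite count_dvdn_pred //; move: h1; rewrite add1n -[(p ^ k)%N]prednK ?ltnS //.
    by rewrite expn_gt0 p0.
  apply: (count_eq hJ') => //; last by rewrite mem_iota.
  by rewrite cntj.
have [Lle Leq] := bnd L f j0 L1 f0 fn j00 j0n Pf j0dvd.
have [Cle Ceq] := bnd 'C(L)%AS j0 f C1 j00 j0n f0 fn Cres (fun j h => fdvd j (CP j h)).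
have dC := dim_centraliser hdiv L1.
have ee : (n %/ j0 = e)%N by rewrite en mulnK.
have enf : (n %/ f = nf)%N by rewrite nfn mulnK.
rewrite ee in Lle Leq; rewrite enf in Cle Ceq.
have prod : (n ^ 2 = (f * e) * (j0 * nf))%N by rewrite -mulnn {1}nfn en; nia.
have [dL dCe] : (f * e <= \dim L)%N /\ (j0 * nf <= \dim 'C(L))%N.
  move: dC Lle Cle; rewrite dimD prod; move: (\dim L) (\dim _) => x y.
  have : (0 < f * e)%N by rewrite muln_gt0 f0.
  have : (0 < j0 * nf)%N by rewrite muln_gt0 j00.
  move: (f * e)%N (j0 * nf)%N => A B B0 A0 h1 h2 h3; split.
    rewrite -(leq_pmul2r B0); apply: leq_trans h1 _; by rewrite leq_mul2l h3 orbT.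
  rewrite -(leq_pmul2l A0); apply: leq_trans h1 _; by rewrite leq_mul2r h2 orbT.
have [resL valL] := Leq dL; have [resC valC] := Ceq dCe.
have [m em] : exists m, j0 = (m * f)%N.
  apply/dvdnP; apply: fdvd; apply: CP; have [y [yL y0 vy]] := hj0.
  by exists y; rewrite subLC.
have nE : n = (e * f * m)%N by rewrite en em; nia.
have m0 : (0 < m)%N by move: j00; rewrite em muln_gt0 => /andP[].
have j0e : j0%:R / n%:R = e%:R^-1 :> rat.
  by rewrite en natrM invfM mulrCA mulfV ?mulr1 // pnatr_eq0 -lt0n.
have fem : f%:R / n%:R = (e * m)%:R^-1 :> rat.
  by rewrite nE [(e * f)%N]mulnC -mulnA natrM invfM mulrA mulfV ?mul1r // pnatr_eq0 -lt0n.
have reslift (S : {aspace D}) k : (forall i, (i < N)%N -> (N %| i * (p ^ k).-1)%N -> has_residue v om S i) ->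
   forall i, (N %| i * (p ^ k).-1)%N -> exists2 x, x \in S & vgt v 0 (x - om ^+ i).
  move=> hS i hi; have [|x xS hx] := hS (i %% N)%N (ltn_pmod _ N0).
    by move: hi; rewrite {1}(divn_eq i N) mulnDl dvdn_addr // mulnAC dvdn_mull.
  exists x => //; rewrite (om_mod hc (j := i %% N)) //.
  by rewrite modn_mod.
have resS (S : {aspace D}) k : (forall i, has_residue v om S i -> (N %| i * (p ^ k).-1)%N) ->
   forall x, x \in S -> x != 0 -> v x = 0 -> exists2 i, (N %| i * (p ^ k).-1)%N & vgt v 0 (x - om ^+ i).
  move=> hS x xS x0 vx; have [i _ hi] := coord_res hc x0 vx.
  by exists i => //; apply: hS; exists x.
exists e, f, m; split.
- exact: nE.
- by apply/eqP; rewrite eqn_leq mulnC Lle dL.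
- move=> x xL x0; have [z ->] := has_val_int j0dvd j0n xL x0.
  by exists z; rewrite intrM -mulrA j0e.
- by have [y [yL y0 vy]] := hj0; exists y; rewrite vy j0e.
- by apply: resS.
- by apply: reslift.
- move=> x xC x0; have [z ->] := has_val_int (fun j h => fdvd j (CP j h)) fn xC x0.
  by exists z; rewrite intrM -mulrA fem.
- rewrite -fem; have [fltn|] := ltnP f n; first exact: (valC f fltn (dvdnn f)).
  by rewrite leq_eqVlt ltnNge (dvdn_leq hn fn) orbF => /eqP <-; apply: valn.
- by rewrite -em; apply: resS.
- by rewrite -em; apply: reslift.
Qed.

End SubfieldStructure.

(** * Arithmetic of Frobenius exponents *)

Lemma dvdn_pred_gcd N i R a b : (0 < R)%N -> coprime a b ->
  (N %| i * (R ^ a).-1)%N -> (N %| i * (R ^ b).-1)%N -> (N %| i * R.-1)%N.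
Proof.
move=> R0 cop ha hb.
pose P j := (N %| i * (R ^ j).-1)%N.
have PB x y : (y <= x)%N -> P x -> P y -> P (x - y)%N.
  move=> yx; rewrite /P (pred_mul_exp R0 yx) mulnDr => h1 h2.
  by move: h1; rewrite dvdn_addr // mulnCA dvdn_mull.
suff : P 1%N by rewrite /P expn1.
case: a cop ha => [|a] cop ha.
  by move: cop; rewrite /coprime gcd0n => /eqP b1; rewrite -b1.
have [c [c0 Pc] cmin] := exists_min (P := fun j => (0 < j)%N /\ P j) (conj (ltn0Sn a) ha).
have cd := min_dvdn PB c0 Pc (fun j j0 hj => cmin j (conj j0 hj)).
have : (c %| gcdn a.+1 b)%N by rewrite dvdn_gcd !cd.
by move: cop; rewrite /coprime => /eqP ->; rewrite dvdn1 => /eqP <-.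
Qed.

Lemma pred_exp_sum R q : (0 < R)%N -> (R ^ q).-1 = (R.-1 * \sum_(l < q) R ^ l)%N.
Proof.
move=> R0; elim: q => [|q IH]; first by rewrite big_ord0 muln0.
rewrite big_ord_recr /= mulnDr -IH expnS; have := expn_gt0 R q; rewrite R0 /=.
by case: R R0 {IH} => // R _; case: (R.+1 ^ q)%N => // Y _; rewrite mulSn; lia.
Qed.

Lemma modn_sum (I : finType) N (F G : I -> nat) :
  (forall i, F i = G i %[mod N]) -> (\sum_i F i)%N = (\sum_i G i)%N %[mod N].
Proof.
move=> h; apply: (big_ind2 (fun a b => a = b %[mod N])) => // a b c d e1 e2.
by rewrite -modnDm e1 e2 modnDm.
Qed.

Lemma modn_mul_exp N i R x : (0 < R)%N -> (N %| i * (R ^ x).-1)%N -> i * R ^ x = i %[mod N].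
Proof.
move=> R0 h; apply/eqP; rewrite eqn_mod_dvd ?leq_pmulr ?expn_gt0 ?R0 //.
by move: h; rewrite -[(R ^ x).-1]subn1 mulnBr muln1.
Qed.

Lemma modn_mul_exp_dvd N i R x : (0 < R)%N -> i * R ^ x = i %[mod N] -> (N %| i * (R ^ x).-1)%N.
Proof.
move=> R0 /eqP; rewrite eqn_mod_dvd ?leq_pmulr ?expn_gt0 ?R0 //.
by rewrite -[(R ^ x).-1]subn1 mulnBr muln1.
Qed.

Lemma modn_mul_exp_mod N k R q x : (0 < R)%N -> (N %| k * (R ^ q).-1)%N ->
  k * R ^ x = k * R ^ (x %% q) %[mod N].
Proof.
move=> R0 h; have hk y : k * R ^ (q * y) = k %[mod N].
  apply: modn_mul_exp => //; apply: dvdn_trans h _.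
  by rewrite dvdn_mul // dvdn_pred_exp // dvdn_mulr.
by rewrite {1}(divn_eq x q) expnD mulnA -modnMml [(x %/ q * q)%N]mulnC hk modnMml.
Qed.

Lemma ord_mul_inj q t : (0 < q)%N -> coprime t q ->
  exists2 h : 'I_q -> 'I_q, injective h & forall l, h l = (t * l %% q)%N :> nat.
Proof.
move=> q0 cop; exists (fun l => Ordinal (ltn_pmod (t * l) q0)) => // a b /(congr1 val) /= /eqP.
wlog ab : a b / (a <= b)%N.
  move=> H e; case/orP: (leq_total a b) => ab; first exact: H.
  by apply/esym; apply: H; rewrite // eq_sym.
rewrite eq_sym eqn_mod_dvd ?leq_mul2l ?ab ?orbT // -mulnBr Gauss_dvdr; last by rewrite coprime_sym.
have := ltn_ord b => hb hd; apply/val_inj => /=.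
have : (b - a == 0)%N.
  by apply: contraLR hd => ne; rewrite gtnNdvd ?lt0n // ltn_subLR //; lia.
by rewrite subn_eq0 => ba; apply/eqP; rewrite eqn_leq ab ba.
Qed.

(* When [R ^ q = 1] modulo the order, the exponents [R ^ (t * l)], [l < q], are a permutation
   of the [R ^ l] as soon as [t] is prime to [q]. *)
Lemma exponent_sum_perm N k R q t : (0 < R)%N -> (0 < q)%N -> coprime t q ->
  (N %| k * (R ^ q).-1)%N ->
  (k * \sum_(l < q) (R ^ t) ^ l)%N = (k * \sum_(l < q) R ^ l)%N %[mod N].
Proof.
move=> R0 q0 cop h; have [s sinj sE] := ord_mul_inj q0 cop.
rewrite !big_distrr /= [in RHS](reindex_inj sinj) /=; apply: modn_sum => l.
by rewrite sE -expnM; apply: modn_mul_exp_mod.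
Qed.

Section Residues.
Variables (p n : nat) (K : fieldType) (vp : K -> rat) (D : falgType K) (v : D -> rat).
Hypotheses (hp : prime p) (hn : (0 < n)%N) (hK : is_padic_field p vp).
Hypotheses (hv : extends_valuation vp v) (hdiv : is_division D).
Variables (W : {aspace D}) (om g : D).
Hypothesis hc : Dn_coordinates p n v W om g.

Let hvD := division_valued hv hdiv.
Let N := (p ^ n).-1.

Lemma vge_omX i : vge v 0 (om ^+ i).
Proof. by right; rewrite (v_omX hp hn hv hdiv hc). Qed.

Lemma om_eq_res x i j : vgt v 0 (x - om ^+ i) -> vgt v 0 (x - om ^+ j) -> i = j %[mod N].
Proof.
move=> h1 h2; apply: (coord_om_inj hc).
by apply: (vgt_trans hvD) h2; apply: (vgtC hvD).
Qed.

(** [(w * y0) ^ l * y0 ^- l] is the product of the conjugates of [w] by [1, y0, ..., y0 ^ (l - 1)],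
    which for suitable [l] is a norm on residues. *)
Lemma norm_residue w y0 k j l : y0 != 0 -> v y0 = j%:R / n%:R -> vgt v 0 (w - om ^+ k) ->
  vgt v 0 ((w * y0) ^+ l * y0 ^- l - om ^+ (k * \sum_(t < l) (p ^ j) ^ t)).
Proof.
move=> y00 vy0 hw; elim: l => [|l IH].
  by rewrite big_ord0 muln0 !expr0 invr1 mulr1 subrr; left.
have yu := hdiv y00.
have -> : (w * y0) ^+ l.+1 * y0 ^- l.+1 = w * (y0 * ((w * y0) ^+ l * y0 ^- l) * y0^-1).
  rewrite exprS [y0 ^+ l.+1]exprS.
  by rewrite invrM ?unitrX // !mulrA.
have -> : (k * \sum_(t < l.+1) (p ^ j) ^ t = k + (k * \sum_(t < l) (p ^ j) ^ t) * p ^ j)%N.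
  rewrite big_ord_recl expn0 mulnDr muln1 -mulnA; congr (_ + _ * _)%N.
  by rewrite big_distrl /=; apply: eq_bigr => t _; rewrite -expnSr.
rewrite exprD; apply: (vgt_mul2 hvD) => //.
- by apply: (vgt_vge hvD) (vge_omX k) _.
- exact: vge_omX.
- exact: (conj_residue hp hn hv hdiv hc y00 vy0).
Qed.

(* A sum of characters over the roots of unity of order [R ^ q - 1] shows that the trace
   does not vanish on residues. *)
Lemma exists_trace_neq0 R q : (1 < R)%N -> (0 < q)%N -> (p %| R ^ q)%N -> ((R ^ q).-1 %| N)%N ->
  exists2 k, (N %| k * (R ^ q).-1)%N & ~ vgt v 0 (\sum_(l < q) om ^+ (k * R ^ l)).
Proof.
move=> R1 q0 pR /dvdnP[c ec]; apply: contrapT => no.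
have R0 := ltnW R1.
set N' := (R ^ q).-1 in ec no.
have Rq1 : (1 < R ^ q)%N by rewrite -{1}(expn0 R) ltn_exp2l.
have N'0 : (0 < N')%N by rewrite /N' -subn1 subn_gt0.
(* Each sum is divided by its term [l = 0], so that this term becomes 1. *)
have all k : vgt v 0 (\sum_(l < q) om ^+ (c * k * (R ^ l).-1)).
  have h : vgt v 0 (\sum_(l < q) om ^+ (c * k * R ^ l)).
    by apply: contrapT => h; apply: no; exists (c * k)%N => //; rewrite ec mulnAC dvdn_mulr.
  apply: (vgt_mulr hvD (x := om ^+ (c * k))); first exact: (omX_neq0 hp hn hv hdiv hc).
  rewrite (v_omX hp hn hv hdiv hc) addr0 mulr_suml; move: h; congr (vgt v 0 _).
  apply: eq_bigr => l _; rewrite -exprD; congr (_ ^+ _).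
  have := expn_gt0 R l; rewrite R0 /=; case: (R ^ l)%N => // Y _.
  by rewrite mulnS addnC.
have : vgt v 0 (\sum_(k < N') \sum_(l < q) om ^+ (c * k * (R ^ l).-1)).
  by apply: (vgt_sum hvD) => k _.
rewrite exchange_big /=.
(* For [l > 0] the sum over [k] is a complete geometric sum of a nontrivial root of unity. Only
   [l = 0] survives and contributes [N'], which is prime to [p]. *)
have zero (l : 'I_q) : (0 < l)%N -> \sum_(k < N') om ^+ (c * k * (R ^ l).-1) = 0.
  move=> l0; set z := om ^+ (c * (R ^ l).-1).
  have -> : \sum_(k < N') om ^+ (c * k * (R ^ l).-1) = \sum_(k < N') z ^+ k.
    by apply: eq_bigr => k _; rewrite /z -exprM mulnAC.
  have zN : z ^+ N' = 1.
    by rewrite /z -exprM mulnAC -ec exprM (coord_om1 hc) expr1n.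
  have z1 : z - 1 != 0.
    apply/negP; rewrite subr_eq0 => /eqP e.
    have : vgt v 0 (om ^+ (c * (R ^ l).-1) - om ^+ 0) by rewrite -/z e expr0 subrr; left.
    move=> /(coord_om_inj hc)/eqP; rewrite mod0n -/(dvdn _ _) -/N ec mulnC.
    have c0 : (0 < c)%N.
      by have := N_gt0 hp hn; rewrite -/N ec muln_gt0 => /andP[].
    rewrite mulnC dvdn_pmul2l // => hd.
    have h1 : (1 < R ^ l)%N by rewrite -{1}(expn0 R) ltn_exp2l.
    have h2 : (R ^ l < R ^ q)%N by rewrite ltn_exp2l.
    move: hd; rewrite gtnNdvd //; first by rewrite -subn1 subn_gt0.
    by rewrite /N' -ltnS !prednK // ltnW.
  apply: (mulrI (hdiv z1)); rewrite mulr0 -[LHS]opprK -mulNr opprB.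
  have := subrX1 z N'; rewrite zN subrr => e.
  by rewrite -mulNr opprB -e.
rewrite (bigD1 (Ordinal q0)) //= [X in _ + X]big1 ?addr0; last first.
  by move=> l hl; apply: zero; rewrite lt0n; apply: contra hl => /eqP e; apply/eqP/val_inj.
under eq_bigr => k _ do rewrite ?expn0 /= muln0 expr0.
rewrite sumr_const card_ord => /(vgt_val (natD_neq0 _ hK _)) h.
have := h N'0; rewrite (v_nat hK hv) // (vp_coprime hp hK) ?ltxx //.
apply/negP => pN'; have := dvdn_sub pR pN'.
have -> : (R ^ q - N' = 1)%N by rewrite /N' -subn1 subKn // ltnW.
by rewrite dvdn1 => /eqP p1; move: hp; rewrite p1.
Qed.

End Residues.

(** * Roots in the centraliser *)

Section LeadingRoots.
Variables (p n : nat) (K : fieldType) (vp : K -> rat) (D : falgType K) (v : D -> rat).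
Hypotheses (hp : prime p) (hn : (0 < n)%N) (hK : is_padic_field p vp).
Hypotheses (hv : extends_valuation vp v) (hdiv : is_division D).
Variables (W : {aspace D}) (om g : D).
Hypothesis hc : Dn_coordinates p n v W om g.
Variables (L : {aspace D}) (e f m : nat).
Hypotheses (hL : is_subfield L) (hS : subfield_structure p n v om L e f m).

Let hvD := division_valued hv hdiv.
Let N := (p ^ n).-1.
Let p0 : (0 < p)%N := prime_gt0 hp.

Lemma struct_gt0 : [/\ (0 < e)%N, (0 < f)%N & (0 < m)%N].
Proof.
by move: hn; rewrite (struct_n hS) !muln_gt0 => /andP[/andP[-> ->] ->].
Qed.

Let e0 : (0 < e)%N. Proof. by case: struct_gt0. Qed.
Let f0 : (0 < f)%N. Proof. by case: struct_gt0. Qed.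
Let m0 : (0 < m)%N. Proof. by case: struct_gt0. Qed.

Lemma sub_cent x : x \in L -> x \in 'C(L)%VS.
Proof. by move=> xL; apply/centvP => y yL; apply: (subfieldC hL). Qed.

Lemma cent1 : 1 \in 'C(L)%VS. Proof. exact/sub_cent/(subfield1 hL). Qed.

Lemma memvX (S : {aspace D}) x i : 1 \in S -> x \in S -> x ^+ i \in S.
Proof. by move=> S1 xS; elim: i => [|i IH]; rewrite ?expr0 // exprS memvM. Qed.

Lemma cent_comm x y : x \in 'C(L)%VS -> y \in L -> x * y = y * x.
Proof. by move=> /centvP h yL; apply: h. Qed.

Lemma val_level j : j%:R / (e * m)%:R = (f * j)%:R / n%:R :> rat.
Proof.
have f0' : f%:R != 0 :> rat by rewrite pnatr_eq0 -lt0n.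
rewrite (struct_n hS) [(e * f)%N]mulnC -mulnA !natrM [(f%:R * (_ * _))^-1]invfM.
by rewrite mulrACA mulfV // mul1r.
Qed.

Lemma cent_level j : exists x, [/\ x \in 'C(L)%VS, x != 0 & v x = j%:R / (e * m)%:R].
Proof.
have [y [yC y0 vy]] := struct_cunif hS; exists (y ^+ j); split.
- exact: (memvX _ cent1 yC).
- exact: (exp_neq0 hvD).
- by rewrite (vX hvD) // vy [RHS]mulr_natl.
Qed.

Lemma field_level (z : int) : exists x, [/\ x \in L, x != 0 & v x = z%:~R / e%:R].
Proof.
have [y [yL y0 vy]] := struct_unif hS.
have vyX i : v (y ^+ i) = i%:R / e%:R by rewrite (vX hvD) // vy [RHS]mulr_natl.
case: z => i.
  by exists (y ^+ i); rewrite (memvX _ (subfield1 hL) yL) (exp_neq0 hvD).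
exists (y ^- i.+1); rewrite memvV (memvX _ (subfield1 hL) yL) invr_eq0 (exp_neq0 hvD) //.
by rewrite (vV hvD) ?(exp_neq0 hvD) // vyX NegzE mulrNz mulNr.
Qed.

Lemma level_conj_dvd y j x i : y != 0 -> v y = j%:R / (e * m)%:R -> y * x = x * y ->
  vgt v 0 (x - om ^+ i) -> (N %| i * (p ^ (f * j)).-1)%N.
Proof.
move=> y0 vy yx hx; rewrite val_level in vy; apply: modn_mul_exp_dvd => //.
have := conj_residue hp hn hv hdiv hc y0 vy hx; rewrite yx mulrK ?hdiv // => h.
exact: (om_eq_res hv hdiv hc h hx).
Qed.

Section Prime.
Variable q : nat.
Hypotheses (hq : prime q) (qm : (q %| m)%N).
Let m' := (m %/ q)%N.
Let mE : m = (m' * q)%N. Proof. by rewrite /m' divnK. Qed.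
(** The residue field of [C(L)] has [R ^ q] elements, and an element of value [t * m' / (e * m)]
    acts on it by the [R ^ t] power. *)
Let R := (p ^ (f * m'))%N.

Lemma residue_base : (R ^ q = p ^ (m * f))%N.
Proof. by rewrite /R -expnM -mulnA -mE mulnC. Qed.

Lemma residue_base_dvd : ((R ^ q).-1 %| N)%N.
Proof. by rewrite residue_base dvdn_pred_exp // (struct_n hS) -mulnA [(f * m)%N]mulnC dvdn_mull. Qed.

Lemma residue_base_gt1 : (1 < R)%N.
Proof.
rewrite /R -{1}(expn0 p) ltn_exp2l ?prime_gt1 // muln_gt0 f0 /=.
by move: m0; rewrite {1}mE muln_gt0 => /andP[].
Qed.

(** Choose [y0] in [C(L)] of value [v a / q]. The unit [a * y0 ^- q] commutes with [y0], so its
    residue is fixed by the powers [R ^ t] and [R ^ q], hence by [R] as [t] is prime to [q]. It is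
    then the norm of some residue [w], and [w * y0] is the approximate root. *)
Lemma ramified_leading_root a t : a \in L -> a != 0 -> v a = t%:R / e%:R -> ~~ (q %| t)%N ->
  exists y, [/\ y \in 'C(L)%VS, y != 0, v y = (t * m')%:R / (e * m)%:R,
                q%:R * v y = v a & vgt v (v a) (y ^+ q - a)].
Proof.
move=> aL a0 va qt.
have R0 : (0 < R)%N := ltnW residue_base_gt1.
have q0 := prime_gt0 hq.
have [y0 [yC y00 vy0]] := cent_level (t * m').
have qvy0 : q%:R * v y0 = v a.
  rewrite vy0 va mE !natrM; field.
  by rewrite !pnatr_eq0 -!lt0n e0 q0 /= /m' divn_gt0 // dvdn_leq.
have cop : coprime t q by rewrite coprime_sym prime_coprime.
pose ep := a * y0 ^- q.
have epC : ep \in 'C(L)%VS.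
  apply: memvM; first exact: sub_cent.
  by rewrite memvV; apply: memvX => //; exact: cent1.
have y0q0 : y0 ^+ q != 0 by rewrite (exp_neq0 hvD).
have ep0 : ep != 0 by rewrite (mul_neq0 hvD) // invr_eq0.
have vep : v ep = 0.
  by rewrite (valuationM hv.1) ?invr_eq0 // (vV hvD) // (vX hvD) // -mulr_natl qvy0 subrr.
have epy : y0 * ep = ep * y0.
  rewrite /ep mulrA (cent_comm yC aL) -!mulrA; congr (_ * _).
  by apply: commrV; apply: commrX.
have [i hi hepi] := struct_cres hS epC ep0 vep.
have hiq : (N %| i * (R ^ q).-1)%N by rewrite residue_base.
have hit : (N %| i * (R ^ t).-1)%N.
  have := level_conj_dvd y00 vy0 epy hepi.
  by rewrite /R -expnM -mulnA [(m' * t)%N]mulnC.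
have hi1 : (N %| i * R.-1)%N by apply: (dvdn_pred_gcd R0 cop hit hiq).
have [c ec] := dvdnP residue_base_dvd.
have N0 : (0 < N)%N := N_gt0 hp hn.
have N'0 : (0 < (R ^ q).-1)%N by move: N0; rewrite ec muln_gt0 => /andP[].
have c0 : (0 < c)%N by move: N0; rewrite ec muln_gt0 => /andP[].
(* Surjectivity of the norm of finite fields: [om ^ i] lies in the field with [R] elements, so [i]
   is a multiple of [c] times the norm exponent. *)
have [k' ek] : exists k', (i = c * (\sum_(l < q) R ^ l) * k')%N.
  have R10 : (0 < R.-1)%N by rewrite -subn1 subn_gt0 residue_base_gt1.
  have : (c * \sum_(l < q) R ^ l %| i)%N.
    by rewrite -(dvdn_pmul2r R10) -mulnA [(_ * R.-1)%N]mulnC -pred_exp_sum // -ec.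
  by move=> /dvdnP[k' ->]; exists k'; rewrite mulnC.
pose k := (c * k')%N.
have hk : (N %| k * (R ^ q).-1)%N by rewrite ec /k mulnAC dvdn_mulr.
have [w wC hw] : exists2 w, w \in 'C(L)%VS & vgt v 0 (w - om ^+ k).
  by apply: (struct_cres_lift hS); rewrite -residue_base.
have [w0 vw] := res_unit hp hn hv hdiv hc hw.
exists (w * y0).
have wy0 : w * y0 != 0 by rewrite (mul_neq0 hvD).
have vwy : v (w * y0) = v y0 by rewrite (valuationM hv.1) // vw add0r.
split; rewrite ?vwy ?memvM //.
have vy0' : v y0 = (f * (t * m'))%:R / n%:R by rewrite vy0 val_level.
have h1 := norm_residue hp hn hv hdiv hc (w := w) (k := k) q y00 vy0' hw.
have h2 : k * (\sum_(l < q) (p ^ (f * (t * m'))) ^ l) = i %[mod N].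
  have -> : (p ^ (f * (t * m')) = R ^ t)%N by rewrite /R -expnM -mulnA [(m' * t)%N]mulnC.
  by rewrite (exponent_sum_perm R0 q0 cop hk) ek /k mulnAC.
have -> : (w * y0) ^+ q - a = ((w * y0) ^+ q * y0 ^- q - ep) * y0 ^+ q.
  by rewrite mulrBl !mulrVK ?hdiv.
rewrite -qvy0 mulr_natl -(vX hvD) // -[v _]add0r.
apply: (vgtMr hvD); last exact: vge_refl.
apply: (vgt_trans hvD) h1 _; rewrite (om_mod hc h2); exact: (vgtC hvD).
Qed.

End Prime.

Lemma unramified_leading_root q a z k i : (0 < q)%N -> a \in L -> a != 0 ->
  v a = (q%:Z * z)%:~R / e%:R -> forall y0, y0 \in L -> y0 != 0 -> v y0 = z%:~R / e%:R ->
  vgt v 0 (a * y0 ^- q - om ^+ i) -> k * q = i %[mod N] ->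
  forall w, w \in 'C(L)%VS -> vgt v 0 (w - om ^+ k) ->
  [/\ w * y0 != 0, q%:R * v (w * y0) = v a & vgt v (v a) ((w * y0) ^+ q - a)].
Proof.
move=> q0 aL a0 va y0 y0L y00 vy0 hi hk w wC hw.
have [w0 vw] := res_unit hp hn hv hdiv hc hw.
have y0q0 : y0 ^+ q != 0 by rewrite (exp_neq0 hvD).
have vwy : v (w * y0) = v y0 by rewrite (valuationM hv.1) // vw add0r.
have qv : q%:R * v y0 = v a by rewrite vy0 va intrM mulrA.
split; rewrite ?(mul_neq0 hvD) ?vwy //.
have -> : (w * y0) ^+ q - a = (w ^+ q - a * y0 ^- q) * y0 ^+ q.
  by rewrite mulrBl mulrVK ?hdiv // exprMn_comm //; apply: cent_comm.
rewrite -qv mulr_natl -(vX hvD) // -[v _]add0r.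
apply: (vgtMr hvD); last exact: vge_refl.
have hwq : vgt v 0 (w ^+ q - om ^+ i).
  rewrite -(om_mod hc hk) exprM; apply: (vgt_exp hvD) => //.
  exact: (vge_omX hp hn hv hdiv hc).
by apply: (vgt_trans hvD) hwq _; apply: (vgtC hvD).
Qed.

Lemma field_unit_part q a (z : int) : a \in L -> a != 0 -> v a = (q%:Z * z)%:~R / e%:R ->
  exists y0 i, [/\ y0 \in L, y0 != 0, v y0 = z%:~R / e%:R, vgt v 0 (a * y0 ^- q - om ^+ i) &
                  (N %| i * (p ^ f).-1)%N].
Proof.
move=> aL a0 va; have [y0 [y0L y00 vy0]] := field_level z.
have [] := struct_res hS (x := a * y0 ^- q).
- by rewrite memvM ?memvV ?(memvX _ (subfield1 hL)).
- by rewrite (mul_neq0 hvD) ?invr_eq0 ?(exp_neq0 hvD).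
- rewrite (valuationM hv.1) ?invr_eq0 ?(exp_neq0 hvD) // (vV hvD) ?(exp_neq0 hvD) //.
  by rewrite (vX hvD) // -mulr_natl vy0 va intrM mulrA subrr.
by move=> i hi hy; exists y0, i.
Qed.

(** Here raising to the power [q] is bijective on the residue units of [L]. This includes
    [q = p]. *)
Lemma field_leading_root q a (z : int) : prime q -> ~~ (q %| (p ^ f).-1)%N ->
  a \in L -> a != 0 -> v a = (q%:Z * z)%:~R / e%:R ->
  exists y, [/\ y \in L, y != 0, q%:R * v y = v a & vgt v (v a) (y ^+ q - a)].
Proof.
move=> hq qQ aL a0 va; have q0 := prime_gt0 hq.
have [y0 [i [y0L y00 vy0 hi hiQ]]] := field_unit_part aL a0 va.
have cop : coprime q (p ^ f).-1 by rewrite prime_coprime.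
have Q0 : (0 < (p ^ f).-1)%N by case: (_.-1) cop => //; rewrite /coprime gcdn0 => /eqP q1; move: hq; rewrite q1.
have [[u w] _ /= huw] : {uw : nat * nat | True & (uw.1 * q = uw.2 * (p ^ f).-1 + 1)%N}.
  case: (egcdnP (p ^ f).-1 q0) => u w h _.
  by exists (u, w) => //=; rewrite h; move: cop; rewrite /coprime => /eqP ->.
pose k := (i * u)%N.
have hkq : k * q = i %[mod N].
  rewrite /k -mulnA huw mulnDr muln1 mulnCA -modnDml.
  by have /eqP -> := dvdn_mull w hiQ.
have hk : (N %| k * (p ^ f).-1)%N by rewrite /k mulnAC dvdn_mulr.
have [x xL hx] := struct_res_lift hS hk.
have [h1 h2 h3] := unramified_leading_root q0 aL a0 va y0L y00 vy0 hi hkq (sub_cent xL) hx.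
by exists (x * y0); rewrite memvM.
Qed.

(** If [q] divides [Q - 1], then [1 + Q + ... + Q ^ (m - 1)] is congruent to [m], hence to 0, modulo
    [q]: each unit of the field with [Q] elements is a q-th power in the extension of degree [m]. *)
Lemma cent_leading_root q a (z : int) : prime q -> (q %| m)%N -> q != p ->
  a \in L -> a != 0 -> v a = (q%:Z * z)%:~R / e%:R ->
  exists y, [/\ y \in 'C(L)%VS, y != 0, q%:R * v y = v a & vgt v (v a) (y ^+ q - a)].
Proof.
move=> hq qm qp aL a0 va; have q0 := prime_gt0 hq.
have [qQ|qQ] := boolP (q %| (p ^ f).-1)%N; last first.
  have [y [yL y0 h1 h2]] := field_leading_root hq qQ aL a0 va.
  by exists y; rewrite sub_cent.
have [y0 [i [y0L y00 vy0 hi hiQ]]] := field_unit_part aL a0 va.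
set Q := (p ^ f)%N in qQ hiQ.
have Qgt0 : (0 < Q)%N by rewrite expn_gt0 p0.
have Q1 : (1 < Q)%N by rewrite /Q -{1}(expn0 p) ltn_exp2l ?prime_gt1.
have Q10 : (0 < Q.-1)%N by rewrite -subn1 subn_gt0.
have eQ := pred_exp_sum m Qgt0; set S := (\sum_(l < m) Q ^ l)%N in eQ.
have QmE : (Q ^ m = p ^ (m * f))%N by rewrite /Q -expnM mulnC.
have hN : ((Q ^ m).-1 %| N)%N.
  by rewrite QmE dvdn_pred_exp // (struct_n hS) -mulnA [(f * m)%N]mulnC dvdn_mull.
have [c ec] := dvdnP hN.
have qS : (q %| S)%N.
  have hQ1 : Q = 1 %[mod q] by apply/eqP; rewrite eqn_mod_dvd // subn1.
  have : S = (\sum_(l < m) 1)%N %[mod q].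
    by apply: modn_sum => l; rewrite -modnXm hQ1 modnXm exp1n.
  rewrite sum1_card card_ord => h; rewrite /dvdn h; exact: qm.
have [S' eS] := dvdnP qS.
have cSi : (c * S %| i)%N by rewrite -(dvdn_pmul2r Q10) -mulnA [(S * _)%N]mulnC -eQ -ec.
have [i' ei] := dvdnP cSi.
pose k := (i' * (c * S'))%N.
have hkq : k * q = i %[mod N] by rewrite ei eS /k -!mulnA.
have hk : (N %| k * (p ^ (m * f)).-1)%N.
  by rewrite -QmE /k ec; apply/dvdnP; exists (i' * S')%N; rewrite [(c * S')%N]mulnC mulnA -mulnA.
have [x xC hx] := struct_cres_lift hS hk.
have [h1 h2 h3] := unramified_leading_root q0 aL a0 va y0L y00 vy0 hi hkq xC hx.
by exists (x * y0); split=> //; apply: memvM => //; exact: sub_cent.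
Qed.

(** On residues this sum is the trace from the field with [R ^ p] elements to that with [R]. The
    element [w] is what inverts the differential of the p-th power in leading terms. *)
Lemma exists_trace1 t y : (p %| m)%N -> ~~ (p %| t)%N -> y \in 'C(L)%VS -> y != 0 ->
  v y = (t * (m %/ p))%:R / (e * m)%:R ->
  exists w, [/\ w \in 'C(L)%VS, vge v 0 w &
                vgt v 0 (\sum_(l < p) y ^+ l * w * y ^- l - 1)].
Proof.
move=> pm pt yC y0 vy.
set m' := (m %/ p)%N in vy; pose R := (p ^ (f * m'))%N.
have R1 : (1 < R)%N := residue_base_gt1 pm.
have R0 := ltnW R1.
have cop : coprime t p by rewrite coprime_sym prime_coprime.
have RpE : (R ^ p = p ^ (m * f))%N := residue_base pm.
have RN := residue_base_dvd pm; rewrite -/m' -/R in RN.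
have pR : (p %| R ^ p)%N.
  by rewrite RpE dvdn_exp // muln_gt0 m0.
have [k hk hT] := exists_trace_neq0 hp hn hK hv hdiv hc R1 p0 pR RN.
have [w0 w0C hw0] : exists2 w, w \in 'C(L)%VS & vgt v 0 (w - om ^+ k).
  by apply: (struct_cres_lift hS); rewrite -RpE.
have yX0 l : y ^+ l != 0 by rewrite (exp_neq0 hvD).
have cjw (l : nat) : vgt v 0 (y ^+ l * w0 * y ^- l - om ^+ (k * (R ^ t) ^ l)).
  have vyl : v (y ^+ l) = (f * (t * m') * l)%:R / n%:R.
    by rewrite (vX hvD) // vy val_level -mulrnAl -mulrnA.
  have := conj_residue hp hn hv hdiv hc (yX0 l) vyl hw0.
  have -> : (p ^ (f * (t * m') * l) = (R ^ t) ^ l)%N by rewrite /R -!expnM [(t * m')%N]mulnC !mulnA.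
  by [].
pose T := \sum_(l < p) y ^+ l * w0 * y ^- l.
have TC : T \in 'C(L)%VS.
  by apply: rpred_sum => l _; rewrite !memvM ?memvV ?(memvX _ cent1).
have permE : \sum_(l < p) om ^+ (k * (R ^ t) ^ l) = \sum_(l < p) om ^+ (k * R ^ l).
  have [s sinj sE] := ord_mul_inj p0 cop.
  rewrite [RHS](reindex_inj sinj) /=; apply: eq_bigr => l _; apply: (om_mod hc).
  by rewrite sE -expnM; apply: modn_mul_exp_mod.
have hTT : vgt v 0 (T - \sum_(l < p) om ^+ (k * R ^ l)).
  by rewrite -permE -sumrB; apply: (vgt_sum hvD) => l _.
have Tnot : ~ vgt v 0 T.
  by move=> h; apply: hT; rewrite -(subKr T (\sum_(l < p) _)); apply: (vgtB hvD).
have vgeT : vge v 0 T.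
  rewrite -(subrK (\sum_(l < p) om ^+ (k * R ^ l)) T); apply: (vgeD hvD).
    exact: vgtW.
  by apply: (vge_sum hvD) => l _; apply: (vge_omX hp hn hv hdiv hc).
have [T0 vT'] := not_vgt Tnot.
have vT : v T = 0 by apply/eqP; rewrite eq_le vT' (vge_val T0 vgeT).
(* Conjugation by [y] shifts the sum by one place, and the terms [l = p] and [l = 0] are congruent;
   so [w0] may be divided by [T] up to higher valuation. *)
have conjT1 : vgt v 0 (y * T * y^-1 - T).
  have -> : y * T * y^-1 - T = y ^+ p * w0 * y ^- p - w0.
    rewrite /T mulr_sumr mulr_suml.
    have -> : \sum_(l < p) y * (y ^+ l * w0 * y ^- l) * y^-1 = \sum_(l < p) y ^+ l.+1 * w0 * y ^- l.+1.
      by apply: eq_bigr => l _; rewrite [y ^+ l.+1]exprS -{2}exprS exprS invrM ?unitrX ?hdiv // !mulrA.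
    rewrite -sumrB -(big_mkord xpredT (fun l => y ^+ l.+1 * w0 * y ^- l.+1 - y ^+ l * w0 * y ^- l)).
    by rewrite telescope_sumr // expr0 invr1 mul1r mulr1.
  apply: (vgt_trans hvD) (cjw p) _; apply: (vgtC hvD).
  have -> : om ^+ (k * (R ^ t) ^ p) = om ^+ k.
    apply: (om_mod hc); rewrite -expnM modn_mul_exp //.
    by apply: dvdn_trans hk _; rewrite dvdn_mul // dvdn_pred_exp // dvdn_mull.
  exact: hw0.
have conjT l : vgt v 0 (y ^+ l * T * y ^- l - T).
  elim: l => [|l IH]; first by rewrite expr0 invr1 mul1r mulr1 subrr; left.
  have -> : y ^+ l.+1 * T * y ^- l.+1 - T = y * (y ^+ l * T * y ^- l - T) * y^-1 + (y * T * y^-1 - T).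
    rewrite mulrBr mulrBl addrA subrK; congr (_ - _).
    by rewrite exprS invrM ?unitrX ?hdiv // !mulrA.
  by apply: (vgtD hvD) => //; exact: (vgt_conj hv hdiv y0 IH).
exists (T^-1 * w0); split.
- by rewrite memvM ?memvV.
- rewrite -[0%R : rat]addr0; apply: (vgeM hvD).
    by right; rewrite (vV hvD) // vT oppr0.
  exact: (vgt_vge hvD (vge_omX hp hn hv hdiv hc k) hw0).
- have -> : 1 = \sum_(l < p) T^-1 * (y ^+ l * w0 * y ^- l).
    by rewrite -mulr_sumr mulVr // hdiv.
  rewrite -sumrB; apply: (vgt_sum hvD) => l _.
  have -> : y ^+ l * (T^-1 * w0) * y ^- l - T^-1 * (y ^+ l * w0 * y ^- l) =
     (- (y ^+ l * T^-1 * y ^- l) * (y ^+ l * T * y ^- l - T) * T^-1) * (y ^+ l * w0 * y ^- l).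
    have yu : y ^+ l \is a GRing.unit by rewrite hdiv.
    have Tu : T \is a GRing.unit by rewrite hdiv.
    have AB : y ^+ l * T^-1 * y ^- l * (y ^+ l * T * y ^- l) = 1.
      by rewrite !mulrA !mulrVK // mulrV.
    have AZ : y ^+ l * T^-1 * y ^- l * (y ^+ l * w0 * y ^- l) = y ^+ l * (T^-1 * w0) * y ^- l.
      by rewrite !mulrA mulrVK.
    by rewrite !mulNr mulrBr AB !mulrBl mul1r mulrK // AZ opprB.
  have vTi : vge v 0 T^-1 by right; rewrite (vV hvD) // vT oppr0.
  have cge z : vge v 0 z -> vge v 0 (y ^+ l * z * y ^- l).
    case=> [->|hz]; first by rewrite mulr0 mul0r; left.
    have [->|z0] := eqVneq z 0; first by rewrite mulr0 mul0r; left.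
    by right; rewrite (v_conj hvD).
  have w0O := vgt_vge hvD (vge_omX hp hn hv hdiv hc k) hw0.
  rewrite -[0%R : rat]addr0; apply: (vgtMr hvD); last exact: cge.
  rewrite -[0%R : rat]addr0; apply: (vgtMr hvD) => //.
  rewrite -[0%R : rat]addr0; apply: (vgtM hvD) => //.
  by apply: (vgeN hvD); apply: cge.
Qed.

End LeadingRoots.

(** * The Artin-Schreier equation on residues *)

Section ArtinSchreier.
Variables (p n : nat) (K : fieldType) (vp : K -> rat) (D : falgType K) (v : D -> rat).
Hypotheses (hp : prime p) (hn : (0 < n)%N) (hK : is_padic_field p vp).
Hypotheses (hv : extends_valuation vp v) (hdiv : is_division D).
Variables (W : {aspace D}) (om g : D).
Hypothesis hc : Dn_coordinates p n v W om g.
Variables (L : {aspace D}) (e f m : nat).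
Hypotheses (hL : is_subfield L) (hS : subfield_structure p n v om L e f m).

Let hvD := division_valued hv hdiv.
Let N := (p ^ n).-1.
Let p0 : (0 < p)%N := prime_gt0 hp.
Let gu : g \is a GRing.unit := hdiv (coord_g0 hc).

Let sg (x : D) : D := g * x * g^-1.

Let sgD x y : sg (x + y) = sg x + sg y. Proof. by rewrite /sg mulrDr mulrDl. Qed.
Let sgM x y : sg (x * y) = sg x * sg y. Proof. by rewrite /sg !mulrA mulrVK. Qed.
Let sg0 : sg 0 = 0. Proof. by rewrite /sg mulr0 mul0r. Qed.
Let sg_sum (I : Type) (r : seq I) (P : pred I) (F : I -> D) :
  sg (\sum_(i <- r | P i) F i) = \sum_(i <- r | P i) sg (F i).
Proof. by rewrite /sg mulr_sumr mulr_suml. Qed.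
Let sg_om i : sg (om ^+ i) = om ^+ (i * p).
Proof. by have := conj_gX hdiv hc 1 i; rewrite !expr1 expn1. Qed.

(* Iterates at 0 of the affine map [Phi z = 1 - om ^+ i * sg z], whose fixed points solve the
   Artin-Schreier equation on residues. *)
Let u (i l : nat) : D := iter l (fun z => 1 - om ^+ i * sg z) 0.

Let gf l (x : D) : D := g ^+ l * x * g ^- l.

Let gfS l x : gf l.+1 x = sg (gf l x).
Proof. by rewrite /gf /sg exprS invrM ?unitrX // !mulrA. Qed.

Let gf_sg l x : gf l (sg x) = sg (gf l x).
Proof.
elim: l x => [|l IH] x; first by rewrite /gf !expr0 invr1 !mul1r !mulr1.
by rewrite !gfS IH.
Qed.

Let gfM l x y : gf l (x * y) = gf l x * gf l y.
Proof. by rewrite /gf !mulrA mulrVK ?unitrX. Qed.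

Let gfB l x y : gf l (x - y) = gf l x - gf l y.
Proof. by rewrite /gf mulrBr mulrBl. Qed.

Let gf1 l : gf l 1 = 1. Proof. by rewrite /gf mulr1 mulrV ?unitrX. Qed.
Let gf0 l : gf l 0 = 0. Proof. by rewrite /gf mulr0 mul0r. Qed.
Let gf_om l i : gf l (om ^+ i) = om ^+ (i * p ^ l).
Proof. exact: (conj_gX hdiv hc l i). Qed.

Let omC i j : om ^+ i * om ^+ j = om ^+ j * om ^+ i.
Proof. by rewrite -!exprD addnC. Qed.

Let W1 : 1 \in W := subfield1 (unramified_is_subfield hdiv (coord_W hc)).
Let WC : {in W &, forall x y, x * y = y * x} := subfieldC (unramified_is_subfield hdiv (coord_W hc)).
Let omW i : om ^+ i \in W. Proof. exact: (memvX _ W1 (coord_omW hc)). Qed.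
Let sgW x : x \in W -> sg x \in W.
Proof. by move=> xW; case: (coord_frob hc xW). Qed.

Let uS i l : u i l.+1 = 1 - om ^+ i * sg (u i l). Proof. by []. Qed.

Let uW i l : u i l \in W.
Proof.
by elim: l => [|l IH]; rewrite ?mem0v // uS rpredB // memvM // sgW.
Qed.

(** The coefficient of the semilinear part of the [l]-th iterate of [Phi], as [u_add] shows. *)
Let xi i l : D := (-1) ^+ l * om ^+ (i * \sum_(t < l) p ^ t).

Let sgN1 l x : sg ((-1) ^+ l * x) = (-1) ^+ l * sg x.
Proof. by rewrite -signr_odd; case: odd; rewrite ?expr0 ?mul1r // expr1 !mulN1r /sg mulrN mulNr. Qed.

Let xiS i l : xi i l.+1 = - (om ^+ i * sg (xi i l)).
Proof.
rewrite /xi sgN1 sg_om mulrA commr_sign -mulrA -exprD exprS mulN1r mulNr.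
congr (- (_ * om ^+ _)).
rewrite big_ord_recl expn0 mulnDr muln1 -mulnA big_distrl /=.
by congr (_ + _ * _)%N; apply: eq_bigr => t _; rewrite -expnSr.
Qed.

Let u_add i l k : u i (l + k) = u i k + xi i k * gf k (u i l).
Proof.
elim: k => [|k IH].
  by rewrite addn0 /xi big_ord0 muln0 !expr0 mulr1 /gf expr0 invr1 mul1r mulr1 mul1r add0r.
rewrite addnS !uS IH sgD sgM mulrDr opprD addrA; congr (_ + _).
by rewrite xiS gfS mulrA mulNr.
Qed.

Let gf_u k i l : i * p ^ k = i %[mod N] -> gf k (u i l) = u i l.
Proof.
move=> hi; elim: l => [|l IH]; first exact: gf0.
by rewrite !uS gfB gf1 gfM gf_om gf_sg IH (om_mod hc hi).
Qed.

Let u_mul i k l : i * p ^ k = i %[mod N] -> u i (k * l) = (\sum_(t < l) xi i k ^+ t) * u i k.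
Proof.
move=> hi; elim: l => [|l IH]; first by rewrite muln0 big_ord0 mul0r.
rewrite mulnS addnC u_add gf_u // IH mulrA mulr_sumr big_ord_recl expr0 mulrDl mul1r.
by congr (_ + _ * _); apply: eq_bigr => t _; rewrite exprS.
Qed.

Let vge_sg x : vge v 0 x -> vge v 0 (sg x).
Proof.
case=> [->|h]; first by rewrite sg0; left.
have [->|x0] := eqVneq x 0; first by rewrite sg0; left.
by right; rewrite (v_conj hvD) // (coord_g0 hc).
Qed.

Let vge_om i : vge v 0 (om ^+ i). Proof. exact: (vge_omX hp hn hv hdiv hc). Qed.

Let vge_u i l : vge v 0 (u i l).
Proof.
elim: l => [|l IH]; first by left.
rewrite uS; apply: (vgeB hvD); first exact: (vge1 hvD).
by rewrite -[0%R : rat]addr0; apply: (vgeM hvD) => //; apply: vge_sg.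
Qed.

Let vge_xi i l : vge v 0 (xi i l).
Proof. by rewrite /xi -signr_odd; case: odd; rewrite ?expr0 ?mul1r // expr1 mulN1r; apply: (vgeN hvD). Qed.

(** Up to sign [xi i f] is a norm to the prime field. The sign disappears since [p - 1] is even or,
    for [p = 2], since [-1] is congruent to 1. *)
Let xi_pow i : (N %| i * (p ^ f).-1)%N -> vgt v 0 (xi i f ^+ p.-1 - 1).
Proof.
move=> hi; rewrite /xi exprMn_comm; last exact/esym/commr_sign.
rewrite -!exprM.
have -> : (i * (\sum_(t < f) p ^ t) * p.-1 = i * (p ^ f).-1)%N.
  by rewrite pred_exp_sum // -mulnA; congr (_ * _)%N; rewrite mulnC.
have -> : om ^+ (i * (p ^ f).-1) = 1.
  by rewrite -[RHS](expr0 om); apply: (om_mod hc); rewrite mod0n; apply/eqP.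
rewrite mulr1; have [p2|podd] := even_prime hp.
  rewrite p2 muln1 -signr_odd; case: odd; last by rewrite expr0 subrr; left.
  rewrite expr1 -opprD; apply: (vgtN hvD); rewrite -[1 + 1]/(2%:R) -p2.
  by right; rewrite (v_p hp hK hv).
have ev : ~~ odd p.-1 by case: (p) podd.
by rewrite -signr_odd oddM (negPf ev) andbF expr0 subrr; left.
Qed.

(** The sum splits into [a] congruent blocks of length [p - 1], and [p] divides [a]. *)
Let geometric i a : (p %| a)%N -> (N %| i * (p ^ f).-1)%N ->
  vgt v 0 (\sum_(t < a * p.-1) xi i f ^+ t).
Proof.
move=> pa hi.
have block b : vgt v 0 (\sum_(t < b * p.-1) xi i f ^+ t - (\sum_(t < p.-1) xi i f ^+ t) *+ b).
  elim: b => [|b IH]; first by rewrite mul0n big_ord0 mulr0n subrr; left.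
  rewrite mulSn big_split_ord mulrS /= opprD addrACA; apply: (vgtD hvD).
    by rewrite subrr; left.
  have -> : \sum_(t < b * p.-1) xi i f ^+ (p.-1 + t) = xi i f ^+ p.-1 * \sum_(t < b * p.-1) xi i f ^+ t.
    by rewrite mulr_sumr; apply: eq_bigr => t _; rewrite exprD.
  have hs : vge v 0 (\sum_(t < b * p.-1) xi i f ^+ t).
    apply: (vge_sum hvD) => t _; rewrite -(mul0rn rat t); exact: (vgeX hvD).
  apply: (vgt_trans hvD) IH; rewrite -[X in _ - X]mul1r -mulrBl -[0%R : rat]addr0.
  exact: (vgtMr hvD (xi_pow hi) hs).
rewrite -(subrK ((\sum_(t < p.-1) xi i f ^+ t) *+ a) (\sum_(t < _) _)); apply: (vgtD hvD) => //.
rewrite -mulr_natl -[0%R : rat]addr0; apply: (vgtMr hvD).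
  apply: (vge_gt ltr01); apply: (dvd_vge1 hvD) pa.
  by right; rewrite (v_p hp hK hv).
by apply: (vge_sum hvD) => t _; rewrite -(mul0rn rat t); exact: (vgeX hvD).
Qed.

(** A fixed point of [Phi] is a weighted mean of the orbit of 0, once the orbit closes up modulo
    higher valuation. It does after [M = f * (m * (p - 1))] steps: [u i M] is a multiple of a
    geometric sum that vanishes because [p] divides [m]. *)
Lemma artin_schreier ga : (p %| m)%N -> ga \in L -> ga != 0 -> v ga = 0 ->
  exists z, [/\ z \in 'C(L)%VS, vge v 0 z & vgt v 0 (ga * z ^+ p + z - 1)].
Proof.
move=> pm gaL ga0 vga; have [e0 f0 m0] := struct_gt0 hn hS.
have [i hi hgi] := struct_res hS gaL ga0 vga.
pose N1 := (m * f)%N.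
have N10 : (0 < N1)%N by rewrite muln_gt0 m0.
have N1N : ((p ^ N1).-1 %| N)%N.
  by rewrite dvdn_pred_exp // (struct_n hS) -mulnA [(f * m)%N]mulnC dvdn_mull.
have [k hk hT] := exists_trace_neq0 hp hn hK hv hdiv hc (prime_gt1 hp) N10 (dvdn_exp N10 (dvdnn p)) N1N.
have hiN1 : (N %| i * (p ^ N1).-1)%N.
  by apply: dvdn_trans hi _; rewrite dvdn_mul // dvdn_pred_exp // dvdn_mull.
pose tau := \sum_(l < N1) om ^+ (k * p ^ l).
have kmod x : k * p ^ (N1 + x) = k * p ^ x %[mod N].
  by rewrite expnD mulnA -modnMml (modn_mul_exp p0 hk) modnMml.
pose M := (N1 * p.-1)%N.
pose A := \sum_(l < M) om ^+ (k * p ^ l).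
have AE : A = tau *+ p.-1.
  rewrite /A /M; elim: (p.-1) => [|b IH]; first by rewrite muln0 big_ord0.
  rewrite mulnS big_split_ord mulrS /=; congr (_ + _); rewrite -IH.
  by apply: eq_bigr => l _; apply: (om_mod hc).
(* Conjugation by [g] moves each weight to the next and [Phi] moves [u i l] to [u i l.+1], so only a
   boundary term remains. The total weight [A] is invertible because the trace [tau] is nonzero on
   residues. *)
pose z0 := \sum_(l < M) om ^+ (k * p ^ l) * u i l.
have shift (F : nat -> D) : \sum_(l < M) F l.+1 = \sum_(l < M) F l - F 0%N + F M.
  have h1 : \sum_(l < M.+1) F l = F 0%N + \sum_(l < M) F l.+1 by rewrite big_ord_recl.
  have h2 : \sum_(l < M.+1) F l = \sum_(l < M) F l + F M by rewrite big_ord_recr.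
  by apply: (addrI (F 0%N)); rewrite -h1 h2 addrA [F 0%N + _]addrC subrK.
have uM : vgt v 0 (u i M).
  have -> : M = (f * (m * p.-1))%N by rewrite /M /N1 mulnAC mulnC.
  rewrite u_mul; last exact: modn_mul_exp.
  rewrite -[0%R : rat]addr0; apply: (vgtMr hvD) => //.
  exact: geometric.
have key : z0 + om ^+ i * sg z0 = A - om ^+ k * u i M.
  have -> : om ^+ i * sg z0 = \sum_(l < M) om ^+ (k * p ^ l.+1) * (1 - u i l.+1).
    rewrite sg_sum mulr_sumr; apply: eq_bigr => l _.
    rewrite sgM sg_om -mulnA -expnSr mulrA omC -mulrA; congr (_ * _).
    by rewrite uS opprB addrC subrK.
  rewrite (shift (fun l => om ^+ (k * p ^ l) * (1 - u i l))) expn0 muln1.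
  have -> : u i 0 = 0 by [].
  have -> : om ^+ (k * p ^ M) = om ^+ k.
    apply: (om_mod hc); apply: modn_mul_exp => //; apply: dvdn_trans hk _.
    by rewrite dvdn_mul // dvdn_pred_exp // dvdn_mulr.
  have -> : \sum_(l < M) om ^+ (k * p ^ l) * (1 - u i l) = A - z0.
    by rewrite /A /z0 -sumrB; apply: eq_bigr => l _; rewrite mulrBr mulr1.
  by rewrite subr0 mulr1 mulrBr mulr1 !addrA subrK [z0 + A]addrC addrK.
have gfA l : l = N1 -> gf l A = A.
  move=> ->; rewrite /gf /A mulr_sumr mulr_suml; apply: eq_bigr => t _.
  rewrite -[_ * _ * _]/(gf N1 _) gf_om; apply: (om_mod hc).
  by rewrite -mulnA -expnD addnC kmod.
have gfz0 : gf N1 z0 = z0.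
  rewrite {1}/gf /z0 mulr_sumr mulr_suml; apply: eq_bigr => t _.
  rewrite -[_ * _ * _]/(gf N1 _) gfM gf_om gf_u; last exact: modn_mul_exp.
  congr (_ * _); apply: (om_mod hc).
  by rewrite -mulnA -expnD addnC kmod.
have sgA : sg A = A.
  rewrite sg_sum.
  have -> : \sum_(l < M) sg (om ^+ (k * p ^ l)) = \sum_(l < M) om ^+ (k * p ^ l.+1).
    by apply: eq_bigr => l _; rewrite sg_om -mulnA -expnSr.
  rewrite (shift (fun l => om ^+ (k * p ^ l))) expn0 muln1.
  have -> : om ^+ (k * p ^ M) = om ^+ k.
    apply: (om_mod hc); apply: modn_mul_exp => //; apply: dvdn_trans hk _.
    by rewrite dvdn_mul // dvdn_pred_exp // dvdn_mulr.
  by rewrite subrK.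
have vp1 : v (p.-1)%:R = 0.
  rewrite (v_nat hK hv) ?(vp_coprime hp hK) //; last by rewrite -subn1 subn_gt0 prime_gt1.
  by rewrite gtnNdvd // -?subn1 ?subn_gt0 ?prime_gt1 // subn1 prednK.
have p1n0 : (p.-1)%:R != 0 :> D by rewrite (natD_neq0 _ hK) // -subn1 subn_gt0 prime_gt1.
have tauO : vge v 0 tau by apply: (vge_sum hvD) => l _.
have [tau0 vt'] := not_vgt hT.
have vtau : v tau = 0 by apply/eqP; rewrite eq_le vt' (vge_val tau0 tauO).
have A0 : A != 0 by rewrite AE -mulr_natl (mul_neq0 hvD).
have vA : v A = 0 by rewrite AE -mulr_natl (valuationM hv.1) // vp1 vtau addr0.
have AW : A \in W by apply: rpred_sum => l _.
have z0W : z0 \in W by apply: rpred_sum => l _; rewrite memvM.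
have z0O : vge v 0 z0.
  by apply: (vge_sum hvD) => l _; rewrite -[0%R : rat]addr0; apply: (vgeM hvD).
pose z := z0 * A^-1.
have Ai : vge v 0 A^-1 by right; rewrite (vV hvD) // vA oppr0.
have zW : z \in W by rewrite memvM ?memvV.
have zO : vge v 0 z by rewrite -[0%R : rat]addr0; apply: (vgeM hvD).
have eqz : vgt v 0 (z + om ^+ i * sg z - 1).
  have -> : z + om ^+ i * sg z - 1 = - (om ^+ k * u i M) * A^-1.
    have -> : sg z = sg z0 * A^-1.
      have sgAV : sg A^-1 = A^-1.
        apply: (mulrI (hdiv A0)); rewrite mulrV ?hdiv // -{1}sgA -sgM mulrV ?hdiv // /sg mulr1 mulrV //.
      by rewrite /z sgM sgAV.
    by rewrite /z mulrA -mulrDl key mulrBl mulrV ?hdiv // addrAC subrr add0r mulNr.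
  rewrite -[0%R : rat]addr0; apply: (vgtMr hvD) => //; apply: (vgtN hvD).
  by rewrite -[0%R : rat]addr0; apply: (vgtM hvD).
have gfz : gf N1 z = z.
  have gA := gfA N1 erefl.
  have gAV : gf N1 A^-1 = A^-1.
    by apply: (mulrI (hdiv A0)); rewrite mulrV ?hdiv // -{1}gA -gfM mulrV ?hdiv // gf1.
  by rewrite /z gfM gfz0 gAV.
(* [z] is fixed by conjugation by [g ^ N1], so its residue lies in the field with [p ^ (m * f)]
   elements, all of which lifts to [C(L)]. *)
have [z' z'C hz'] : exists2 z', z' \in 'C(L)%VS & vgt v 0 (z - z').
  have [h|h] := EM (vgt v 0 z); first by exists 0; rewrite ?mem0v ?subr0.
  have [zn0 vz'] := not_vgt h.
  have vz : v z = 0 by apply/eqP; rewrite eq_le vz' (vge_val zn0 zO).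
  have [k' _ hk'] := coord_res hc zn0 vz.
  have gN0 : g ^+ N1 != 0 by rewrite (exp_neq0 hvD) // (coord_g0 hc).
  have hh : vgt v 0 (z - om ^+ (k' * p ^ N1)).
    have := vgt_conj hv hdiv gN0 hk'; rewrite -/(gf N1 _) gfB gfz gf_om //.
  have [z' z'C hz'] := struct_cres_lift hS (modn_mul_exp_dvd p0 (om_eq_res hv hdiv hc hh hk')).
  by exists z' => //; apply: (vgt_trans hvD) hk' _; apply: (vgtC hvD).
have z'O : vge v 0 z' by apply: (vgt_vge hvD zO); apply: (vgtC hvD).
exists z'; split=> //.
have [_ /(_ zO) frob] := coord_frob hc zW; rewrite -/(sg z) in frob.
have -> : ga * z' ^+ p + z' - 1 = (ga * z' ^+ p - om ^+ i * sg z) + (z' - z) + (z + om ^+ i * sg z - 1).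
  by rewrite !addrA subrK [_ - _ + z' + _]addrAC subrK.
apply: (vgtD hvD) => //; apply: (vgtD hvD); last exact: (vgtC hvD).
apply: (vgt_mul2 hvD) => //; first by right; rewrite vga.
- exact: vge_sg.
- apply: (vgt_trans hvD (y := z ^+ p)); last exact: (vgtC hvD).
  by apply: (vgt_exp hvD) => //; apply: (vgtC hvD).
Qed.

End ArtinSchreier.

(** * Solving p-th power equations by Hensel's lemma *)

Section PrimeRoots.
Variables (p n : nat) (K : fieldType) (vp : K -> rat) (D : falgType K) (v : D -> rat).
Hypotheses (hp : prime p) (hn : (0 < n)%N) (hK : is_padic_field p vp).
Hypotheses (hv : extends_valuation vp v) (hdiv : is_division D).

Let hvK := padic_valued hK.
Let hvD := division_valued hv hdiv.
Let p0 : (0 < p)%N := prime_gt0 hp.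
Let p1 : (1 < p)%N := prime_gt1 hp.

Definition one_plus_power : nat -> K := fun j => if j == 0%N then 0 else 'C(p, j)%:R.

Lemma one_plus_powerE (y : D) : (1 + y) ^+ p = 1 + scalar_poly p one_plus_power y.
Proof.
rewrite exprDn_comm; last exact/esym/commr1.
rewrite big_ord_recl /scalar_poly [in RHS]big_ord_recl /= bin0 expr0 mulr1 expr1n.
rewrite /one_plus_power /= scale0r add0r; congr (_ + _); apply: eq_bigr => i _.
by rewrite /bump leq0n add1n expr1n mul1r scaler_nat.
Qed.

Lemma vge_one_plus_power j : (0 < j < p)%N -> vge vp 1 (one_plus_power j).
Proof.
move=> /andP[j0 jp]; rewrite /one_plus_power gtn_eqF //.
apply: (dvd_vge1 (p := p) hvK); first by right; rewrite (vp_p hp hK).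
by apply: prime_dvd_bin => //; rewrite j0.
Qed.

Lemma vgtZ r s (c : K) (x : D) : vgt vp r c -> vge v s x -> vgt v (r + s) (c *: x).
Proof.
have [->|c0] := eqVneq c 0; first by rewrite scale0r; left.
have [->|x0] := eqVneq x 0; first by rewrite scaler0; left.
move=> /(vgt_val c0) h1 /(vge_val x0) h2.
by right; rewrite (vZ hv) // ltr_leD.
Qed.

Let s1 : rat := (p.-1)%:R^-1.

Let p1Q : (p.-1)%:R = p%:R - 1 :> rat. Proof. by rewrite -subn1 natrB. Qed.
Let s1_gt0 : 0 < s1. Proof. by rewrite invr_gt0 ltr0n -subn1 subn_gt0. Qed.
Let ps1 : p%:R * s1 = 1 + s1.
Proof.
have h : (p%:R - 1) * s1 = 1 by rewrite -p1Q /s1 mulfV // gt_eqF // ltr0n -subn1 subn_gt0.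
by move: h; rewrite mulrBl mul1r => /eqP; rewrite subr_eq => /eqP.
Qed.

(* Above the level [p / (p - 1)], and at that level when the residual equation is solvable,
   the linear term of the p-th power map dominates. *)
Lemma root_high_level (S : {aspace D}) (M : nat) (b y0 : D) :
  (0 < M)%N -> (forall x, x \in S -> x != 0 -> exists z : int, v x = z%:~R / M%:R) ->
  1 \in S -> b \in S -> {in S, forall y, b * y = y * b} -> y0 \in S -> vge v s1 y0 ->
  vgt v (1 + s1) (scalar_poly p one_plus_power y0 - b) ->
  exists2 y, y \in S & (1 + y) ^+ p = 1 + b.
Proof.
move=> M0 hM S1 bS bC y0S hy0 hF.
have hB j : (j <= p)%N -> vge vp ((p%:R - j%:R) * s1) (one_plus_power j).
  move=> jp; case: (posnP j) => [->|j0]; first by left.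
  move: jp; rewrite leq_eqVlt => /orP[/eqP ->|jp].
    by rewrite subrr mul0r /one_plus_power gtn_eqF // binn; apply: (vge1 hvK).
  apply: vge_le (vge_one_plus_power _); last by rewrite j0.
  have : 1 <= j%:R :> rat by rewrite ler1n.
  by have := s1_gt0; have := ps1; nra.
have lin y d : y \in S -> vgt v s1 (y - y0) -> d \in S -> d != 0 -> y * d = d * y ->
    exists h, [/\ h \in S, vge v (v d - (p%:R - 1) * s1) h &
      vgt v (v d) (dscalar_poly p one_plus_power y h - d)].
  move=> yS hy dS d0 yd; have hys : vge v s1 y by apply: (vge_near hv hdiv hy0); apply: vgtW.
  have pK0 := natK_p_neq0 hp hK.
  (* This solves the linear term exactly. Each middle term gains a positive power of [y], and the
     top one is [p * h * y ^ (p - 1)], again of valuation above [v d]. *)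
  pose h := p%:R^-1 *: d.
  have hS : h \in S by rewrite rpredZ.
  have hh : vge v (v d - 1) h.
    by right; rewrite (vZ hv) ?invr_eq0 // (vV hvK) // (vp_p hp hK) addrC.
  exists h; split=> //.
    by apply: vge_le hh; have := ps1; lra.
  have ord1 : (1 < p.+1)%N by rewrite ltnS.
  rewrite /dscalar_poly (bigD1 (Ordinal ord1)) //= addrAC.
  have -> : one_plus_power 1 *: dpow 1 y h - d = 0.
    rewrite /dpow big_ord_recl big_ord0 addr0 /= expr0 mul1r mulr1 /one_plus_power /= bin1.
    by rewrite /h scalerA mulfV // scale1r subrr.
  rewrite add0r; apply: (vgt_sum hvD) => j hj.
  have [->|j0] := posnP j; first by rewrite /one_plus_power eqxx scale0r; left.
  have j1 : (1 < j)%N.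
    by rewrite ltn_neqAle j0 andbT eq_sym; apply: contra hj => /eqP ej; apply/eqP/val_inj.
  have j1Q : 2 <= j%:R :> rat by rewrite (ler_nat _ 2).
  have [jp|pj] := ltnP j p.
    have hBj := vge_one_plus_power (j := j); rewrite j0 jp in hBj.
    apply: (vge_gt _ (vgeZ hv (hBj isT) (vge_dpow hv hdiv j hys hh))).
    by have := s1_gt0; nra.
  have -> : nat_of_ord j = p by apply/eqP; rewrite eqn_leq pj -ltnS ltn_ord.
  rewrite dpow_comm; last by rewrite /h -scalerAr -scalerAl yd.
  have B1 : vge vp 0 (one_plus_power p) by rewrite /one_plus_power gtn_eqF // binn; apply: (vge1 hvK).
  rewrite -mulr_natl; have pge : vge v 1 (p%:R : D) by right; rewrite (v_p hp hK hv).
  apply: (vge_gt _ (vgeZ hv B1 (vgeM hvD pge (vgeM hvD hh (vgeX hvD p.-1 hys))))).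
  have : 0 < s1 *+ p.-1 by rewrite pmulrn_rgt0 // -subn1 subn_gt0.
  lra.
have hF' : vgt v (p%:R * s1) (scalar_poly p one_plus_power y0 - b) by rewrite ps1.
have [y [yS _ hy]] := hensel hp hK hv hdiv hB M0 hM S1 bS bC y0S hy0 hF' lin.
by exists y => //; rewrite one_plus_powerE hy.
Qed.

Variables (W : {aspace D}) (om g : D).
Hypothesis hc : Dn_coordinates p n v W om g.
Variables (L : {aspace D}) (e f m : nat).
Hypotheses (hL : is_subfield L) (hS : subfield_structure p n v om L e f m).

(** Only the top term matters at level [s]. The general [B] covers both [X ^ p] and, below the
    critical level, [(1 + X) ^ p - 1]. *)
Lemma ramified_root (B : nat -> K) (a y0 : D) t (s := (t * (m %/ p))%:R / (e * m)%:R) :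
  (p %| m)%N -> ~~ (p %| t)%N -> B 0%N = 0 -> B p = 1 ->
  (forall j, (0 < j < p)%N -> vgt vp ((p%:R - j%:R) * s) (B j)) ->
  a \in L -> y0 \in 'C(L)%VS -> y0 != 0 -> v y0 = s -> vgt v (p%:R * s) (scalar_poly p B y0 - a) ->
  exists2 y, y \in 'C(L)%VS & scalar_poly p B y = a.
Proof.
move=> pm pt B0 Bp hBj aL y0C y00 vy0 hF.
have [e0 f0 m0] := struct_gt0 hn hS.
have hB j : (j <= p)%N -> vge vp ((p%:R - j%:R) * s) (B j).
  move=> jp; case: (posnP j) => [->|j0]; first by rewrite B0; left.
  move: jp; rewrite leq_eqVlt => /orP[/eqP ->|jp].
    by rewrite subrr mul0r Bp; apply: (vge1 hvK).
  by apply/vgtW/hBj; rewrite j0.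
have lin y d : y \in 'C(L)%AS -> vgt v s (y - y0) -> d \in 'C(L)%AS -> d != 0 -> y * d = d * y ->
    exists h, [/\ h \in 'C(L)%AS, vge v (v d - (p%:R - 1) * s) h &
      vgt v (v d) (dscalar_poly p B y h - d)].
  move=> yC hy dC d0 yd.
  have [yn0 vy] : y != 0 /\ v y = v y0 by apply: (vgt_close hvD) => //; rewrite vy0.
  rewrite vy0 in vy.
  have yu i : y ^+ i \is a GRing.unit by rewrite unitrX // hdiv.
  have [w [wC wO hw]] := exists_trace1 hp hn hK hv hdiv hc hL hS pm pt yC yn0 vy.
  (* With this [h] the differential of [y ^ p] is the trace sum of [w] times [d], because [d]
     commutes with [y]. *)
  pose eta := d * y ^- p.-1; pose h := w * eta.
  have hC : h \in 'C(L)%AS.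
    have etaC : eta \in 'C(L)%AS.
      apply: memvM => //; rewrite memvV; apply: memvX => //; exact: (cent1 hL).
    exact: memvM.
  have heta : vge v (v d - (p%:R - 1) * s) eta.
    right; rewrite (valuationM hv.1) ?invr_eq0 ?(exp_neq0 hvD) // (vV hvD) ?(exp_neq0 hvD) //.
    by rewrite (vX hvD) // vy -p1Q mulr_natl lexx.
  have hh : vge v (v d - (p%:R - 1) * s) h by rewrite -[X in vge _ X _]add0r; apply: (vgeM hvD).
  exists h; split=> //.
  rewrite /dscalar_poly big_ord_recr /= Bp scale1r -addrA; apply: (vgtD hvD).
    apply: (vgt_sum hvD) => j _; case: (posnP j) => [->|j0]; first by rewrite B0 scale0r; left.
    have hj := hBj j; rewrite j0 ltn_ord in hj.
    apply: (vgt_le _ (vgtZ (hj isT) (vge_dpow hv hdiv j (vge_refl v y) hh))).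
    rewrite vy; lra.
  have -> : dpow p y h - d = (\sum_(l < p) y ^+ l * w * y ^- l - 1) * d.
    rewrite mulrBl mul1r mulr_suml; congr (_ - _); apply: eq_bigr => l _.
    rewrite /h /eta -!mulrA; congr (_ * (_ * _)).
    have -> : y ^+ p.-1 = y ^+ (p - l.+1) * y ^+ l.
      by rewrite -exprD -[in LHS](subnK (ltn_ord l)) addnS.
    rewrite invrM // -mulrA mulVr // mulr1.
    by apply: commrV; apply: commrX.
  by rewrite -[v d]add0r; apply: (vgtMr hvD) => //; apply: vge_refl.
have aC : {in 'C(L)%AS, forall y, a * y = y * a}.
  by move=> y yC; rewrite (cent_comm yC aL).
have em0 : (0 < e * m)%N by rewrite muln_gt0 e0.
have y0s : vge v s y0 by right; rewrite vy0.
have [y [yS _ hy]] := hensel hp hK hv hdiv hB em0 (struct_cval hS) (cent1 hL) (sub_cent hL aL)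
  aC y0C y0s hF lin.
by exists y.
Qed.

End PrimeRoots.

(** * Roots of prime degree in the centraliser *)

Section CentraliserRoots.
Variables (p n : nat) (K : fieldType) (vp : K -> rat) (D : falgType K) (v : D -> rat).
Hypotheses (hp : prime p) (hn : (0 < n)%N) (hK : is_padic_field p vp).
Hypotheses (hv : extends_valuation vp v) (hdiv : is_division D).
Variables (W : {aspace D}) (om g : D).
Hypothesis hc : Dn_coordinates p n v W om g.
Variables (L : {aspace D}) (e f m : nat).
Hypotheses (hL : is_subfield L) (hS : subfield_structure p n v om L e f m).

Let hvK := padic_valued hK.
Let hvD := division_valued hv hdiv.
Let p0 : (0 < p)%N := prime_gt0 hp.
Let p1 : (1 < p)%N := prime_gt1 hp.
Let e0 : (0 < e)%N. Proof. by case: (struct_gt0 hn hS). Qed.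
Let m0 : (0 < m)%N. Proof. by case: (struct_gt0 hn hS). Qed.
Let em0 : (0 < e * m)%N. Proof. by rewrite muln_gt0 e0. Qed.
Let e0Q : 0 < e%:R :> rat. Proof. by rewrite ltr0n. Qed.
Local Notation sp := (@scalar_poly K D p (one_plus_power p K)).
Let s1 : rat := (p.-1)%:R^-1.

Let p1Q : (p.-1)%:R = p%:R - 1 :> rat. Proof. by rewrite -subn1 natrB. Qed.
Let s1_gt0 : 0 < s1. Proof. by rewrite invr_gt0 ltr0n -subn1 subn_gt0. Qed.
Let ps1 : (p%:R - 1) * s1 = 1.
Proof. by rewrite -p1Q /s1 mulfV // gt_eqF // ltr0n -subn1 subn_gt0. Qed.
Let pQ : 2 <= p%:R :> rat. Proof. by rewrite (ler_nat _ 2). Qed.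

Let spE y : sp y - y ^+ p = \sum_(j < p) one_plus_power p K j *: y ^+ j.
Proof.
rewrite /scalar_poly big_ord_recr /= {2}/one_plus_power gtn_eqF // binn scale1r.
by rewrite addrK.
Qed.

Lemma vge_sp_rest y s : 0 <= s -> vge v s y -> vge v (1 + s) (sp y - y ^+ p).
Proof.
move=> s0 hy; rewrite spE; apply: (vge_sum hvD) => j _.
case: (posnP j) => [->|j0]; first by rewrite /one_plus_power eqxx scale0r; left.
have hj := @vge_one_plus_power p K vp hp hK j; rewrite j0 ltn_ord in hj.
apply: vge_le (vgeZ hv (hj isT) (vgeX hvD j hy)).
rewrite lerD2l -mulr_natl ler_peMl // ler1n //.
Qed.

Lemma vge_sp_rest2 y s : 0 <= s -> vge v s y -> vge v (1 + 2 * s) (sp y - y ^+ p - p%:R *: y).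
Proof.
move=> s0 hy; rewrite spE (bigD1 (Ordinal p1)) //= {1}/one_plus_power /= bin1 expr1 addrAC subrr add0r.
apply: (vge_sum hvD) => j hj1.
case: (posnP j) => [->|j0]; first by rewrite /one_plus_power eqxx scale0r; left.
have hj := @vge_one_plus_power p K vp hp hK j; rewrite j0 ltn_ord in hj.
apply: vge_le (vgeZ hv (hj isT) (vgeX hvD j hy)).
rewrite lerD2l -[s *+ j]mulr_natl ler_wpM2r // (ler_nat _ 2).
by rewrite ltn_neqAle j0 andbT eq_sym; apply: contra hj1 => /eqP ej; apply/eqP/val_inj.
Qed.

Let L_int x : x \in L -> x != 0 -> exists z : int, v x = z%:~R / e%:R := @struct_val _ _ _ _ _ _ _ _ _ _ hS x.

Let vgt_succ x r (k : nat) (z : int) : x \in L -> r = z%:~R / e%:R ->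
  vgt v (r + k%:R / e%:R) x -> vge v (r + k.+1%:R / e%:R) x.
Proof.
move=> xL re h; have [->|x0] := eqVneq x 0; first by left.
have := vgt_val x0 h; have [z' hz'] := L_int xL x0; rewrite re hz' -!mulrDl => h'.
right; rewrite hz'; move: h'; rewrite ltr_pM2r ?invr_gt0 // ler_pM2r ?invr_gt0 //.
have -> : z%:~R + k%:R = (z + k%:Z)%:~R :> rat by rewrite intrD.
have -> : z%:~R + k.+1%:R = (z + k.+1%:Z)%:~R :> rat by rewrite intrD.
by rewrite ltr_int ler_int; lia.
Qed.

Let cent_int x : x \in 'C(L)%AS -> x != 0 -> exists z : int, v x = z%:~R / (e * m)%:R.
Proof. exact: (struct_cval hS). Qed.

Let cent_commL a : a \in L -> {in 'C(L)%AS, forall y, a * y = y * a}.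
Proof. by move=> aL y yC; rewrite (cent_comm yC aL). Qed.

Lemma tame_root q a t : prime q -> (q %| m)%N -> q != p -> a \in L -> a != 0 ->
  v a = t%:R / e%:R -> exists2 x, x \in 'C(L)%VS & x ^+ q = a.
Proof.
move=> hq qm qp aL a0 va.
have [y [yC y0 qv hy]] : exists y, [/\ y \in 'C(L)%VS, y != 0, q%:R * v y = v a & vgt v (v a) (y ^+ q - a)].
  have [/dvdnP[t' et]|qt] := boolP (q %| t)%N.
    apply: (cent_leading_root hp hn hv hdiv hc hL hS (z := t'%:Z) hq qm qp aL a0).
    by rewrite va et mulnC -PoszM.
  have [y [yC y0 _ h1 h2]] := ramified_leading_root hp hn hv hdiv hc hL hS hq qm aL a0 va qt.
  by exists y.
have pq : ~~ (p %| q)%N by rewrite dvdn_prime2 // eq_sym.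
rewrite -qv in hy.
have [x [xC _ hx]] := root_tame hp hK hv hdiv em0 cent_int (cent1 hL) (sub_cent hL aL)
  (cent_commL aL) yC y0 pq hy.
by exists x.
Qed.

(** When [p] divides [t], take [c] in [L] with [c ^ p] as near to [a] as possible and put
    [a = (1 + b) * c ^ p]. The level [beta = v b] is at most [p/(p - 1)], and optimality of [c]
    leaves only equations that can be solved in [C(L)]. *)
Lemma wild_root a t : (p %| m)%N -> a \in L -> a != 0 ->
  v a = t%:R / e%:R -> exists2 x, x \in 'C(L)%VS & x ^+ p = a.
Proof.
move=> pm aL a0 va.
have LX x i : x \in L -> x ^+ i \in L := memvX i (subfield1 hL).
have [/dvdnP[t' et]|pt] := boolP (p %| t)%N; last first.
  have [y [yC y0 vy qv hy]] := ramified_leading_root hp hn hv hdiv hc hL hS hp pm aL a0 va pt.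
  have [||||x xC hx] := ramified_root hp hn hK hv hdiv hc hL hS (B := pure_power K p) pm pt _ _ _ aL yC y0 vy _.
  - by rewrite /pure_power ltn_eqF.
  - by rewrite /pure_power eqxx.
  - by move=> j /andP[_ jp]; rewrite /pure_power ltn_eqF //; left.
  - by rewrite scalar_poly_pure -vy qv.
  by exists x => //; move: hx; rewrite scalar_poly_pure.
apply: contrapT => no.
have noL x : x \in L -> x ^+ p <> a by move=> xL hx; apply: no; exists x => //; apply: sub_cent.
have qQ : ~~ (p %| (p ^ f).-1)%N.
  have [_ f0 _] := struct_gt0 hn hS; exact: p_ndvd_N.
have va' : v a = (p%:Z * t'%:Z)%:~R / e%:R by rewrite va et mulnC -PoszM.
pose A k := exists2 c, c \in L & vge v (v a + k%:R / e%:R) (a - c ^+ p) /\ c != 0.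
have neq c : c \in L -> a - c ^+ p != 0.
  by move=> cL; apply/eqP => /eqP; rewrite subr_eq0 => /eqP h; apply: (noL c cL).
have vc c : c != 0 -> vgt v (v a) (a - c ^+ p) -> v (c ^+ p) = v a.
  by move=> c0 h; case: (vgt_close hvD a0 (vgtC hvD h)).
have kpos (k : nat) : (0 < k)%N -> 0 < k%:R / e%:R :> rat by move=> k0; rewrite divr_gt0 ?ltr0n.
have A1 : A 1%N.
  have [c [cL c0 _ hcc]] := field_leading_root hp hn hv hdiv hc hL hS hp qQ aL a0 va'.
  exists c => //; split=> //; apply: (vgt_succ (z := p%:Z * t'%:Z) (k := 0)) => //.
  - by rewrite rpredB ?LX.
  - by rewrite mul0r addr0; apply: (vgtC hvD).
(* Above [p/(p - 1)] Hensel's lemma started at 0 already gives a p-th root of [1 + b] inside [L]. *)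
have bnd k : A k -> (0 < k)%N -> k%:R / e%:R <= 1 + s1.
  move=> [c cL [hcc c0]] k0; rewrite leNgt; apply/negP => lt.
  have hgt : vgt v (v a) (a - c ^+ p) by apply: vge_gt hcc; rewrite ltrDl kpos.
  have cp0 : c ^+ p != 0 by rewrite (exp_neq0 hvD).
  pose b := (a - c ^+ p) * c ^- p.
  have bL : b \in L by rewrite memvM ?memvV ?rpredB ?LX.
  have [||y yL hy] := root_high_level hp hK hv hdiv (S := L) (M := e) (b := b) (y0 := 0) e0 L_int (subfield1 hL) bL _ (mem0v _) (vge0 v _) _.
  - by move=> y yL; apply: (subfieldC hL).
  - have -> : sp 0 = 0.
      rewrite /scalar_poly big1 // => j _; case: (posnP j) => [->|j0].
        by rewrite /one_plus_power eqxx scale0r.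
      by rewrite expr0n gtn_eqF // scaler0.
    rewrite sub0r; apply: (vgtN hvD); right.
    rewrite (valuationM hv.1) ?neq ?invr_eq0 // (vV hvD) // (vc c) //.
    apply: lt_le_trans lt _; have := vge_val (neq c cL) hcc; lra.
  apply: (noL ((1 + y) * c)); first by rewrite memvM // rpredD // (subfield1 hL).
  have y1L : 1 + y \in L by rewrite rpredD // (subfield1 hL).
  rewrite exprMn_comm; last exact: (subfieldC hL).
  by rewrite hy mulrDl mul1r /b mulrVK ?hdiv // addrC subrK.
have kbnd k : `[< (0 < k)%N /\ A k >] -> (k <= 2 * e)%N.
  move=> /asboolP[k0 Ak]; have := bnd k Ak k0; rewrite ler_pdivrMr // => h.
  have s1le : s1 <= 1 by have := ps1; have := pQ; have := s1_gt0; nra.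
  rewrite -(ler_nat rat) natrM; apply: le_trans h _; rewrite ler_wpM2r ?ler0n //; lra.
have ex : exists k, `[< (0 < k)%N /\ A k >] by exists 1%N; apply/asboolP.
case: (ex_maxnP ex kbnd) => k /asboolP[k0 Ak] kmax.
have [c cL [hcc c0]] := Ak.
have bd := bnd k Ak k0.
pose beta : rat := k%:R / e%:R.
have beta0 : 0 < beta := kpos k k0.
have hgt : vgt v (v a) (a - c ^+ p) by apply: vge_gt hcc; rewrite ltrDl.
have cp0 : c ^+ p != 0 by rewrite (exp_neq0 hvD).
have vcp := vc c c0 hgt.
have d0 := neq c cL.
have dL : a - c ^+ p \in L by rewrite rpredB ?LX.
have nA : ~ A k.+1.
  move=> h; have : (k.+1 <= k)%N by apply: kmax; apply/asboolP.
  by rewrite ltnn.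
have vd : v (a - c ^+ p) = v a + beta.
  apply/eqP; rewrite eq_le (vge_val d0 hcc) andbT leNgt; apply/negP => lt.
  apply: nA; exists c => //; split=> //.
  by apply: (vgt_succ (z := p%:Z * t'%:Z)) => //; right.
pose b := (a - c ^+ p) * c ^- p.
have bL : b \in L by rewrite memvM ?memvV ?LX.
have b0 : b != 0 by rewrite (mul_neq0 hvD) ?invr_eq0.
have vb : v b = beta.
  by rewrite (valuationM hv.1) ?invr_eq0 // (vV hvD) // vcp vd addrC addKr.
have lift y : y \in 'C(L)%VS -> (1 + y) ^+ p = 1 + b -> False.
  move=> yC hy; apply: no; exists ((1 + y) * c).
    by apply: memvM; [apply: rpredD => //; exact: (cent1 hL)|exact: sub_cent].
  rewrite exprMn_comm; last first.
    by rewrite /GRing.comm mulrDl mulrDr mulr1 mul1r (cent_comm yC cL).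
  by rewrite hy mulrDl mul1r /b mulrVK ?hdiv // addrC subrK.
(* Such a [y] would make [(1 + y) * c] a better choice than [c]. *)
have noimp y : y \in L -> ~ vgt v beta (sp y - b).
  move=> yL hy; apply: nA.
  have y1L : 1 + y \in L by rewrite rpredD // (subfield1 hL).
  have e1 : a - ((1 + y) * c) ^+ p = - (sp y - b) * c ^+ p.
    rewrite exprMn_comm; last exact: (subfieldC hL).
    rewrite (one_plus_powerE p) // opprB mulrBl {1}/b mulrVK ?hdiv // mulrDl mul1r.
    by rewrite opprD addrA.
  have h1 : vgt v (v a + beta) (a - ((1 + y) * c) ^+ p).
    rewrite e1 addrC -vcp; apply: (vgtMr hvD); [exact: (vgtN hvD)|exact: vge_refl].
  exists ((1 + y) * c); first by rewrite memvM.
  split; first by apply: (vgt_succ (z := p%:Z * t'%:Z)) => //; rewrite rpredB // LX // memvM.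
  apply/eqP => h0; move: h1; rewrite h0 expr0n gtn_eqF // subr0 => /(vgt_val a0).
  by rewrite ltNge lerDl ltW.
(* Below the critical level [(1 + y) ^ p - 1] has leading term [y ^ p] at [v y = beta / p]. If [p]
   divides [k], such a [y] exists in [L] and contradicts [noimp]; otherwise [b] has a ramified root
   in [C(L)]. *)
have [lt|ge] := ltP beta (1 + s1).
  have bp0 : 0 <= beta / p%:R by rewrite divr_ge0 ?ler0n // ltW.
  have small : (p%:R - 1) * (beta / p%:R) < 1.
    rewrite mulrA ltr_pdivrMr ?ltr0n // mul1r.
    by have := ps1; have := pQ; nra.
  have ltb : beta < 1 + beta / p%:R.
    have : p%:R * (beta / p%:R) = beta by rewrite mulrC divfK // gt_eqF // ltr0n.
    by move: small; lra.
  have [/dvdnP[k'' ek]|pk] := boolP (p %| k)%N.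
    have vb' : v b = (p%:Z * k''%:Z)%:~R / e%:R by rewrite vb /beta ek mulnC -PoszM.
    have [y [yL y0 pv hy]] := field_leading_root hp hn hv hdiv hc hL hS hp qQ bL b0 vb'.
    apply: (noimp y yL); rewrite -(subrK (y ^+ p) (sp y)) -addrA; apply: (vgtD hvD); last by rewrite -vb.
    have vyE : v y = beta / p%:R.
      by rewrite -vb -pv mulrC mulKf // gt_eqF // ltr0n.
    by apply: vge_gt (vge_sp_rest _ (vge_refl v y)); rewrite vyE.
  have [y [yC y0 vy pv hy]] := ramified_leading_root hp hn hv hdiv hc hL hS hp pm bL b0 vb pk.
  have vyE : v y = beta / p%:R.
    by rewrite -vb -pv mulrC mulKf // gt_eqF // ltr0n.
  have [||||x xC hx] := ramified_root hp hn hK hv hdiv hc hL hS (B := one_plus_power p K) pm pk _ _ _ bL yC y0 vy _.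
  - by [].
  - by rewrite /one_plus_power gtn_eqF // binn.
  - move=> j /andP[j0 jp]; apply: vge_gt (vge_one_plus_power hp hK _); last by rewrite j0.
    rewrite -vy vyE; apply: le_lt_trans small; rewrite ler_wpM2r //.
    by rewrite lerB // ler1n.
  - rewrite -vy pv -(subrK (y ^+ p) (sp y)) -addrA; apply: (vgtD hvD) => //.
    by apply: vge_gt (vge_sp_rest _ (vge_refl v y)); rewrite vyE ?vb.
  by apply: (lift x xC); rewrite (one_plus_powerE p) // hx.
have betaE : beta = 1 + s1 by apply/eqP; rewrite eq_le bd.
(* With [y = la * z] the equation [y ^ p + p * y = b] becomes [ga * z ^ p + z = 1], and [ga] is a
   unit exactly because [beta] is critical. *)
pose la := p%:R^-1 *: b.
have pK0 := natK_p_neq0 hp hK.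
have laL : la \in L by rewrite rpredZ.
have la0 : la != 0 by rewrite scaler_eq0 negb_or invr_eq0 pK0.
have vla : v la = s1.
  by rewrite (vZ hv) ?invr_eq0 // (vV hvK) // (vp_p hp hK) vb betaE addrA addNr add0r.
have lab : p%:R *: la = b by rewrite scalerA mulfV // scale1r.
pose ga := la ^+ p * b^-1.
have gaL : ga \in L by rewrite memvM ?memvV ?LX.
have ga0 : ga != 0 by rewrite (mul_neq0 hvD) ?invr_eq0 ?(exp_neq0 hvD).
have vga : v ga = 0.
  rewrite (valuationM hv.1) ?invr_eq0 ?(exp_neq0 hvD) // (vV hvD) // (vX hvD) // vla vb betaE.
  by rewrite -mulr_natl; have := ps1; lra.
have [z [zC zO hz]] := artin_schreier hp hn hK hv hdiv hc hS pm gaL ga0 vga.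
have y0O : vge v s1 (la * z) by rewrite -vla -[v la]addr0; apply: (vgeM hvD) => //; apply: vge_refl.
have bC : {in 'C(L)%AS, forall y, b * y = y * b} := cent_commL bL.
have [||y yC hy] := root_high_level hp hK hv hdiv (S := 'C(L)%AS) (M := (e * m)%N) (b := b) (y0 := la * z) em0 cent_int (cent1 hL) (sub_cent hL bL) bC _ y0O _; last exact: (lift y yC hy).
- by apply: memvM => //; apply: sub_cent.
- have e1 : (la * z) ^+ p + p%:R *: (la * z) - b = b * (ga * z ^+ p + z - 1).
    rewrite exprMn_comm; last by rewrite /GRing.comm (cent_comm zC laL).
    rewrite scalerAl lab mulrBr mulrDr mulr1 mulrA /ga.
    by rewrite mulrA (subfieldC hL bL (LX la p laL)) mulrK ?hdiv.
  have -> : sp (la * z) - b = (sp (la * z) - (la * z) ^+ p - p%:R *: (la * z)) +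
     ((la * z) ^+ p + p%:R *: (la * z) - b).
    by rewrite !addrA [sp _ - _ - _ + _]addrAC subrK subrK.
  apply: (vgtD hvD).
    by apply: vge_gt (vge_sp_rest2 (ltW s1_gt0) y0O); rewrite ltrD2l; rewrite mulr_natl mulr2n ltrDl.
  by rewrite e1 -betaE -vb -[v b]addr0; apply: (vgtM hvD) => //; apply: vge_refl.
Qed.

Theorem cent_prime_root q a : prime q -> (q %| m)%N -> a \in L -> a != 0 ->
  exists2 x, x \in 'C(L)%VS & x ^+ q = a.
Proof.
move=> hq qm aL a0; have [z hz] := L_int aL a0.
have q0 := prime_gt0 hq.
(* Multiplying [a] by the q-th power of [p ^ k] makes its value nonnegative, as the lemmas on roots
   ask. *)
pose k := `|z|%N; pose t := `|(z + (q * k * e)%N%:Z)%R|%N.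
have hk : (k <= q * k * e)%N by rewrite mulnAC leq_pmull // muln_gt0 q0 e0.
have tE : t%:Z = z + (q * k * e)%N%:Z.
  rewrite gez0_abs //; move: hk; rewrite -lez_nat; move: (q * k * e)%N => x.
  by rewrite /k abszE => h; have := lerNnormlW (lexx `|z|); lia.
have pK0 := natK_p_neq0 hp hK.
have pX0 i : (p%:R : K) ^+ i != 0 by rewrite expf_neq0.
pose a' := (p%:R ^+ (q * k)) *: a.
have a'L : a' \in L by rewrite rpredZ.
have a'0 : a' != 0 by rewrite scaler_eq0 negb_or pX0.
have va' : v a' = t%:R / e%:R.
  rewrite (vZ hv) // (vX hvK) // (vp_p hp hK) hz.
  have -> : (t%:R : rat) = (t%:Z)%:~R by [].
  by rewrite tE intrD mulrDl addrC PoszM intrM mulfK ?gt_eqF.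
have [x xC hx] : exists2 x, x \in 'C(L)%VS & x ^+ q = a'.
  have [qp|qp] := eqVneq q p; last exact: (tame_root hq qm qp a'L a'0 va').
  by rewrite qp; apply: (wild_root _ a'L a'0 va'); rewrite -qp.
exists ((p%:R ^+ k)^-1 *: x); first by rewrite rpredZ.
by rewrite exprZn hx scalerA exprVn -exprM mulnC mulVf // scale1r.
Qed.

End CentraliserRoots.

(** * Capelli's criterion *)

Lemma monic_is_char_poly (F : fieldType) (r : {poly F}) d : r \is monic -> size r = d.+2 ->
  exists M : 'M[F]_d.+1, char_poly M = r.
Proof.
move=> mon sz; move: (companionmx r) (companionmxK mon); rewrite sz /= => M hM.
by exists M.
Qed.

Lemma detXn (F : fieldType) d (M : 'M[F]_d.+1) k : \det (M ^+ k) = \det M ^+ k.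
Proof. by elim: k => [|k IH]; rewrite ?expr0 ?det1 // !exprS detM IH. Qed.

(* If [r] is a proper factor of [X ^ q - a], the norm of a root of [r] makes a power of [a] of
   exponent prime to [q] a q-th power. *)
Lemma coprime_XnsubC (F : fieldType) (q : nat) (a : F) (r : {poly F}) :
  prime q -> (forall b, b ^+ q <> a) -> r != 0 -> (size r <= q)%N -> coprimep r ('X^q - a%:P).
Proof.
move=> hq ha r0 sr; have q0 := prime_gt0 hq.
rewrite /coprimep; set h := gcdp r _; apply: contrapT => sh.
have h0 : h != 0 by rewrite gcdp_eq0 negb_and r0.
have hr : (size h <= q)%N by apply: leq_trans (dvdp_leq r0 (dvdp_gcdl _ _)) sr.
have hlc : lead_coef h != 0 by rewrite lead_coef_eq0.
pose h1 := (lead_coef h)^-1 *: h.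
have mon : h1 \is monic by rewrite monicE lead_coefZ mulVf.
have sh1 : size h1 = size h by rewrite size_scale ?invr_eq0.
have [d sd] : exists d, size h1 = d.+2.
  have : (0 < size h)%N by rewrite size_poly_gt0.
  by rewrite sh1; case: (size h) sh => [|[|d]] // _ _; exists d.
have [M hM] := monic_is_char_poly mon sd.
have /dvdpP[w hw] : h1 %| 'X^q - a%:P.
  by rewrite (eqp_dvdl _ (eqp_scale _ _)) ?invr_eq0 // dvdp_gcdr.
have MX : M ^+ q = a%:M.
  apply/eqP; rewrite -subr_eq0 -(horner_mx_C M) -[X in X ^+ q](horner_mx_X M) -rmorphXn -rmorphB hw.
  by rewrite rmorphM /= -hM Cayley_Hamilton mulr0.
have := congr1 determinant MX; rewrite detXn det_scalar => hdet.
have a0 : a != 0 by apply/eqP => a0; apply: (ha 0); rewrite expr0n gtn_eqF.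
have dq : (d.+1 < q)%N by rewrite -sd sh1.
have cop : coprime q d.+1 by rewrite prime_coprime // gtnNdvd.
case: (egcdnP q (ltn0Sn d)) => u w' e _.
have e' : (u * d.+1 = w' * q + 1)%N by rewrite e gcdnC; move: cop; rewrite /coprime => /eqP ->.
apply: (ha (\det M ^+ u / a ^+ w')).
rewrite expr_div_n -exprM mulnC exprM hdet -exprM [(d.+1 * u)%N]mulnC e' exprD expr1 exprM.
by rewrite mulrAC mulfV ?mul1r // !expf_neq0.
Qed.

(** Determinants are taken of the relation [b ^ q = s X] in the algebra of the companion matrix of
    [X ^ q - a], where [X] has norm [(-1) ^ (q + 1) * a]. *)
Lemma norm_root_XnsubC (F : fieldType) (q : nat) (a s : F) (b : {poly F}) :
  (0 < q)%N -> 'X^q - a%:P %| b ^+ q - s *: 'X ->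
  exists x, x ^+ q = s ^+ q * ((-1) ^+ q.+1 * a).
Proof.
case: q => // q _ /dvdpP[w hw].
have [M hM] := monic_is_char_poly (monicXnsubC a (ltn0Sn q)) (size_XnsubC a (ltn0Sn q)).
exists (\det (horner_mx M b)).
have e : horner_mx M b ^+ q.+1 = s *: M.
  apply/eqP; rewrite -subr_eq0 -[X in _ - s *: X](horner_mx_X M) -rmorphXn -linearZ -rmorphB hw.
  by rewrite rmorphM /= -hM Cayley_Hamilton mulr0.
rewrite -detXn e detZ; congr (_ * _).
have := char_poly_det M; rewrite hM coefB coefXn coefC /= sub0r => h.
have -> : \det M = ((-1) ^+ q.+1) ^+ 2 * \det M by rewrite sqrr_sign mul1r.
by rewrite expr2 -mulrA -h mulrN [in RHS]exprS mulN1r mulNr.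
Qed.

Section SimpleExtension.
Variables (F : fieldType) (A : nzRingType) (iota : {rmorphism F -> A}) (y : A).
Hypothesis cy : forall c, iota c * y = y * iota c.
Variables (q : nat) (a : F).
Hypotheses (hq : prime q) (ya : y ^+ q = iota a) (ha : forall b, b ^+ q <> a).

Let cy' : commr_rmorph iota y.
Proof. by move=> c; apply/esym/cy. Qed.

Let ev : {rmorphism {poly F} -> A} := horner_morph cy'.

Let evC c : ev c%:P = iota c. Proof. exact: horner_morphC. Qed.
Let evX : ev 'X = y. Proof. exact: horner_morphX. Qed.

Let ev_XnsubC : ev ('X^q - a%:P) = 0.
Proof. by rewrite rmorphB rmorphXn evX evC ya subrr. Qed.

Let ev_poly (c : 'I_q -> F) : ev (\sum_(j < q) c j *: 'X^j) = \sum_(j < q) iota (c j) * y ^+ j.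
Proof.
rewrite rmorph_sum; apply: eq_bigr => j _.
by rewrite -mul_polyC rmorphM evC rmorphXn evX.
Qed.

Let size_ev_poly (c : 'I_q -> F) : (size (\sum_(j < q) c j *: 'X^j)%R <= q)%N.
Proof.
apply: (leq_trans (size_sum _ _ _)); apply/bigmax_leqP => j _.
by apply: leq_trans (size_scale_leq _ _) _; rewrite size_polyXn.
Qed.

(** A nonzero [r] of degree below [q] is coprime to [X ^ q - a], so a Bezout relation evaluated at
    [y] would give a nonzero constant equal to 0. The ring [A] need only commute with [y] on the
    image of [F]. *)
Let ev_small (r : {poly F}) : (size r <= q)%N -> ev r = 0 -> r = 0.
Proof.
move=> sr hr; apply/eqP/negP => /negP r0.
have := coprime_XnsubC hq ha r0 sr => /Bezout_coprimepP[[u w] /=].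
move=> /eqpf_eq[c c0 huw].
have := congr1 ev huw; rewrite rmorphD !rmorphM hr ev_XnsubC !mulr0 addr0.
rewrite -mul_polyC mulr1 evC => /esym/eqP; rewrite fmorph_eq0 (negPf c0) //.
Qed.

Lemma simple_extension_free (c : 'I_q -> F) :
  \sum_(j < q) iota (c j) * y ^+ j = 0 -> forall j, c j = 0.
Proof.
rewrite -ev_poly => /(ev_small (size_ev_poly c)) h j.
have := congr1 (coefp j) h; rewrite /= coef0 coef_sum (bigD1 j) //= coefZ coefXn eqxx mulr1.
rewrite big1 ?addr0 // => i ij; rewrite coefZ coefXn.
by rewrite (_ : (j == i :> nat) = false) ?mulr0 //; apply/negbTE; rewrite eq_sym.
Qed.

Lemma simple_extension_norm (c : 'I_q -> F) s :
  (\sum_(j < q) iota (c j) * y ^+ j) ^+ q = iota s * y ->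
  exists b, b ^+ q = s ^+ q * ((-1) ^+ q.+1 * a).
Proof.
rewrite -ev_poly; set b := (\sum_(j < q) _) => h.
have q0 := prime_gt0 hq.
apply: (norm_root_XnsubC (b := b) q0); rewrite /dvdp; apply/eqP/ev_small.
  have := ltn_modp (b ^+ q - s *: 'X) ('X^q - a%:P).
  by rewrite -size_poly_gt0 size_XnsubC // ltnS => ->.
have := congr1 ev (divp_eq (b ^+ q - s *: 'X) ('X^q - a%:P)).
rewrite [RHS]rmorphD [X in _ = X + _]rmorphM ev_XnsubC mulr0 add0r => <-.
have es : ev (s *: 'X) = iota s * y by rewrite -mul_polyC rmorphM evC evX.
by rewrite rmorphB rmorphXn es -/b h subrr.
Qed.

End SimpleExtension.

Lemma agenv_sub (K : fieldType) (D : falgType K) (A : {aspace D}) (U : {vspace D}) :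
  1 \in A -> (U <= A)%VS -> (agenv U <= A)%VS.
Proof. by move=> A1 UA; apply: agenv_sub_modl (prodv_sub UA (subvv _)); rewrite -memvE. Qed.

(** A centraliser is a subalgebra, so commutation passes from generators to the generated algebra,
    once on each side. *)
Lemma agenv_is_subfield (K : fieldType) (D : falgType K) (U : {vspace D}) :
  is_division D -> (U <= 'C(U))%VS -> is_subfield (agenv_aspace U).
Proof.
move=> hdiv cU; split=> //; first by rewrite memvE sub1_agenv.
have C1 (W : {vspace D}) : 1 \in 'C(W)%VS by apply/centvP=> w _; rewrite mul1r mulr1.
have h := centvsP (agenv_sub (C1 _) cU).
have /centvsP k : (agenv U <= 'C(agenv U))%VS.
  by apply: agenv_sub (C1 _) _; apply/centvsP => x y xU yU; rewrite (h y x yU xU).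
exact: k.
Qed.

Section PrimeRootExtension.
Variables (K : fieldType) (D : falgType K) (L : {aspace D}) (hL : is_subfield L) (y : D).
Hypothesis yC : y \in 'C(L)%VS.

Lemma adjoin_is_subfield : is_subfield <<L; y>>%AS.
Proof.
apply: (agenv_is_subfield (subfield_division hL)).
apply/centvsP => _ _ /memv_addP[b bL [_ /vlineP[k ->] ->]] /memv_addP[c cL [_ /vlineP[l ->] ->]].
have cy x : x \in L -> y * x = x * y by move/centvP: yC; exact.
rewrite !mulrDl !mulrDr (subfieldC hL bL cL) -!scalerAl -!scalerAr -!(cy _ bL) -!(cy _ cL).
by rewrite !scalerA [l * k]mulrC addrACA.
Qed.

Lemma adjoin_sub : (L <= <<L; y>>%AS)%VS.
Proof. exact: subv_trans (addvSl _ _) (sub_agenv _). Qed.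

Lemma adjoin_mem : y \in <<L; y>>%AS.
Proof. by rewrite memvE; apply: subv_trans (addvSr _ _) (sub_agenv _). Qed.

Variables (q : nat) (a : D).
Hypotheses (hq : prime q) (aL : a \in L) (ya : y ^+ q = a).

Let U := (\sum_(j < q) L * <[y ^+ j]>)%VS.

Let UP z : reflect (exists2 l : 'I_q -> D, forall j, l j \in L & z = \sum_j l j * y ^+ j) (z \in U).
Proof.
apply: (iffP memv_sumP) => [[w hw ->]|[l hl ->]].
  have ex j : exists l, l \in L /\ w j = l * y ^+ j.
    by have /memv_cosetP[l lL e] := hw j isT; exists l.
  have [l hl] := choice ex.
  by exists l => [j|]; [exact: (hl j).1 | apply: eq_bigr => j _; exact: (hl j).2].
by exists (fun j => l j * y ^+ j) => // j _; apply/memv_cosetP; exists (l j).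
Qed.

Let U_agenv : (<<L; y>>%AS = U :> {vspace D})%VS.
Proof.
have q0 := prime_gt0 hq.
apply/eqP; rewrite eqEsubv; apply/andP; split.
  apply: agenv_sub_modl.
    rewrite -memvE; apply/UP; exists (fun j : 'I_q => ((j : nat) == 0%N)%:R).
      by move=> j; case: (_ == _); rewrite ?mem0v ?(subfield1 hL).
    rewrite (bigD1 (Ordinal q0)) //= mul1r expr0 big1 ?addr0 // => j j0.
    suff -> : (j == 0 :> nat)%N = false by rewrite mul0r.
    by apply/negbTE; apply: contra j0 => /eqP j0; apply/eqP/val_inj.
  apply/prodvP => _ z /memv_addP[b bL [_ /vlineP[k ->] ->]] /UP[l hl ->].
  rewrite mulrDl mulr_sumr -scalerAl; apply: memvD.
    by apply/UP; exists (fun j => b * l j) => [j|]; rewrite ?memvM //; apply: eq_bigr => j _; rewrite mulrA.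
  apply: memvZ; rewrite mulr_sumr; apply: memv_suml => j _.
  rewrite mulrA (centvP yC _ (hl j)) -mulrA -exprS.
  have [jq|jq] := ltnP j.+1 q.
    rewrite memvE; apply: subv_trans (sumv_sup (Ordinal jq) _ (subvv _)) => //.
    by rewrite -memvE; apply/memv_cosetP; exists (l j).
  have -> : j.+1 = q by apply/eqP; rewrite eqn_leq ltn_ord jq.
  rewrite memvE; apply: subv_trans (sumv_sup (Ordinal q0) _ (subvv _)) => //.
  by rewrite -memvE; apply/memv_cosetP; exists (l j * a); rewrite ?memvM // ya expr0 mulr1.
apply/subvP => z /UP[l hl ->]; apply: memv_suml => j _.
apply: memvM; first exact: (subvP adjoin_sub).
apply: memvX adjoin_mem; exact: (subfield1 adjoin_is_subfield).
Qed.

Lemma adjoin_rootP z : z \in <<L; y>>%AS ->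
  exists2 l : 'I_q -> D, forall j, l j \in L & z = \sum_j l j * y ^+ j.
Proof. by rewrite U_agenv => /UP. Qed.

Hypothesis ha : forall b, b \in L -> b ^+ q <> a.

Let a' := subfield_sub hL aL.

Let ya' : y ^+ q = subfield_val a'. Proof. exact: ya. Qed.

Let cy (c : subfield_type hL) : subfield_val c * y = y * subfield_val c.
Proof. by rewrite (centvP yC _ (subfield_valP c)). Qed.

Let ha' (b : subfield_type hL) : b ^+ q <> a'.
Proof.
move=> h; apply: (ha (subfield_valP b)); rewrite -subfield_valX h; exact: subfield_subK.
Qed.

Lemma dim_adjoin_root : (\dim <<L; y>>%AS = q * \dim L)%N.
Proof.
have y0 : y != 0.
  apply/eqP => y0; apply: (ha (mem0v L)).
  by rewrite -ya y0.
have yu : y \is a GRing.unit by apply: (subfield_division hL).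
rewrite U_agenv; have /directvP -> : directv (\sum_(j < q) L * <[y ^+ j]>)%VS.
  apply/directv_sum_independent => w hw w0 j _.
  have ex i : exists l : subfield_type hL, w i = subfield_val l * y ^+ i.
    by have /memv_cosetP[l lL e] := hw i isT; exists (subfield_sub hL lL).
  have [l hl] := choice ex.
  rewrite hl (@simple_extension_free _ _ (@subfield_val K D L hL) y cy q a' hq ya' ha' l _ j).
    by rewrite subfield_val0 mul0r.
  by apply: etrans w0; apply: eq_bigr => i _; rewrite hl.
transitivity (\sum_(j < q) \dim L)%N; last by rewrite sum_nat_const card_ord.
by apply: eq_bigr => j _; apply: dim_cosetv_unit; rewrite unitrX.
Qed.

Lemma norm_adjoin_root z s : z \in <<L; y>>%AS -> s \in L -> z ^+ q = s * y ->
  exists2 b, b \in L & b ^+ q = s ^+ q * ((-1) ^+ q.+1 * a).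
Proof.
move=> zU sL; have /UP[l hl ->] : z \in U by rewrite -U_agenv.
move=> h; pose l' j := subfield_sub hL (hl j).
have [b hb] := @simple_extension_norm _ _ (@subfield_val K D L hL) y cy q a' hq ya' ha' l'
  (subfield_sub hL sL) h.
exists (subfield_val b); first exact: subfield_valP.
rewrite -subfield_valX hb !subfield_valM !subfield_valX subfield_subK; congr (_ * (_ ^+ _ * _)).
by rewrite -[-1 in LHS]sub0r subfield_valB subfield_val0 subfield_val_1 sub0r.
Qed.

End PrimeRootExtension.

(** * Roots of arbitrary degree, and degrees of radical extensions *)

Section Roots.
Variables (p n : nat) (K : fieldType) (vp : K -> rat) (D : falgType K) (v : D -> rat).
Hypotheses (hp : prime p) (hn : (0 < n)%N) (hK : is_padic_field p vp).
Hypotheses (hv : extends_valuation vp v) (hdiv : is_division D) (dimD : \dim {:D} = (n ^ 2)%N).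
Variables (W : {aspace D}) (om g : D).
Hypothesis hc : Dn_coordinates p n v W om g.

Lemma subfield_dim_dvd (L : {aspace D}) : is_subfield L -> (\dim L %| n)%N.
Proof.
move=> hL; have [e [f [m hS]]] := exists_subfield_structure hp hn hK hv hdiv hc hL dimD.
by rewrite (struct_dim hS) (struct_n hS) dvdn_mulr.
Qed.

(** Let [q] be a prime factor of [r]. If [a = b ^ q] in [L], continue with [b] and [r / q].
    Otherwise adjoin a q-th root [y] from [C(L)]: [dim L] is multiplied by [q], so the product with
    [r / q] is unchanged. *)
Lemma cent_root (r : nat) (L : {aspace D}) a : is_subfield L -> (0 < r)%N ->
  (r * \dim L %| n)%N -> a \in L -> a != 0 -> exists2 x, x \in 'C(L)%VS & x ^+ r = a.
Proof.
elim/ltn_ind: r L a => r IH L a hL r0 hr aL a0.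
have [r1|r1] := leqP r 1.
  have -> : r = 1%N by apply/eqP; rewrite eqn_leq r1.
  by exists a; rewrite ?expr1 ?(sub_cent hL).
pose q := pdiv r; have hq : prime q := pdiv_prime r1.
have er : r = (r %/ q * q)%N by rewrite divnK // pdiv_dvd.
set r' := (r %/ q)%N in er.
have r'0 : (0 < r')%N by move: r0; rewrite er muln_gt0 => /andP[].
have r'r : (r' < r)%N by rewrite er ltn_Pmulr ?prime_gt1.
have [[b bL hb]|nb] := pselect (exists2 b, b \in L & b ^+ q = a).
  have b0 : b != 0.
    by apply: contraNneq a0 => b0; rewrite -hb b0 expr0n gtn_eqF ?prime_gt0.
  have hr' : (r' * \dim L %| n)%N by apply: dvdn_trans hr; rewrite dvdn_pmul2r ?adim_gt0 // er dvdn_mulr.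
  have [x xC hx] := IH r' r'r L b hL r'0 hr' bL b0.
  by exists x; rewrite // er exprM hx.
have [e [f [m hS]]] := exists_subfield_structure hp hn hK hv hdiv hc hL dimD.
have qm : (q %| m)%N.
  have d0 : (0 < e * f)%N by rewrite -(struct_dim hS) adim_gt0.
  rewrite -(dvdn_pmul2l d0) -(struct_n hS) -(struct_dim hS) mulnC.
  by apply: dvdn_trans hr; rewrite dvdn_pmul2r ?adim_gt0 // er dvdn_mull.
have [y yC hy] := cent_prime_root hp hn hK hv hdiv hc hL hS hq qm aL a0.
have hb b : b \in L -> b ^+ q <> a by move=> bL h; apply: nb; exists b.
have hL' := adjoin_is_subfield hL yC.
have hr' : (r' * \dim <<L; y>>%AS %| n)%N by rewrite (dim_adjoin_root hL yC hq aL hy hb) mulnA -er.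
have y0 : y != 0.
  by apply: contraNneq a0 => y0; rewrite -hy y0 expr0n gtn_eqF ?prime_gt0.
have [x xC hx] := IH r' r'r _ y hL' r'0 hr' (adjoin_mem L y) y0.
exists x; last by rewrite er exprM hx.
by apply/centvP => z zL; apply: (centvP xC); apply: (subvP (adjoin_sub L y)).
Qed.

Lemma cent_adjoin (L : {aspace D}) x y : x \in 'C(L)%VS -> x * y = y * x -> x \in 'C(<<L; y>>)%VS.
Proof.
move=> xC xy.
have h : (<<L; y>>%AS <= 'C[x])%VS.
  apply: agenv_sub; first by apply/cent1vP; rewrite mul1r mulr1.
  rewrite subv_add; apply/andP; split.
    by apply/subvP => z zL; apply/cent1vP/esym; apply: (centvP xC).
  by rewrite -memvE; apply/cent1vP.
by apply/centvP => z /(subvP h)/cent1vP.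
Qed.

(* Capelli's criterion for the irreducibility of [X ^ (q ^ c) - a], away from its exceptional case. *)
Lemma root_degree (q c : nat) (L : {aspace D}) x a : prime q -> is_subfield L -> x \in 'C(L)%VS ->
  a \in L -> x ^+ (q ^ c) = a -> (forall b, b \in L -> b ^+ q <> a) ->
  (q = 2%N -> (1 < c)%N -> forall b, b \in L -> b ^+ 2 <> - a) -> (q ^ c * \dim L %| n)%N.
Proof.
move=> hq; elim: c L a => [|c IH] L a hL xC aL hx ha ha2.
  by rewrite expn0 mul1n subfield_dim_dvd.
pose y := x ^+ (q ^ c).
have hy : y ^+ q = a by rewrite -hx expnSr exprM.
have yC : y \in 'C(L)%VS by apply: centvX.
have hL' := adjoin_is_subfield hL yC.
have xC' : x \in 'C(<<L; y>>)%VS by apply: cent_adjoin => //; rewrite -exprS -exprSr.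
rewrite expnSr -mulnA -(dim_adjoin_root hL yC hq aL hy ha).
case: c IH @y hx ha2 hy yC hL' xC' => [|c] IH y hx ha2 hy yC hL' xC'.
  by rewrite expn0 mul1n subfield_dim_dvd.
(* The cases [s = 1] and [s = -1] are the two hypotheses of the next step. For [q = 2] the norm of
   [y] is [- a], which is where [ha2] enters. *)
have hN z s : s \in L -> s ^+ q = 1 -> z \in <<L; y>>%AS -> z ^+ q <> s * y.
  move=> sL s2 zL' hz.
  have [b bL] := norm_adjoin_root hL yC hq aL hy ha zL' sL hz.
  rewrite s2 mul1r -signr_odd /=.
  have [q2|q2] := eqVneq q 2%N.
    by rewrite q2 expr1 mulN1r => hb; apply: (ha2 q2 isT b bL).
  have oq : odd q by apply: contraNT q2 => eq; rewrite eq_sym -dvdn_prime2 // dvdn2.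
  by rewrite oq /= expr0 mul1r; apply: ha.
apply: (IH _ y hL' xC' (adjoin_mem L y) erefl).
  by move=> b bL'; rewrite -[y]mul1r; apply: hN; rewrite ?expr1n ?(subfield1 hL).
move=> q2 _ b bL'; rewrite -mulN1r -q2; apply: hN; rewrite ?q2 ?sqrrN ?expr1n //.
by rewrite rpredN (subfield1 hL).
Qed.
End Roots.

(** * Finite groups in fields, and square roots of -1 *)

Lemma finite_subgroup_unity_root (F : fieldType) (rs : seq F) : uniq rs -> 0 \notin rs ->
  {in rs &, forall x y, x * y \in rs} -> {in rs, forall x, x ^+ size rs = 1}.
Proof.
move=> urs n0 mrs x xrs; have x0 : x != 0 by apply: contraNneq n0 => <-.
have um : uniq (map ( *%R x) rs) by rewrite map_inj_uniq //; apply: mulfI.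
have sub : {subset map ( *%R x) rs <= rs} by move=> _ /mapP[y yrs ->]; apply: mrs.
have /(_ _)[|_ e] := uniq_min_size um sub; first by rewrite size_map.
have hp : perm_eq (map ( *%R x) rs) rs by apply: uniq_perm.
have : \prod_(y <- map ( *%R x) rs) y = \prod_(y <- rs) y by apply: perm_big.
rewrite big_map big_split /= big_const_seq count_predT.
rewrite -[X in _ = X]mul1r => /mulIf; rewrite iter_mulr_1; apply.
by rewrite prodf_seq_neq0; apply/allP => y yrs /=; apply: contraNneq n0 => <-.
Qed.

Lemma finite_subgroup_prim_root (F : fieldType) (rs : seq F) : uniq rs -> 0 \notin rs -> 1 \in rs ->
  {in rs &, forall x y, x * y \in rs} -> exists2 z, z \in rs & (size rs).-primitive_root z.
Proof.
move=> urs n0 i1 mrs; apply/hasP; apply: has_prim_root => //.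
  by case: rs i1 {urs n0 mrs}.
by apply/allP => x xrs; apply/unity_rootP/finite_subgroup_unity_root.
Qed.

Section ConjugateSquareRoots.
Variables (K E : fieldType) (iota : {rmorphism K -> E}) (N : nat) (z : E).
Hypothesis hz : N.-primitive_root z.

Let ev (f : {poly K}) := (map_poly iota f).[z].

Let N0 : (0 < N)%N. Proof. exact: prim_order_gt0 hz. Qed.

Let exists_min : exists M : {poly K}, [/\ M != 0, ev M = 0 & forall f, ev f = 0 -> M %| f].
Proof.
pose P k := `[< exists M : {poly K}, [/\ M != 0, ev M = 0 & size M = k] >].
have exP : exists k, P k.
  exists N.+1; apply/asboolP; exists ('X^N - 1%:P); split.
  - by rewrite -size_poly_gt0 size_XnsubC.
  - by rewrite /ev rmorphB rmorphXn /= map_polyX map_polyC /= rmorph1 !hornerE prim_expr_order // subrr.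
  - by rewrite size_XnsubC.
case: (ex_minnP exP) => k /asboolP[M [M0 hM sM]] mink; exists M; split=> // f hf.
apply: contrapT => nd; have r0 : f %% M != 0 by apply/eqP => /eqP.
have er : ev (f %% M) = 0.
  move: hf; rewrite {1}(divp_eq f M) /ev rmorphD rmorphM !hornerE -/(ev M) hM mulr0 add0r.
  exact.
have : (k <= size (f %% M)%R)%N by apply: mink; apply/asboolP; exists (f %% M).
by rewrite leqNgt -sM ltn_modp M0.
Qed.

(* The roots of the minimal polynomial of [z] are powers of [z]; if [d = R(z)] and [d ^ 2] is not in [K], then
   at one of these roots [R ^ 2] takes the other square root [- d ^ 2] of [d ^ 4]. *)
Lemma prim_root_sqrtN1 (R : {poly K}) c : ev R ^+ 4 = iota c ->
  (forall k, ev R ^+ 2 <> iota k) -> exists i : E, i ^+ 2 = -1.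
Proof.
set d := ev R => d4 d2.
have d0 : d != 0 by apply/eqP => d0; apply: (d2 0); rewrite d0 expr0n rmorph0.
have [M [M0 hM Mmin]] := exists_min.
have evB f g : ev (f - g) = ev f - ev g by rewrite /ev rmorphB !hornerE.
have evX f k : ev (f ^+ k) = ev f ^+ k by rewrite /ev rmorphXn horner_exp.
have evC k : ev k%:P = iota k by rewrite /ev map_polyC hornerC.
have MX : map_poly iota M %| \prod_(i <- index_iota 0 N) ('X - (z ^+ i)%:P).
  rewrite (factor_Xn_sub_1 hz); have -> : 'X^N - 1 = map_poly iota ('X^N - 1%:P).
    by rewrite rmorphB rmorphXn /= map_polyX map_polyC /= rmorph1.
  rewrite dvdp_map; apply: Mmin.
  by rewrite evB evX evC rmorph1 /ev map_polyX hornerX prim_expr_order // subrr.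
rewrite -(big_map (fun i => z ^+ i) xpredT (fun x => 'X - x%:P)) in MX.
have [m hm] := dvdp_prod_XsubC MX; set rs := mask m _ in hm.
have urs : uniq rs.
  rewrite mask_uniq // map_inj_in_uniq ?iota_uniq // => i j.
  rewrite !mem_index_iota => /andP[_ iN] /andP[_ jN] /eqP.
  by rewrite (eq_prim_root_expr hz) !modn_small // => /eqP.
have sM : size M = (size rs).+1.
  by rewrite -(size_map_poly iota) (eqp_size hm) size_prod_XsubC.
have rM w : w \in rs -> root (map_poly iota M) w by rewrite (eqp_root hm) root_prod_XsubC.
have rD w f : w \in rs -> M %| f -> root (map_poly iota f) w.
  by rewrite -dvdp_XsubCl => /rM; rewrite -dvdp_XsubCl => h hf; apply: dvdp_trans h _; rewrite dvdp_map.
have [[w wrs hw]|nw] := pselect (exists2 w, w \in rs & (map_poly iota R).[w] ^+ 2 = - d ^+ 2).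
  by exists ((map_poly iota R).[w] / d); rewrite expr_div_n hw mulNr mulfV // expf_neq0.
have hw w : w \in rs -> (map_poly iota R).[w] ^+ 2 = d ^+ 2.
  move=> wrs; have /(rD w _ wrs) : M %| R ^+ 4 - c%:P by apply: Mmin; rewrite evB evX evC d4 subrr.
  rewrite /root rmorphB rmorphXn /= map_polyC !hornerE => /eqP/subr0_eq h.
  have {}h : (map_poly iota R).[w] ^+ 4 = d ^+ 4 by rewrite d4; exact: h.
  move/eqP: h; rewrite -[4%N]/(2 * 2)%N !exprM -subr_eq0 subr_sqr mulf_eq0 subr_eq0 addr_eq0.
  case/orP=> /eqP // h.
  by case: nw; exists w.
(* [P - d ^ 2] vanishes at all roots of [M], which are distinct, and its degree is smaller: so [P]
   is the constant [d ^ 2], and [d ^ 2] lies in [K]. *)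
pose P := (R ^+ 2) %% M.
have eP : map_poly iota P = (d ^+ 2)%:P.
  apply/eqP; rewrite -subr_eq0; apply/negPn/negP => h.
  have : (size rs < size (map_poly iota P - (d ^+ 2)%:P)%R)%N.
    apply: max_poly_roots h _ urs; apply/allP => w wrs.
    have /(rD w _ wrs) : M %| R ^+ 2 - P by rewrite /P {1}(divp_eq (R ^+ 2) M) addrK dvdp_mull.
    rewrite /root rmorphB rmorphXn !hornerE hw // => /eqP/subr0_eq ->.
    by rewrite subrr.
  apply/negP; rewrite -leqNgt; apply: leq_trans (size_polyD _ _) _.
  rewrite size_polyN size_map_poly geq_max -ltnS -sM ltn_modp M0 /=; apply: leq_trans (size_polyC_leq1 _) _.
  rewrite lt0n size_eq0; apply: contraTN isT => /eqP rs0.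
  have : size M = 1%N by rewrite sM rs0.
  move/eqP/size_poly1P => [k k0 Mk]; move: hM; rewrite Mk evC => /eqP.
  by rewrite fmorph_eq0 (negPf k0).
case: (d2 (P`_0)); rewrite -evX.
have := congr1 (coefp 0) eP; rewrite /= coef_map coefC /= => ->; exact: evX.
Qed.

End ConjugateSquareRoots.

Local Open Scope classical_set_scope.
Local Open Scope ring_scope.

(** * The field generated by a finite abelian group *)

Section AdjoinAbelian.
Variables (K : fieldType) (D : falgType K) (F0 : seq D).
Hypotheses (hdiv : is_division D) (F0C : {in F0 &, forall x y, x * y = y * x}).

Lemma adjoin_is_subfield_seq : is_subfield (adjoin F0).
Proof.
apply: agenv_is_subfield hdiv _.
have in1C (V : {vspace D}) : 1 \in 'C(V)%VS by apply/centvP => w _; rewrite mul1r mulr1.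
have fC f : f \in F0 -> (1 + <<F0>> <= 'C[f])%VS.
  move=> fF; rewrite subv_add -memvE; apply/andP; split.
    by apply/cent1vP; rewrite mul1r mulr1.
  by apply/span_subvP => g gF; apply/cent1vP; apply: F0C.
rewrite subv_add -memvE in1C; apply/span_subvP => f fF; apply/centvP => w wU.
by apply/esym/cent1vP; apply: (subvP (fC f fF)).
Qed.

Lemma mem_adjoin f : f \in F0 -> f \in adjoin F0.
Proof.
move=> fF; rewrite memvE; apply: subv_trans (sub_agenv _); rewrite -memvE.
by apply: (subvP (addvSr _ _)); apply: memv_span.
Qed.

Lemma cent_adjoin_seq x : {in F0, forall f, x * f = f * x} -> x \in 'C(adjoin F0)%VS.
Proof.
move=> xC; apply/centvP => w wL; apply/esym/cent1vP; apply: subvP wL.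
apply: agenv_sub; first by apply/cent1vP; rewrite mul1r mulr1.
rewrite subv_add -memvE; apply/andP; split.
  by apply/cent1vP; rewrite mul1r mulr1.
by apply/span_subvP => f fF; apply/cent1vP; rewrite xC.
Qed.

Hypothesis hF0 : is_subgroup [set` F0].

Local Notation L := (adjoin F0).
Local Notation hL := adjoin_is_subfield_seq.
Local Notation N := (size (undup F0)).

(** [F0] is a list that may contain repetitions, so the order of the group is [size (undup F0)]. *)
Let lift : seq (subfield_type hL) := [seq (vsproj L f : subfield_type hL) | f <- undup F0].

Let liftP (z : subfield_type hL) : (z \in lift) = (subfield_val z \in F0).
Proof.
apply/mapP/idP => [[f]|h]; rewrite ?mem_undup.
  by move=> fF ->; rewrite /subfield_val vsprojK ?mem_adjoin.
by exists (subfield_val z); rewrite ?mem_undup // /subfield_val vsvalK.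
Qed.

Let group_lift : [/\ uniq lift, 0 \notin lift, 1 \in lift & {in lift &, forall x y, x * y \in lift}].
Proof.
split.
- rewrite map_inj_in_uniq ?undup_uniq // => x y; rewrite !mem_undup => xF yF.
  by move=> /(congr1 (@subfield_val _ _ _ hL)); rewrite /subfield_val !vsprojK ?mem_adjoin.
- rewrite liftP subfield_val0; apply/negP => h.
  by have := subgroup_unit hF0 h; rewrite unitr0.
- by rewrite liftP subfield_val_1; exact: subgroup1 hF0.
- by move=> x y; rewrite !liftP subfield_valM => xF yF; apply: (subgroupM hF0).
Qed.

Lemma F0_exp f : f \in F0 -> f ^+ N = 1.
Proof.
move=> fF; have [u n0 _ m] := group_lift.
have fL : subfield_sub hL (mem_adjoin fF) \in lift by rewrite liftP subfield_subK.
have := congr1 (@subfield_val _ _ _ hL) (finite_subgroup_unity_root u n0 m fL).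
by rewrite subfield_valX subfield_subK subfield_val_1 size_map.
Qed.

Lemma F0_cyclic : exists z : subfield_type hL, [/\ N.-primitive_root z, subfield_val z \in F0 &
  forall f, f \in F0 -> exists i, f = subfield_val z ^+ i].
Proof.
have [u n0 i1 m] := group_lift.
have [z zL hz] := finite_subgroup_prim_root u n0 i1 m; rewrite size_map in hz.
exists z; split=> //; first by rewrite -liftP.
move=> f fF; pose f' := subfield_sub hL (mem_adjoin fF).
have : f' ^+ N = 1 by apply: subfield_val_inj; rewrite subfield_valX subfield_subK F0_exp ?subfield_val_1.
case/(prim_rootP hz) => i hi; exists i.
by rewrite -subfield_valX -hi subfield_subK.
Qed.

Lemma N_odd : -1 \notin F0 -> odd N.
Proof.
apply: contraNT => oN; have [z [hz zF _]] := F0_cyclic.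
have N0 := prim_order_gt0 hz.
have e : N = (N./2 * 2)%N by rewrite muln2 -[LHS]odd_double_half (negPf oN).
have : z ^+ N./2 == -1.
  have : (z ^+ N./2) ^+ 2 = 1 by rewrite -exprM -e prim_expr_order.
  move/eqP; rewrite sqrf_eq1 => /orP[|//].
  rewrite -(prim_order_dvd hz) => /dvdn_leq; lia.
move/eqP/(congr1 (@subfield_val _ _ _ hL)); rewrite subfield_valX.
rewrite -[-1 in X in _ = X -> _]sub0r subfield_valB subfield_val0 subfield_val_1 sub0r => <-.
elim: (N./2) => [|k IH]; first by rewrite expr0; exact: (subgroup1 hF0).
by rewrite exprS; apply: (subgroupM hF0).
Qed.
End AdjoinAbelian.

Section SubfieldScalar.
Variables (K : fieldType) (D : falgType K) (L : {aspace D}) (hL : is_subfield L).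

Fact scalar_subfield (k : K) : k%:A \in L.
Proof. by rewrite memvZ // (subfield1 hL). Qed.

Definition subfield_scalar (k : K) : subfield_type hL := subfield_sub hL (scalar_subfield k).

Fact subfield_scalar_additive : zmod_morphism subfield_scalar.
Proof. by move=> x y; apply: subfield_val_inj; rewrite subfield_valB !subfield_subK scalerBl. Qed.

Fact subfield_scalar_multiplicative : monoid_morphism subfield_scalar.
Proof.
split=> [|x y]; apply: subfield_val_inj; first by rewrite subfield_subK subfield_val_1 scale1r.
by rewrite subfield_valM !subfield_subK -scalerAl mul1r scalerA.
Qed.

HB.instance Definition _ := GRing.isZmodMorphism.Build K (subfield_type hL) subfield_scalar
  subfield_scalar_additive.
HB.instance Definition _ := GRing.isMonoidMorphism.Build K (subfield_type hL) subfield_scalar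
  subfield_scalar_multiplicative.

End SubfieldScalar.

Section SubfieldGenerator.
Variables (K : fieldType) (D : falgType K) (F0 : seq D).
Hypotheses (hL : is_subfield (adjoin F0)).
Variables (N : nat) (z : subfield_type hL).
Hypotheses (hz : N.-primitive_root z) (Fz : forall f, f \in F0 -> exists i, f = subfield_val z ^+ i).

(** The span of the powers of [z] is closed under products and contains [F0]. *)
Lemma adjoin_horner x : x \in adjoin F0 ->
  exists R : {poly K}, x = subfield_val (map_poly (subfield_scalar hL) R).[z].
Proof.
pose zeta := subfield_val z; pose U := (\sum_(j < N) <[zeta ^+ j]>)%VS.
have N0 := prim_order_gt0 hz.
have zU i : zeta ^+ i \in U.
  rewrite /zeta -subfield_valX -(prim_expr_mod hz) subfield_valX.
  rewrite memvE; exact: (sumv_sup (Ordinal (ltn_pmod i N0)) isT (subvv _)).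
have UU : (U * U <= U)%VS.
  apply/prodvP => _ _ /memv_sumP[a ha ->] /memv_sumP[b hb ->].
  rewrite mulr_suml; apply: memv_suml => i _; rewrite mulr_sumr; apply: memv_suml => j _.
  have /vlineP[k ->] := ha i isT; have /vlineP[l ->] := hb j isT.
  by rewrite -scalerAl -scalerAr scalerA memvZ // -exprD zU.
have LU : (adjoin F0 <= U)%VS.
  have U1 : (1 <= U)%VS by rewrite -memvE -(expr0 zeta) zU.
  apply: agenv_sub_modl => //; apply: subv_trans UU; apply: prodvSl; rewrite subv_add U1.
  by apply/span_subvP => f /Fz[i ->]; exact: zU.
move/(subvP LU)/memv_sumP => [a ha ->].
have ex j : exists k, a j = k *: zeta ^+ j by have /vlineP[k ->] := ha j isT; exists k.
have [k hk] := choice ex.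
exists (\sum_(j < N) k j *: 'X^j).
rewrite rmorph_sum horner_sum (big_morph _ (@subfield_valD _ _ _ hL) (@subfield_val0 _ _ _ hL)).
apply: eq_bigr => j _; rewrite hk -mul_polyC rmorphM rmorphXn /= map_polyX map_polyC !hornerE.
by rewrite subfield_valM subfield_valX subfield_subK -scalerAl mul1r.
Qed.

Variables (p : nat) (vp : K -> rat).
Hypotheses (hp : prime p) (hK : is_padic_field p vp).

(* Otherwise [b ^ m] has its fourth power in [K] but not its square, hence [L] contains a square root [i] of
   [-1], and [a = (2 i b ^ 2) ^ 2]. *)
Lemma not_minus4_fourth (a : D) (m k : nat) (c : K) : c != 0 -> a ^+ m = c%:A -> vp c = k%:R -> odd k ->
  (forall b, b \in adjoin F0 -> b ^+ 2 <> a) ->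
  forall b, b \in adjoin F0 -> 4%:R * b ^+ 4 <> - a.
Proof.
move=> c0 ham vc ok na b0 b0L hb.
pose iota : {rmorphism K -> subfield_type hL} := subfield_scalar hL; pose b := subfield_sub hL b0L.
have ev4 : subfield_val (- (4%:R * b ^+ 4)) = a.
  have nat4 : subfield_val (4%:R : subfield_type hL) = 4%:R.
    by rewrite !mulrS mulr0n !subfield_valD subfield_val0 subfield_val_1.
  rewrite -[- _]sub0r subfield_valB subfield_val0 sub0r subfield_valM subfield_valX nat4.
  by rewrite subfield_subK hb opprK.
have ea : (- (4%:R * b ^+ 4)) ^+ m = iota c.
  by apply: subfield_val_inj; rewrite subfield_valX ev4 subfield_subK.
have hvp := padic_valued hK.
have n40 : (4%:R : K) != 0 by apply: natK_neq0 hK _ _.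
have [R hR] := adjoin_horner (subfield_valP (b ^+ m)).
move/subfield_val_inj in hR.
(* From [a = - 4 b ^ 4] and [a ^ m = c], this is the value of [b ^ (4 m)]. *)
pose c' := (-1) ^+ m * c / 4%:R ^+ m.
have c'0 : c' != 0 by rewrite !mulf_neq0 ?signr_eq0 ?invr_eq0 ?expf_neq0.
have b4 : (b ^+ m) ^+ 4 = iota c'.
  have n4 : iota (4%:R ^+ m) != 0 by rewrite fmorph_eq0 expf_neq0.
  apply: (mulIf n4); rewrite -rmorphM /c' divfK ?expf_neq0 // rmorphM -[X in _ = _ * X]ea.
  rewrite !rmorphXn rmorphN1 rmorph_nat -exprAC -!exprMn mulN1r opprK; congr (_ ^+ m).
  by rewrite mulrC.
have [] := @prim_root_sqrtN1 _ _ iota N z hz R c'.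
- by rewrite -hR b4.
- move=> d; rewrite -hR => hd.
  have dc : d ^+ 2 = c' by apply: (fmorph_inj iota); rewrite rmorphXn -hd -exprM b4.
  have d0 : d != 0 by apply: contraNneq c'0 => d0; rewrite -dc d0 expr0n.
  (* A parity contradiction: [vp c'] differs from the odd [k] by the even number [2 m * logn p 2],
     while [vp (d ^ 2)] is even. *)
  have := congr1 vp dc; rewrite (vX hvp) // /c' (valuationM hvp.1) ?mulf_neq0 ?signr_eq0 ?invr_eq0 ?expf_neq0 //.
  rewrite (valuationM hvp.1) ?signr_eq0 // vc (vV hvp) ?expf_neq0 // !(vX hvp) ?oppr_eq0 ?oner_neq0 //.
  rewrite (vN hvp) (v1 hvp) mul0rn add0r (vp_nat hK) // -[4%N]/(2 ^ 2)%N lognX.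
  have [z' ->] := vp_int hK d0.
  rewrite -mulrnA -mulnA; move: (logn p 2 * m)%N => l h.
  have : (z' *+ 2 = k%:Z - (2 * l)%N%:Z)%R by apply: (@intr_inj rat); rewrite rmorphMn rmorphB.
  by move=> {h}; move: ok; clear; lia.
move=> i hi; apply: (na (subfield_val (2%:R * i * b ^+ 2))); first exact: subfield_valP.
rewrite -subfield_valX -ev4; congr subfield_val.
by rewrite !exprMn hi; ring.
Qed.
End SubfieldGenerator.

(** * The exceptional case of Capelli's criterion *)

Section FourthRoots.
Variables (K : fieldType) (D : falgType K) (L : {aspace D}) (y a : D).
Hypotheses (hL : is_subfield L) (yC : y \in 'C(L)%VS) (aL : a \in L) (ya : y ^+ 2 = a).
Hypothesis ha : forall b, b \in L -> b ^+ 2 <> a.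

(** Write [z = l0 + l1 y]. Then [l0 ^ 2 + l1 ^ 2 a = 0] and [2 l0 l1 = s], since otherwise [y] would
    lie in [L]; hence [4 l0 ^ 4 = - s ^ 2 a = - a]. *)
Lemma adjoin_sqrt_square z s : z \in <<L; y>>%AS -> s \in L -> s ^+ 2 = 1 -> z ^+ 2 = s * y ->
  exists2 b, b \in L & 4%:R * b ^+ 4 = - a.
Proof.
move=> zE sL s2 hz; have [l hl ez] := adjoin_rootP hL yC (isT : prime 2) aL ya zE.
have hE := adjoin_is_subfield hL yC.
have sub x : x \in L -> x \in <<L; y>>%AS by apply/subvP; exact: adjoin_sub.
pose F := subfield_type hE.
pose l0 : F := subfield_sub hE (sub _ (hl ord0)); pose l1 : F := subfield_sub hE (sub _ (hl (lift ord0 ord0))).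
pose y' : F := subfield_sub hE (adjoin_mem L y); pose a' : F := subfield_sub hE (sub _ aL).
pose s' : F := subfield_sub hE (sub _ sL); pose z' : F := subfield_sub hE zE.
have y2 : y' ^+ 2 = a' by apply: subfield_val_inj; rewrite subfield_valX !subfield_subK.
have s2' : s' ^+ 2 = 1 by apply: subfield_val_inj; rewrite subfield_valX subfield_subK s2; exact/esym/subfield_val_1.
have ez' : z' = l0 + l1 * y'.
  apply: subfield_val_inj; rewrite subfield_valD subfield_valM !subfield_subK ez.
  by rewrite big_ord_recl big_ord1 expr0 mulr1 expr1.
have hz' : z' ^+ 2 = s' * y' by apply: subfield_val_inj; rewrite subfield_valX subfield_valM !subfield_subK.
have e : (l0 ^+ 2 + l1 ^+ 2 * a') + (2%:R * l0 * l1 - s') * y' = 0.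
  by rewrite -y2 -[RHS](subrr (s' * y')) -{1}hz' ez'; ring.
pose val := @subfield_val K D _ hE.
have F_L x : val x \in L -> x != 0 -> val x^-1 \in L.
  by move=> xL x0; rewrite /val subfield_valV // memvV.
have [c0|c0] := eqVneq (2%:R * l0 * l1 - s') 0.
  exists (val l0); first by rewrite /val subfield_subK.
  have nat4 : val 4%:R = 4%:R.
    by rewrite /val !mulrS mulr0n !subfield_valD subfield_val0 subfield_val_1.
  rewrite -nat4 /val -subfield_valX -subfield_valM -[a in RHS](subfield_subK hE (sub _ aL)) -/a'.
  apply/eqP; rewrite -subr_eq0 opprK -subfield_valD subfield_val_eq0; apply/eqP.
  move: e; rewrite c0 mul0r addr0 => e; move/subr0_eq: c0 => c0.
  have -> : 4%:R * l0 ^+ 4 + a' = 4%:R * l0 ^+ 2 * (l0 ^+ 2 + l1 ^+ 2 * a') - ((2%:R * l0 * l1) ^+ 2 - 1) * a' by ring.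
  by rewrite e c0 s2' subrr mulr0 mul0r subrr.
exfalso; set c := 2%:R * l0 * l1 - s' in e c0.
have ey : y' = - (l0 ^+ 2 + l1 ^+ 2 * a') * c^-1.
  apply: (mulIf c0); rewrite mulfVK // [LHS]mulrC; apply/eqP; rewrite -subr_eq0 opprK addrC.
  by rewrite e.
apply: (ha (b := y)); last exact: ya.
rewrite -[y](subfield_subK hE (adjoin_mem L y)) -/y' ey.
have cL : val c \in L.
  have val2 : val 2%:R \in L.
    by rewrite /val mulr2n subfield_valD subfield_val_1 rpredD ?(subfield1 hL).
  rewrite /val /c subfield_valB !subfield_valM !subfield_subK; apply: rpredB => //.
  by apply: memvM; [apply: memvM|].
rewrite subfield_valM memvM ?F_L //.
rewrite -[- _]sub0r subfield_valB subfield_val0 sub0r rpredN subfield_valD subfield_valM !subfield_valX.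
by rewrite !subfield_subK rpredD ?memvM ?memvX ?hl ?(subfield1 hL).
Qed.
End FourthRoots.

Section Roots.
Variables (p n : nat) (K : fieldType) (vp : K -> rat) (D : falgType K) (v : D -> rat).
Hypotheses (hp : prime p) (hn : (0 < n)%N) (hK : is_padic_field p vp).
Hypotheses (hv : extends_valuation vp v) (hdiv : is_division D) (dimD : \dim {:D} = (n ^ 2)%N).
Variables (W : {aspace D}) (om g : D).
Hypothesis hc : Dn_coordinates p n v W om g.

(** After one square root [y], neither [y] nor [- y] is a square in [L(y)]; from there [root_degree]
    applies. *)
Lemma root_degree2 (c : nat) (L : {aspace D}) x a : is_subfield L -> x \in 'C(L)%VS ->
  a \in L -> x ^+ (2 ^ c) = a -> (forall b, b \in L -> b ^+ 2 <> a) ->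
  (forall b, b \in L -> 4%:R * b ^+ 4 <> - a) -> (2 ^ c * \dim L %| n)%N.
Proof.
case: c => [|c] hL xC aL hx ha ha4.
  by rewrite expn0 mul1n (subfield_dim_dvd hp hn hK hv hdiv dimD hc).
pose y := x ^+ (2 ^ c).
have hy : y ^+ 2 = a by rewrite -hx expnSr exprM.
have yC : y \in 'C(L)%VS by apply: centvX.
have xC' : x \in 'C(<<L; y>>)%VS by apply: cent_adjoin => //; rewrite -exprS -exprSr.
rewrite expnSr -mulnA -(dim_adjoin_root hL yC _ aL hy ha) //.
have hN z s : s \in L -> s ^+ 2 = 1 -> z \in <<L; y>>%AS -> z ^+ 2 <> s * y.
  by move=> sL s2 zE hz; have [b bL] := adjoin_sqrt_square hL yC aL hy ha zE sL s2 hz; apply: ha4.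
apply: (root_degree hp hn hK hv hdiv dimD hc _ (adjoin_is_subfield hL yC) xC' (adjoin_mem L y) erefl) => //.
  by move=> b bL'; rewrite -[y]mul1r; apply: hN; rewrite ?expr1n ?(subfield1 hL).
move=> _ _ b bL'; rewrite -mulN1r; apply: hN; rewrite ?sqrrN ?expr1n //.
by rewrite rpredN (subfield1 hL).
Qed.
End Roots.

(** * Subgroups and their indices *)

Section Subgroups.
Variables (K : fieldType) (D : falgType K).

Lemma subgroupX (G : set D) x k : is_subgroup G -> G x -> G (x ^+ k).
Proof.
move=> hG Gx; elim: k => [|k IH]; first by rewrite expr0; exact: subgroup1 hG.
by rewrite exprS; apply: (subgroupM hG).
Qed.

Lemma subgroupXz (G : set D) x (k : int) : is_subgroup G -> G x -> G (x ^ k).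
Proof.
move=> hG Gx; case: k => k; first exact: (subgroupX k hG Gx).
by rewrite NegzE -exprnN; apply: (subgroupV hG); apply: subgroupX.
Qed.

Lemma lcoset_eq (H : set D) x y : is_subgroup H -> x \is a GRing.unit -> H (x^-1 * y) ->
  [set y * h | h in H] = [set x * h | h in H].
Proof.
move=> hH ux hxy; apply/seteqP; split=> _ [h Hh <-].
  by exists (x^-1 * y * h); [apply: (subgroupM hH)|rewrite !mulrA mulrV ?mul1r].
exists ((x^-1 * y)^-1 * h); first by apply: (subgroupM hH) => //; apply: (subgroupV hH).
have uxy : x^-1 * y \is a GRing.unit := subgroup_unit hH hxy.
by rewrite -{1}(mulVKr ux y) -mulrA mulVKr.
Qed.

Lemma cyclic_is_subgroup (x : D) : x \is a GRing.unit -> is_subgroup (cyclic_subgroup x).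
Proof.
move=> ux; split.
- by move=> _ [k _ <-]; apply: unitrXz.
- by exists 0.
- by move=> _ _ [k _ <-] [l _ <-]; exists (k + l); rewrite ?exprzDr.
- by move=> _ [k _ <-]; exists (- k); rewrite // invr_expz.
Qed.

Lemma prod_is_subgroup (G : set D) x : is_subgroup G -> x \is a GRing.unit ->
  (forall f, G f -> x * f = f * x) -> is_subgroup (prod_set G (cyclic_subgroup x)).
Proof.
move=> hG ux xG; have xzG f (k : int) : G f -> x ^ k * f = f * x ^ k.
  by move=> Gf; apply/esym/commrXz/esym/xG.
split.
- move=> _ [f Gf [_ [k _ <-] <-]]; rewrite unitrMl; first exact: (subgroup_unit hG).
  exact: unitrXz.
- by exists 1; [exact: subgroup1 hG|exists 1; [exists 0|rewrite mul1r]].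
- move=> _ _ [f Gf [_ [k _ <-] <-]] [g Gg [_ [l _ <-] <-]].
  exists (f * g); first exact: (subgroupM hG).
  exists (x ^ (k + l)); first by exists (k + l).
  by rewrite exprzDr // !mulrA -[f * g * _]mulrA -[f * _ * g]mulrA xzG // !mulrA.
- move=> _ [f Gf [_ [k _ <-] <-]]; exists f^-1; first exact: (subgroupV hG).
  exists (x ^ (- k)); first by exists (- k).
  by rewrite (invrM (subgroup_unit hG Gf) (unitrXz k ux)) invr_expz xzG //; apply: (subgroupV hG).
Qed.

Variable v : D -> rat.
Hypothesis hvD : valued_division v.

Lemma vXz x (k : int) : x != 0 -> v (x ^ k) = v x *~ k.
Proof.
move=> x0; case: k => k; first by rewrite -exprnP (vX hvD).
by rewrite NegzE -exprnN (vV hvD) ?(exp_neq0 hvD) // (vX hvD) // mulrNz.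
Qed.

Lemma mulrz_eq (r : rat) (k l : int) : r != 0 -> r *~ k = r *~ l -> k = l.
Proof. by move=> r0 /mulrIz; apply. Qed.

Lemma subgroup_neq0 (G : set D) x : is_subgroup G -> G x -> x != 0.
Proof. by move=> hG /(subgroup_unit hG); apply: contraTneq => ->; rewrite unitr0. Qed.

(** Membership in [H] depends only on the valuation, so the cosets are those of [x ^ i] for
    [i < s]. *)
Lemma index_val (G H : set D) x s : is_subgroup G -> is_subgroup H -> H `<=` G -> G x -> v x != 0 ->
  (0 < s)%N -> (forall y, G y -> exists k : int, v y = v x *~ k) ->
  (forall z, G z -> (H z <-> exists k : int, v z = v x *~ (k * s%:Z))) -> index_is G H s.
Proof.
move=> hG hH HG Gx vx0 s0 hGx hHv.
have x0 := subgroup_neq0 hG Gx; have ux := subgroup_unit hG Gx.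
pose phi (i : nat) := [set x ^+ i * h | h in H].
have inj : {in `I_s &, injective phi}.
  move=> i j; rewrite !inE /= => si sj e.
  have [h Hh eh] : phi j (x ^+ i) by rewrite -e; exists 1; rewrite ?mulr1 //; exact: subgroup1 hH.
  have Gh := HG _ Hh; have h0 := subgroup_neq0 hG Gh.
  have [k hk] := (hHv _ Gh).1 Hh.
  have := congr1 v eh; rewrite (valuationM hvD.1) ?(exp_neq0 hvD) // !(vX hvD) // hk.
  rewrite !pmulrn -mulrzDr => /(mulrz_eq vx0) e'; move: si sj e'; clear => si sj e'.
  have [k0|[k0|k0]] : k = 0 \/ 1 <= k \/ k <= -1 by lia.
  - by move: e'; rewrite k0; lia.
  - by nia.
  - by nia.
rewrite /index_is; have -> : lcosets G H = phi @` `I_s.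
  apply/seteqP; split=> [_ [y Gy <-]|_ [i _ <-]]; last by exists (x ^+ i) => //; exact: subgroupX.
  have [k hk] := hGx y Gy.
  have kmod : (k %% s%:Z)%Z >= 0 by apply: modz_ge0; rewrite eqz_nat -lt0n.
  exists `|(k %% s%:Z)%Z|%N => /=.
    by rewrite -ltz_nat gez0_abs // ltz_pmod.
  apply/esym/lcoset_eq => //; first by rewrite unitrX.
  have GXV : G (x ^+ `|(k %% s%:Z)%Z|%N)^-1 by apply: (subgroupV hG); apply: subgroupX.
  apply/hHv; first exact: (subgroupM hG).
  exists (k %/ s%:Z)%Z.
  rewrite (valuationM hvD.1) ?(subgroup_neq0 hG Gy) ?(subgroup_neq0 hG GXV) //.
  rewrite (vV hvD) ?(exp_neq0 hvD) // (vX hvD) // hk pmulrn gez0_abs // addrC -mulrzBr.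
  by congr (_ *~ _); rewrite {1}(divz_eq k s%:Z) addrK.
exact: inj_card_eq.
Qed.

Lemma index_is_inj (G H : set D) r s : index_is G H r -> index_is G H s -> r = s.
Proof. by rewrite /index_is => hr hs; apply/card_eq_II; apply: card_eq_trans hs; rewrite card_eq_sym. Qed.

Lemma index_finite (G H : set D) r : index_is G H r -> finite_set (lcosets G H).
Proof. by move=> h; apply/finite_setP; exists r. Qed.
End Subgroups.

Section CyclicExtension.
Variables (K : fieldType) (D : falgType K) (v : D -> rat) (hvD : valued_division v).
Variables (F0 : seq D) (hF0 : is_subgroup [set` F0]) (vF : {in F0, forall f, v f = 0}).
Hypothesis F0C : {in F0 &, forall f g, f * g = g * f}.

Definition cyc_ext (x : D) : set D := prod_set [set` F0] (cyclic_subgroup x).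

Definition commutes (x : D) := x \is a GRing.unit /\ {in F0, forall f, x * f = f * x}.

Lemma ext_subgroup x : commutes x -> is_subgroup (cyc_ext x).
Proof. by move=> [ux xC]; apply: prod_is_subgroup hF0 ux _ => f; exact: xC. Qed.

Lemma ext_gen x : cyc_ext x x.
Proof. by exists 1; [exact: subgroup1 hF0|exists x; [exists 1|rewrite mul1r]]. Qed.

Lemma ext_F0 x f : f \in F0 -> cyc_ext x f.
Proof. by move=> fF; exists f => //; exists 1; [exists 0|rewrite mulr1]. Qed.

Lemma ext_min (G : set D) x : is_subgroup G -> [set` F0] `<=` G -> G x -> cyc_ext x `<=` G.
Proof.
move=> hG FG Gx _ [f fF [_ [k _ <-] <-]]; apply: (subgroupM hG); first exact: FG.
exact: subgroupXz.
Qed.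

Lemma commutesX x k : commutes x -> commutes (x ^+ k).
Proof. by move=> [ux xC]; split=> [|f fF]; [rewrite unitrX | apply/esym/commrX/esym/xC]. Qed.

Lemma ext_val x y : commutes x -> cyc_ext x y -> exists k : int, v y = v x *~ k.
Proof.
move=> [ux xC] [f fF [_ [k _ <-] <-]]; exists k.
have x0 : x != 0 by apply: contraTneq ux => ->; rewrite unitr0.
have xk0 : x ^ k != 0 by apply: contraTneq (unitrXz k ux) => ->; rewrite unitr0.
by rewrite (valuationM hvD.1) ?(subgroup_neq0 hF0 fF) // vF // add0r (vXz hvD).
Qed.

Lemma ext_pow_sub x s : commutes x -> cyc_ext (x ^+ s) `<=` cyc_ext x.
Proof.
move=> xC; apply: ext_min; first exact: ext_subgroup.
  by move=> f; apply: ext_F0.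
exact: (subgroupX s (ext_subgroup xC) (ext_gen x)).
Qed.

Lemma ext_pow x s z : commutes x -> v x != 0 -> cyc_ext x z ->
  cyc_ext (x ^+ s) z <-> exists k : int, v z = v x *~ (k * s%:Z).
Proof.
move=> xC vx0 Gz; have x0 := subgroup_neq0 (ext_subgroup xC) (ext_gen x).
split=> [Hz|[k hk]].
  by have [k ->] := ext_val (commutesX s xC) Hz; exists k; rewrite (vX hvD) // pmulrn mulrC mulrzA.
case: Gz hk => f fF [_ [m _ <-] <-].
have xm0 : x ^ m != 0 by apply: contraTneq (unitrXz m xC.1) => ->; rewrite unitr0.
rewrite (valuationM hvD.1) ?(subgroup_neq0 hF0 fF) // vF // add0r (vXz hvD) // => /(mulrz_eq vx0) ->.
exists f => //; exists ((x ^+ s) ^ k); first by exists k.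
by rewrite exprnP exprz_exp mulrC.
Qed.

Lemma ext_index x s : commutes x -> v x != 0 -> (0 < s)%N ->
  index_is (cyc_ext x) (cyc_ext (x ^+ s)) s.
Proof.
move=> xC vx0 s0; apply: (index_val hvD (x := x)) => //.
- exact: ext_subgroup.
- exact/ext_subgroup/commutesX.
- exact: ext_pow_sub.
- exact: ext_gen.
- by move=> y; apply: ext_val.
- by move=> z; apply: ext_pow.
Qed.

(** This identifies [F0 <pu>] with [F0 <y ^ s>] whenever [y ^ s = f * pu]. *)
Lemma ext_shift y f : f \in F0 -> commutes y -> cyc_ext (f * y) = cyc_ext y.
Proof.
move=> fF yC; have fyC : commutes (f * y).
  split=> [|g gF]; first by rewrite unitrMl ?(subgroup_unit hF0 fF) ?yC.1.
  by rewrite -mulrA yC.2 // !mulrA (F0C fF gF).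
apply/seteqP; split; apply: ext_min; do ?[exact: ext_subgroup | by move=> g; apply: ext_F0].
  by apply: (subgroupM (ext_subgroup yC)); [exact: ext_F0|exact: ext_gen].
rewrite -[y in X in cyc_ext _ X](mulKr (subgroup_unit hF0 fF)).
apply: (subgroupM (ext_subgroup fyC)); last exact: ext_gen.
by apply/ext_F0/(subgroupV hF0).
Qed.

(** The second family requires finite index over [<pu>] itself; the [g * x ^ i] with [g] in [F0] and
    [i < s] are representatives. *)
Lemma ext_finite_cosets x z f s : commutes x -> commutes z -> f \in F0 -> (0 < s)%N -> x ^+ s = f * z ->
  finite_set (lcosets (cyc_ext x) (cyclic_subgroup z)).
Proof.
move=> xC zC fF s0 hx.
pose phi (a : D * nat) := [set a.1 * x ^+ a.2 * h | h in cyclic_subgroup z].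
have fin : finite_set ([set` F0] `*` `I_s) by apply: finite_setX => //; exact: finite_seq.
apply: sub_finite_set (finite_image phi fin) => _ [_ [g gF [_ [k _ <-] <-]] <-].
have kmod : (k %% s%:Z)%Z >= 0 by apply: modz_ge0; rewrite eqz_nat -lt0n.
pose i := `|(k %% s%:Z)%Z|%N; pose t := (k %/ s%:Z)%Z.
have lti : (i < s)%N by rewrite -ltz_nat gez0_abs // ltz_pmod.
have ek : k = i%:Z + s%:Z * t by rewrite gez0_abs // addrC mulrC -divz_eq.
have [h hF [_ [l _ <-] e]] : cyc_ext z ((x ^+ s) ^ t).
  apply: subgroupXz (ext_subgroup zC) _; rewrite hx.
  by apply: (subgroupM (ext_subgroup zC)); [exact: ext_F0|exact: ext_gen].
exists (g * h, i); first by split=> //; apply: (subgroupM hF0).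
have ug : g * h * x ^+ i \is a GRing.unit.
  rewrite unitrMl; first exact: (subgroup_unit hF0 (subgroupM hF0 gF hF)).
  by rewrite unitrX ?xC.1.
apply/esym/lcoset_eq.
- exact: cyclic_is_subgroup zC.1.
- exact: ug.
exists l => //=; rewrite ek exprzDr ?xC.1 // -exprz_exp -[x ^ s%:Z]exprnP -e.
have -> : x ^ i = x ^+ i by [].
have -> : g * (x ^+ i * (h * z ^ l)) = g * h * x ^+ i * z ^ l.
  by rewrite !mulrA -[g * _ * h]mulrA ((commutesX i xC).2 _ hF) !mulrA.
exact/esym/(mulKr ug).
Qed.
End CyclicExtension.

(** * The two families of subgroups *)

Section MaximalExtensions.
Variables (p n : nat) (K : fieldType) (vp : K -> rat) (D : falgType K) (v : D -> rat).
Hypotheses (hp : prime p) (hn : (0 < n)%N) (hK : is_padic_field p vp).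
Hypotheses (hv : extends_valuation vp v) (hdiv : is_division D) (dimD : \dim {:D} = (n ^ 2)%N).
Variables (W : {aspace D}) (om g : D).
Hypothesis hc : Dn_coordinates p n v W om g.
Variables (u : K) (F0 : seq D).
Hypotheses (hu : ring_units (val_ring vp) u) (hF0 : is_subgroup [set` F0]).
Hypothesis F0C : {in F0 &, forall x y, x * y = y * x}.

Let hvD := division_valued hv hdiv.
Let hL := adjoin_is_subfield_seq hdiv F0C.
Local Notation L := (adjoin F0).
Let pu := pu_elt p D u.

Lemma vp_unit : vp u = 0.
Proof.
have hvp := padic_valued hK; case: hu => uu [|u1]; first by move=> u0; move: uu; rewrite u0 unitr0.
case=> [/eqP|]; first by rewrite invr_eq0 => /eqP u0; move: uu; rewrite u0 unitr0.
rewrite (vV hvp) ?oppr_ge0 -?unitfE // => u2; exact/le_anti/andP.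
Qed.

Lemma pu_neq0 : p%:R * u != 0.
Proof. by rewrite mulf_neq0 ?(natK_p_neq0 hp hK) // -unitfE; case: hu. Qed.

Lemma v_pu : v pu = 1.
Proof.
have hvp := padic_valued hK.
rewrite /pu /pu_elt hv.2 ?pu_neq0 // (valuationM hvp.1) ?(natK_p_neq0 hp hK) //; last by rewrite -unitfE; case: hu.
by rewrite vp_unit (vp_p hp hK) addr0.
Qed.

Lemma vp_pu : vp (p%:R * u) = 1.
Proof. by rewrite -hv.2 ?pu_neq0 //; exact: v_pu. Qed.

Let pu_unit : pu \is a GRing.unit.
Proof. by apply: hdiv; apply: scalar_neq0; exact: pu_neq0. Qed.

Let pu_comm x : pu * x = x * pu.
Proof. by rewrite /pu /pu_elt -scalerAl -scalerAr mul1r mulr1. Qed.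

Let puC : commutes F0 pu.
Proof. by split=> [|f _]; [exact: pu_unit|exact: pu_comm]. Qed.

Lemma v_F0 : {in F0, forall f, v f = 0}.
Proof.
move=> f fF; have f0 := subgroup_neq0 hF0 fF.
have := congr1 v (F0_exp hdiv F0C hF0 fF); rewrite (vX hvD) // (v1 hvD) => /eqP.
rewrite mulrn_eq0 => /orP[|/eqP //]; rewrite size_eq0 => /eqP e.
by have := subgroup1 hF0; rewrite /= -mem_undup e.
Qed.
Let vF := v_F0.

Lemma ext_pu_val0 z : cyc_ext F0 pu z -> v z = 0 -> z \in F0.
Proof.
move=> [f fF [_ [k _ <-] <-]].
have pu0 : pu != 0 by apply: contraTneq pu_unit => ->; rewrite unitr0.
have puk : pu ^ k != 0 by apply: contraTneq (unitrXz k pu_unit) => ->; rewrite unitr0.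
rewrite (valuationM hvD.1) ?(subgroup_neq0 hF0 fF) // (vF fF) add0r (vXz hvD) // v_pu.
by move/eqP; rewrite intr_eq0 => /eqP ->; rewrite expr0z mulr1.
Qed.

(** The values of [G] form a subgroup of [(1/n) Z] that contains [v pu = 1], so it is generated by
    some [1/s]. *)
Lemma exists_val_generator (G : set D) : is_subgroup G -> G pu -> exists s x,
  [/\ (0 < s)%N, G x, v x = s%:R^-1 & forall y, G y -> exists k : int, v y = v x *~ k].
Proof.
move=> hG Gpu; have n0 : (n%:R : rat) != 0 by rewrite pnatr_eq0 -lt0n.
pose P k := (0 < k)%N /\ exists2 y, G y & v y = k%:R / n%:R.
have Pn : P n by split=> //; exists pu => //; rewrite v_pu mulfV.
have [m [m0 [x Gx hx]] mmin] := exists_min Pn.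
have x0 := subgroup_neq0 hG Gx.
have gen y : G y -> exists k : int, v y = v x *~ k.
  move=> Gy; have y0 := subgroup_neq0 hG Gy; have [z hz] := coord_val hc y0.
  pose t := (z %/ m%:Z)%Z; pose r := `|(z %% m%:Z)%Z|%N.
  have er : (z %% m%:Z)%Z = r%:Z by rewrite gez0_abs // modz_ge0 // eqz_nat -lt0n.
  have ltr : (r < m)%N by rewrite -ltz_nat -er ltz_pmod.
  have Gw : G (x ^ (- t) * y) by apply: (subgroupM hG) => //; apply: subgroupXz.
  have xt0 : x ^ (- t) != 0.
    by apply: contraTneq (unitrXz (- t) (subgroup_unit hG Gx)) => ->; rewrite unitr0.
  have ez : z = t * m%:Z + r%:Z by rewrite -er -divz_eq.
  have vw : v (x ^ (- t) * y) = r%:R / n%:R.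
    rewrite (valuationM hvD.1) // (vXz hvD) // hx hz ez rmorphD rmorphM /= -mulrzr mulrNz -!pmulrn.
    by field.
  have r0 : r = 0%N.
    apply: contrapT => r0; have : (m <= r)%N by apply: mmin; split; [rewrite lt0n; apply/eqP|exists (x ^ (- t) * y)].
    by rewrite leqNgt ltr.
  by exists t; rewrite hz ez r0 addr0 hx rmorphM /= -mulrzr -pmulrn; field.
have [k hk] := gen _ Gpu.
have vx0 : 0 < v x by rewrite hx divr_gt0 ?ltr0n.
have k0 : 0 < k.
  have : 0 < v x *~ k by rewrite -hk v_pu.
  by rewrite pmulrz_rgt0.
exists `|k|%N, x; split=> //; first by rewrite absz_gt0 gt_eqF.
have kk : (`|k|%N%:R : rat) = k%:~R by rewrite pmulrn gez0_abs // ltW.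
rewrite kk; apply: (mulIf (_ : k%:~R != 0 :> rat)); first by rewrite intr_eq0 gt_eqF.
by rewrite mulVf ?intr_eq0 ?gt_eqF // mulrzr -hk v_pu.
Qed.

Lemma val_fracs x : x != 0 -> rat_fracs n (v x).
Proof. by move=> x0; have [z ->] := coord_val hc x0; exists z. Qed.

Lemma mem_adjoin_unit x : x \in L -> x != 0 -> adjoin_units F0 x.
Proof. by move=> xL x0; split=> //; apply: hdiv. Qed.

Lemma adjoin_Xz x (k : int) : x \in L -> x ^ k \in L.
Proof.
move=> xL; case: k => k; first by rewrite -exprnP memvX ?(subfield1 hL).
by rewrite NegzE -exprnN memvV memvX ?(subfield1 hL).
Qed.

Lemma mem_adjoin_commutes x : x \in L -> x != 0 -> commutes F0 x.
Proof.
move=> xL x0; split=> [|f fF]; first exact: hdiv.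
by apply: (subfieldC hL xL); apply: mem_adjoin.
Qed.

Lemma root_pu_val s x f : (0 < s)%N -> x != 0 -> f \in F0 -> x ^+ s = f * pu -> v x = s%:R^-1.
Proof.
move=> s0 x0 fF hx; have pu0 := subgroup_neq0 (ext_subgroup hF0 puC) (ext_gen hF0 pu).
have sn0 : (s%:R : rat) != 0 by rewrite pnatr_eq0 -lt0n.
have := congr1 v hx; rewrite (vX hvD) // (valuationM hvD.1) ?(subgroup_neq0 hF0 fF) // (vF fF) add0r v_pu.
by move=> e; apply: (mulIf sn0); rewrite mulVf // mulr_natr.
Qed.

Lemma ext_Ftilde_field s y f : (0 < s)%N -> y \in L -> y != 0 -> f \in F0 -> y ^+ s = f * pu ->
  Ftilde_field p v n u F0 s (cyc_ext F0 y).
Proof.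
move=> s0 yL y0 fF hy; have yC := mem_adjoin_commutes yL y0.
have vy := root_pu_val s0 y0 fF hy.
have vy0 : v y != 0 by rewrite vy invr_eq0 pnatr_eq0 -lt0n.
have eT : tilde p u F0 = cyc_ext F0 (y ^+ s) by rewrite hy (ext_shift hF0 F0C fF puC).
have gG := ext_subgroup hF0 yC.
have idx := ext_index hvD hF0 vF yC vy0 s0.
split.
- exact: gG.
- move=> z Gz; apply: mem_adjoin_unit; last exact: subgroup_neq0 gG Gz.
  case: Gz => h hF [_ [k _ <-] <-]; apply: memvM; first exact: mem_adjoin.
  exact: adjoin_Xz.
- rewrite eT; split; [exact/ext_subgroup/commutesX|exact: ext_pow_sub|exact: index_finite idx].
- split=> [z Gz|z w Gz Gw]; first exact: val_fracs (subgroup_neq0 gG Gz).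
  rewrite eT (ext_pow hvD hF0 vF s yC vy0); last by apply: (subgroupM gG) => //; apply: (subgroupV gG).
  have z0 := subgroup_neq0 gG Gz; have w0 := subgroup_neq0 gG Gw.
  have wV0 : w^-1 != 0 by apply: (subgroup_neq0 gG); apply: (subgroupV gG).
  rewrite (valuationM hvD.1) // (vV hvD) // addrC vy.
  have e (k : int) : s%:R^-1 *~ (k * s%:Z) = k%:~R :> rat.
    by rewrite -mulrzr rmorphM /= -pmulrn; field; rewrite pnatr_eq0 -lt0n.
  split=> [[k _ hk]|[k]]; first by exists k; rewrite e.
  by rewrite e => ->; exists k.
- by rewrite eT.
Qed.

(** For [x] of least positive value [1/s], the element [x ^ s * pu^-1] has valuation 0; by
    injectivity of [v] modulo [F0 <pu>] it lies in that group, hence in [F0]. Counting cosets gives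
    [s = r]. *)
Lemma Ftilde_fieldP r F1 : Ftilde_field p v n u F0 r F1 -> exists x f,
  [/\ (0 < r)%N, x \in L, x != 0, f \in F0 & x ^+ r = f * pu /\ F1 = cyc_ext F0 x].
Proof.
case=> gF1 F1L [gT TF1 _] [_ inj] idx.
have F1pu : F1 pu by apply: TF1; exact: (ext_gen hF0 pu).
have [s [x [s0 F1x vx gen]]] := exists_val_generator gF1 F1pu.
have x0 := subgroup_neq0 gF1 F1x; have [xL _] := F1L _ F1x.
have sn0 : (s%:R : rat) != 0 by rewrite pnatr_eq0 -lt0n.
have vx0 : v x != 0 by rewrite vx invr_eq0.
have e (k : int) : v x *~ (k * s%:Z) = k%:~R :> rat.
  by rewrite vx -mulrzr rmorphM /= -pmulrn; field.
have critT z : F1 z -> (tilde p u F0 z <-> exists k : int, v z = v x *~ (k * s%:Z)).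
  move=> F1z; have := inj z 1 F1z (subgroup1 gF1); rewrite (v1 hvD) subr0 invr1 mul1r => <-.
  split=> [[k _ hk]|[k]]; first by exists k; rewrite e.
  by rewrite e => ->; exists k.
have er : r = s := index_is_inj idx (index_val hvD gF1 gT TF1 F1x vx0 s0 gen critT).
have val0 z : F1 z -> v z = 0 -> z \in F0.
  move=> F1z z0; apply: ext_pu_val0 => //; apply/(critT z F1z).
  by exists 0; rewrite mul0r z0 mulr0z.
have pu0 := subgroup_neq0 gF1 F1pu.
have F1f : F1 (x ^+ s * pu^-1).
  by apply: (subgroupM gF1); [exact: subgroupX|exact: (subgroupV gF1)].
have puV0 : pu^-1 != 0 by apply: (subgroup_neq0 gF1); apply: (subgroupV gF1).
exists x, (x ^+ s * pu^-1); rewrite er; split=> //.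
  apply: (val0 _ F1f); rewrite (valuationM hvD.1) ?(exp_neq0 hvD) // (vX hvD) // (vV hvD) // v_pu vx.
  by rewrite -[_ *+ s]mulr_natr mulVf // subrr.
split; first by rewrite -mulrA mulVr // mulr1.
apply/seteqP; split; last first.
  apply: ext_min => // f fF; apply: TF1; exact: (ext_F0 pu fF).
move=> y F1y; have [k hk] := gen y F1y.
have uxk : x ^ k \is a GRing.unit by apply/unitrXz/hdiv.
have xk0 : x ^ (- k) != 0 by apply: contraTneq (unitrXz (- k) (hdiv x0)) => ->; rewrite unitr0.
exists (y * x ^ (- k)).
  apply: val0; first by apply: (subgroupM gF1) => //; exact: subgroupXz.
  by rewrite (valuationM hvD.1) ?(subgroup_neq0 gF1 F1y) // (vXz hvD) // mulrNz hk subrr.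
exists (x ^ k); first by exists k.
by rewrite -mulrA -exprzDr ?hdiv // addNr expr0z mulr1.
Qed.

Section Maximal.
Variables (r1 : nat) (F1 : set D).
Hypothesis hr1max : forall r : nat, (r1 < r)%N -> Ftilde_field p v n u F0 r = set0.
Variables (x1 f1 : D).
Hypotheses (r1_gt0 : (0 < r1)%N) (x1L : x1 \in L) (x10 : x1 != 0) (f1F : f1 \in F0).
Hypotheses (hx1 : x1 ^+ r1 = f1 * pu) (eF1 : F1 = cyc_ext F0 x1).

Let x1C : commutes F0 x1.
Proof. exact: mem_adjoin_commutes. Qed.

Let vx1 : v x1 = r1%:R^-1.
Proof. exact: root_pu_val hx1. Qed.

Lemma F1_pow_pu a : F1 a -> v a = r1%:R^-1 -> exists2 f, f \in F0 & a ^+ r1 = f * pu.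
Proof.
rewrite eF1 => - [f fF [_ [k _ <-] <-]].
have xk0 : x1 ^ k != 0 by apply: contraTneq (unitrXz k x1C.1) => ->; rewrite unitr0.
rewrite (valuationM hvD.1) ?(subgroup_neq0 hF0 fF) // (vF fF) add0r (vXz hvD) // vx1.
rewrite -[X in _ = X]mulr1z => /mulrz_eq -> //; last by rewrite invr_eq0 pnatr_eq0 -lt0n.
exists (f ^+ r1 * f1); first by apply: (subgroupM hF0) => //; exact: subgroupX.
by rewrite expr1z exprMn_comm ?hx1 ?mulrA // /GRing.comm x1C.2.
Qed.

(** A root [y] of degree [j] would satisfy [y ^ (j * r1) = f * pu], so [F0 <y>] would be a member of
    the first family of index [j * r1 > r1]. *)
Lemma maximal_no_root a y j : F1 a -> v a = r1%:R^-1 -> (1 < j)%N -> y \in L -> y ^+ j <> a.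
Proof.
move=> F1a va j1 yL hy; have [f fF ha] := F1_pow_pu F1a va.
have hyj : y ^+ (j * r1) = f * pu by rewrite exprM hy.
have jr0 : (0 < j * r1)%N by rewrite muln_gt0 r1_gt0 (ltnW j1).
have y0 : y != 0.
  apply: contraTneq (_ : y ^+ (j * r1) \is a GRing.unit) => [->|].
    by rewrite expr0n gtn_eqF // unitr0.
  by rewrite hyj (unitrMl _ pu_unit); exact: (subgroup_unit hF0 fF).
have := ext_Ftilde_field jr0 yL y0 fF hyj.
by rewrite hr1max // ltn_Pmull.
Qed.

Lemma maximal_not_minus4 a : F1 a -> v a = r1%:R^-1 -> a \in L ->
  forall b, b \in L -> 4%:R * b ^+ 4 <> - a.
Proof.
move=> F1a va aL; have [n1|n1] := boolP (-1 \in F0).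
  (* [- a = (2 b ^ 2) ^ 2] is again an element of [F1] of valuation [1/r1]. *)
  move=> b bL hb; apply: (@maximal_no_root (- a) (2%:R * b ^+ 2) 2) => //.
  - rewrite -mulN1r eF1; apply: (subgroupM (ext_subgroup hF0 x1C)); first exact: ext_F0.
    by rewrite -eF1.
  - by rewrite (vN hvD).
  - by rewrite memvM ?memvX ?(subfield1 hL) // rpredMn // (subfield1 hL).
  rewrite -hb exprMn_comm; last by rewrite /GRing.comm mulr_natl mulr_natr.
  by rewrite -exprM -natrX.
have [z [hz zF Fz]] := F0_cyclic hdiv F0C hF0.
have [f fF ha] := F1_pow_pu F1a va.
have na b : b \in L -> b ^+ 2 <> a by apply: maximal_no_root.
have hN := N_odd hdiv F0C hF0 n1.
(* Raising [a ^ r1 = f * pu] to the order of [F0] removes [f] and leaves a power of [p * u] in [K]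
   whose valuation is that odd order. *)
apply: (not_minus4_fourth hz Fz hK (m := (r1 * size (undup F0))%N) (c := (p%:R * u) ^+ size (undup F0)) _ _ _ hN na).
- by rewrite expf_neq0 // pu_neq0.
- rewrite exprM ha exprMn_comm; last exact/esym/pu_comm.
  rewrite (F0_exp hdiv F0C hF0 fF) mul1r /pu /pu_elt.
  by elim: (size _) => [|k IH]; rewrite ?expr0 ?scale1r // !exprS IH -scalerAl mul1r scalerA.
- by rewrite (vX (padic_valued hK)) ?pu_neq0 // vp_pu.
Qed.

Lemma centralizer_dvd r2 F2 : Ftilde_centralizer p v n u F0 F1 r2 F2 -> (r2 * \dim L %| n)%N.
Proof.
move=> [[gF2 F2C] [_ puF2 _] e12 [_ inj] idx].
have gF1 : is_subgroup F1 by rewrite eF1; exact: ext_subgroup.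
have F2pu : F2 pu by apply: puF2; exists 1.
have [s [x [s0 F2x vx gen]]] := exists_val_generator gF2 F2pu.
have F12 : F1 `<=` F2 by rewrite -e12; apply: subIsetl.
have F1x1 : F1 x1 by rewrite eF1; exact: ext_gen.
have x0 := subgroup_neq0 gF2 F2x.
have vx0 : 0 < v x by rewrite vx invr_gt0 ltr0n.
have [k hk] := gen _ (F12 _ F1x1).
have k0 : 0 < k.
  have : 0 < v x *~ k by rewrite -hk vx1 invr_gt0 ltr0n.
  by rewrite pmulrz_rgt0.
pose j := `|k|%N; have ej : k = j%:Z by rewrite gez0_abs // ltW.
have j0 : (0 < j)%N by rewrite absz_gt0 gt_eqF.
have crit z : F2 z -> (F1 z <-> exists l : int, v z = v x *~ (l * j%:Z)).
  move=> F2z; have := inj z 1 F2z (subgroup1 gF2); rewrite (v1 hvD) subr0 invr1 mul1r => <-.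
  split=> [[y F1y <-]|[l hl]].
    have [l ->] : exists l : int, v y = v x1 *~ l by apply: (ext_val hvD hF0 vF x1C); rewrite -eF1.
    by exists l; rewrite hk ej -mulrzA mulrC.
  exists (x1 ^ l); first exact: subgroupXz.
  by rewrite (vXz hvD) // hk ej -mulrzA hl mulrC.
have er : r2 = j by apply: (index_is_inj idx); exact: (index_val hvD gF2 gF1 F12 F2x (lt0r_neq0 vx0) j0 gen crit).
have F1a : F1 (x ^+ j).
  by apply/crit; [exact: subgroupX|exists 1; rewrite mul1r (vX hvD)].
have va : v (x ^+ j) = r1%:R^-1 by rewrite (vX hvD) // pmulrn -ej -hk vx1.
have aL : x ^+ j \in L by move: F1a; rewrite -e12 => -[_ []].
have xC : x \in 'C(L)%VS by apply: cent_adjoin_seq; exact: (F2C _ F2x).2.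
have /dvdnP[m hm] := subfield_dim_dvd hp hn hK hv hdiv dimD hc hL.
(* As [dim L] divides [n], divisibility of the quotient by [j] can be tested on prime powers. *)
rewrite er {1}hm dvdn_pmul2r ?adim_gt0 //; apply/dvdn_partP => // q.
rewrite mem_primes => /and3P[hq _ qj]; rewrite p_part.
rewrite -(dvdn_pmul2r (adim_gt0 L)) -hm.
have ha b : b \in L -> b ^+ q <> x ^+ j by apply: maximal_no_root F1a va (prime_gt1 hq).
have /dvdnP[r' hr'] := pfactor_dvdnn q j.
have hx : (x ^+ r') ^+ (q ^ logn q j) = x ^+ j by rewrite -exprM -hr'.
have xC' : x ^+ r' \in 'C(L)%VS by apply: centvX.
have h4 := maximal_not_minus4 F1a va aL.
have [q2|q2] := eqVneq q 2%N.
  move: hx ha; rewrite q2 => hx ha.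
  exact: (root_degree2 hp hn hK hv hdiv dimD hc hL xC' aL hx ha h4).
apply: (root_degree hp hn hK hv hdiv dimD hc hq hL xC' aL hx ha).
by move=> q2'; rewrite q2' eqxx in q2.
Qed.

Lemma centralizer_exists r2 : (0 < r2)%N -> (r2 * \dim L %| n)%N ->
  Ftilde_centralizer p v n u F0 F1 r2 !=set0.
Proof.
move=> r20 hr2.
have [x xC hx] := cent_root hp hn hK hv hdiv dimD hc hL r20 hr2 x1L x10.
have x0 : x != 0 by apply: contraNneq x10 => x0; rewrite -hx x0 expr0n gtn_eqF.
have xCF : commutes F0 x.
  by split=> [|f fF]; [exact: hdiv|apply: (centvP xC); exact: mem_adjoin].
have r0 : (0 < r2 * r1)%N by rewrite muln_gt0 r20.
have hx' : x ^+ (r2 * r1) = f1 * pu by rewrite exprM hx.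
have vx := root_pu_val r0 x0 f1F hx'.
have vx0 : v x != 0 by rewrite vx invr_eq0 pnatr_eq0 -lt0n.
have eF : F1 = cyc_ext F0 (x ^+ r2) by rewrite hx.
have gF2 := ext_subgroup hF0 xCF.
have gF1 : is_subgroup F1 by rewrite eF1; exact: ext_subgroup.
have idx := ext_index hvD hF0 vF xCF vx0 r20; rewrite -eF in idx.
have F12 : F1 `<=` cyc_ext F0 x by rewrite eF; apply: ext_pow_sub.
have crit := ext_pow hvD hF0 vF r2 xCF vx0; rewrite -eF in crit.
have F1pu : F1 pu.
  rewrite eF1; apply: (ext_pow_sub hF0 (s := r1) x1C); rewrite hx1 (ext_shift hF0 F0C f1F puC).
  exact: ext_gen.
exists (cyc_ext F0 x); split=> //.
- split=> // z Gz; split; first exact: (subgroup_unit gF2 Gz).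
  move=> f fF; case: Gz => h hF [_ [k _ <-] <-].
  have xf : x ^ k * f = f * x ^ k by apply/esym/commrXz/esym/xCF.2.
  by rewrite -mulrA xf !mulrA (F0C hF fF).
- split; first exact: cyclic_is_subgroup pu_unit.
    by move=> _ [k _ <-]; apply: subgroupXz => //; apply: F12.
  exact: (ext_finite_cosets hF0 xCF puC f1F r0 hx').
- apply/seteqP; split=> [z [Gz [zL _]]|z F1z]; last first.
    split; first exact: F12.
    apply: mem_adjoin_unit; last exact: subgroup_neq0 gF1 F1z.
    move: F1z; rewrite eF1 => -[h hF [_ [k _ <-] <-]].
    by apply: memvM; [exact: mem_adjoin|exact: adjoin_Xz].
  (* If [h * x ^ k] lies in [L], so does [x ^ i] with [i = k mod r2]. For [i > 0], Bezout puts
     [x ^ d] in [L] with [d = gcd(i, r2) < r2], and its power of exponent [r2 / d] is [x1], against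
     maximality of [r1]. *)
  have [h hF [_ [k _ <-] e]] := Gz; rewrite -e in Gz zL *.
  have ux : x \is a GRing.unit by apply: hdiv.
  have kmod : (k %% r2%:Z)%Z >= 0 by apply: modz_ge0; rewrite eqz_nat -lt0n.
  pose i := `|(k %% r2%:Z)%Z|%N; pose t := (k %/ r2%:Z)%Z.
  have lti : (i < r2)%N by rewrite -ltz_nat gez0_abs // ltz_pmod.
  have ek : x ^ k = x ^+ i * x1 ^ t.
    rewrite -hx [x ^+ r2]exprnP exprz_exp [x ^+ i]exprnP -exprzDr //; congr (_ ^ _).
    by rewrite gez0_abs // addrC mulrC -divz_eq.
  have [i0|i0] := posnP i.
    by rewrite ek i0 expr0 mul1r eF1; exists h => //; exists (x1 ^ t) => //; exists t.
  have xiL : x ^+ i \in L.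
    have -> : x ^+ i = h^-1 * (h * x ^ k) * x1 ^ (- t).
      by rewrite (mulKr (subgroup_unit hF0 hF)) ek -mulrA -exprzDr ?hdiv // subrr expr0z mulr1.
    by rewrite memvM ?adjoin_Xz // memvM // memvV mem_adjoin.
  case: (egcdnP r2 i0) => a b eab _.
  pose d := gcdn i r2; have d0 : (0 < d)%N by rewrite gcdn_gt0 i0.
  have xdL : x ^+ d \in L.
    have -> : x ^+ d = (x1 ^+ b)^-1 * (x ^+ i) ^+ a.
      by rewrite -hx -!exprM [(i * a)%N]mulnC eab mulnC exprD mulKr // unitrX.
    have L1 := subfield1 hL; apply: memvM; last exact: memvX.
    by rewrite memvV; exact: memvX.
  have ed : r2 = (d * (r2 %/ d))%N by rewrite mulnC divnK // dvdn_gcdr.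
  have j1 : (1 < r2 %/ d)%N.
    rewrite ltnNge; apply/negP => j1; suff : (r2 <= i)%N by rewrite leqNgt lti.
    apply: leq_trans (dvdn_leq i0 (dvdn_gcdl i r2)); rewrite {1}ed -/d.
    by rewrite -[X in (_ <= X)%N]muln1 leq_mul2l j1 orbT.
  have F1x1 : F1 x1 by rewrite eF1; exact: ext_gen.
  by case: (maximal_no_root F1x1 vx1 j1 xdL); rewrite -exprM -ed.
- split=> [z Gz|z w Gz Gw]; first exact: val_fracs (subgroup_neq0 gF2 Gz).
  have Gt : cyc_ext F0 x (w^-1 * z) by apply: (subgroupM gF2) => //; apply: (subgroupV gF2).
  have z0 := subgroup_neq0 gF2 Gz; have w0 := subgroup_neq0 gF2 Gw.
  have wV0 : w^-1 != 0 by apply: (subgroup_neq0 gF2); apply: (subgroupV gF2).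
  have <- : v (w^-1 * z) = v z - v w by rewrite (valuationM hvD.1) // (vV hvD) // addrC.
  split=> [[y F1y hy]|F1t]; last by exists (w^-1 * z).
  by apply/(crit _ Gt); rewrite -hy; apply/(crit _ (F12 _ F1y)).
Qed.
End Maximal.
End MaximalExtensions.

(** The invariant fixes [v g] only up to an integer. Scaling [g] by a power of [p], which is
    central, gives [v g = 1/n] without changing conjugation. *)
Lemma Dn_has_coordinates (p n : nat) (K : fieldType) (vp : K -> rat) (D : falgType K) (v : D -> rat) :
  prime p -> (0 < n)%N -> is_padic_field p vp -> extends_valuation vp v -> is_Dn p v n ->
  exists (W : {aspace D}) (om g : D), Dn_coordinates p n v W om g.
Proof.
move=> hp hn hK hv hD; have hdiv := Dn_division hD.
have [W [g [hW dW gu hg [z _ hz]]]] := Dn_invariant hD.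
have dimW : \dim W = n.
  by apply/eqP; rewrite -(@eqn_exp2r _ _ 2) // dW (Dn_dim hD).
have g0 : g != 0 by apply: contraTneq gu => ->; rewrite unitr0.
have hvp := padic_valued hK.
pose c : K := p%:R ^ (- z).
have c0 : c != 0 by apply: expfz_neq0; exact: natK_p_neq0 hp hK.
have cg0 : c *: g != 0 by rewrite scaler_eq0 negb_or c0 g0.
have vg : v (c *: g) = n%:R^-1.
  by rewrite (vZ hv) // /c (vp_pz hp hK) rmorphN /= hz opprB addrNK.
have frob : conj_Frobenius p v W (c *: g).
  move=> x xW; rewrite invrZ ?unitfE // -!scalerAl -scalerAr scalerA mulfV // scale1r.
  exact: hg.
have [om hc] := exists_coordinates hp hK hv hdiv hn hW dimW cg0 vg frob (Dn_dim hD).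
by exists W, om, (c *: g).
Qed.

Theorem mainTheorem4 (p n : nat) (hp : prime p) (hn : (0 < n)%N)
  (K : fieldType) (vp : K -> rat) (hK : is_padic_field p vp)
  (D : falgType K) (v : D -> rat) (hv : extends_valuation vp v)
  (hD : is_Dn p v n)
  (O : set D) (hO : is_maximal_order vp O)
  (u : K) (hu : ring_units (val_ring vp) u)
  (F0 : seq D) (hF0 : is_subgroup [set` F0])
  (hF0S : [set` F0] `<=` ring_units O)
  (hF0ab : {in F0 &, forall x y, x * y = y * x})
  (r1 : nat)
  (hr1 : Ftilde_field p v n u F0 r1 !=set0)
  (hr1max : forall r : nat, (r1 < r)%N -> Ftilde_field p v n u F0 r = set0)
  (F1 : set D) (hF1 : Ftilde_field p v n u F0 r1 F1)
  (r2 : nat) (hr2 : (1 <= r2)%N) :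
  Ftilde_centralizer p v n u F0 F1 r2 !=set0 <->
  (r2 %| n %/ \dim (adjoin F0))%N.
Proof.
have hdiv := Dn_division hD; have dimD := Dn_dim hD.
have [W [om [g hc]]] := Dn_has_coordinates hp hn hK hv hD.
have hL := adjoin_is_subfield_seq hdiv hF0ab.
have dn := subfield_dim_dvd hp hn hK hv hdiv dimD hc hL.
have [x1 [f1 [r10 x1L x10 f1F [hx1 eF1]]]] := Ftilde_fieldP hp hn hK hv hdiv hc hu hF0 hF0ab hF1.
rewrite dvdn_divRL //; split=> [[F2 hF2]|h].
  exact: (centralizer_dvd hp hn hK hv hdiv dimD hc hu hF0 hF0ab hr1max r10 x1L x10 f1F hx1 eF1 hF2).
exact: (centralizer_exists hp hn hK hv hdiv dimD hc hu hF0 hF0ab hr1max r10 x1L x10 f1F hx1 eF1 hr2 h).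
Qed.
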